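(* There exists $n_0$ such that, for all $n\ge n_0$, the family of $n$-vertex graphs that contain $m_o^h(n)$ odd holes is $\mathcal{G}_n$.
   Context: All graphs are finite and simple. An odd hole is an induced cycle with an odd number of vertices and length at least 5. $m_o^h(n)$ denotes the maximum number of odd holes that can be contained in a graph on $n$ vertices. $N_B(x)$ denotes the neighbourhood of $x$ in $B$. A graph $B$ is a cyclic braid if there exist $k\ge 3$ and a partition $B_1,\dots,B_k$ of $V(B)$ such that for every $1\le i\le k$ and every $x\in B_i$ we have $B_{i-1}\cup B_{i+1}\subseteq N_B(x)\subseteq B_{i-1}\cup B_i\cup B_{i+1}$, indices modulo $k$. The sets $B_i$ are the clusters. Edges within clusters are allowed but not required. $\mathcal{G}_n$ is the family of all cyclic braids on $n$ vertices (with arbitrary edges inside the clusters and with the clusters of the given sizes placed in any cyclic order) whose clusters all have size 3 except for: - three clusters of size 2, when $n\equiv 0$ modulo 6; - two clusters of size 2, when $n\equiv 1$ modulo 6; - one cluster of size 2, when $n\equiv 2$ modulo 6; - no exceptions (all clusters of size 3), when $n\equiv 3$ modulo 6; - one cluster of size 4, when $n\equiv 4$ modulo 6; - either two clusters of size 4 or four clusters of size 2, when $n\equiv 5$ modulo 6. *)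

(* Defs.v *)
From mathcomp Require Import all_boot.

Set Implicit Arguments.
Unset Strict Implicit.
Unset Printing Implicit Defensive.

(* A finite simple graph on V, given by its edge set of unordered pairs. *)
Definition sgraph (V : finType) : finType :=
  {E : {set {set V}} | [forall A in E, #|A| == 2]}.

Section Graph.

Variables (V : finType) (G : sgraph V).

(* The diagonal is excluded because [set x; x] has one element. *)
Definition adj : rel V := [rel x y | [set x; y] \in val G].

Definition neighbours (x : V) : {set V} := [set y | adj x y].

(* c lists the vertices of S in cyclic order; two vertices of S are adjacent
   exactly when they are consecutive in c. *)
Definition induces_cycle (S : {set V}) : bool :=
  (3 <= #|S|) &&
  [exists c : #|S|.-tuple V,
    [&& uniq c, [set:: c] == S &
      [forall x in S, forall y in S,
        adj x y == (y == next c x) || (x == next c y)]]].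

(* An induced cycle is a subgraph determined by its vertex set, so odd holes
   are counted by their vertex sets. *)
Definition odd_hole (S : {set V}) : bool :=
  [&& induces_cycle S, odd #|S| & 5 <= #|S|].

Definition nb_odd_holes : nat := #|[set S | odd_hole S]|.

(* Injectivity together with partition says that the B i are nonempty,
   pairwise disjoint (as an indexed family) and cover V. The maps ord_pred
   and ordS are predecessor and successor modulo k. *)
Definition cyclic_braid_clusters (k : nat) (B : 'I_k -> {set V}) : Prop :=
  [/\ 3 <= k,
      injective B,
      partition [set B i | i : 'I_k] [set: V] &
      forall (i : 'I_k) (x : V), x \in B i ->
        B (ord_pred i) :|: B (ordS i) \subset neighbours x /\
        neighbours x \subset B (ord_pred i) :|: B i :|: B (ordS i)].

End Graph.

Definition max_odd_holes (n : nat) : nat :=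
  \max_(G : sgraph 'I_n) nb_odd_holes G.

(* All clusters have size 3, except for exactly j clusters of size s (used
   with s <> 3). *)
Definition size3_except (V : finType) (k : nat) (B : 'I_k -> {set V})
    (j s : nat) : Prop :=
  (forall i, #|B i| = 3 \/ #|B i| = s) /\ #|[set i | #|B i| == s]| = j.

Definition extremal_sizes (V : finType) (k : nat) (B : 'I_k -> {set V})
    (n : nat) : Prop :=
  match n %% 6 with
  | 0 => size3_except B 3 2
  | 1 => size3_except B 2 2
  | 2 => size3_except B 1 2
  | 3 => forall i, #|B i| = 3
  | 4 => size3_except B 1 4
  | _ => size3_except B 2 4 \/ size3_except B 4 2
  end.

Definition extremal_family (n : nat) (G : sgraph 'I_n) : Prop :=
  exists (k : nat) (B : 'I_k -> {set 'I_n}),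
    cyclic_braid_clusters G B /\ extremal_sizes B n.

(* Main.v *)
(* An induced path grown vertex by vertex, deleting the neighbours of each
   vertex it leaves, pays d vertices for a choice among d continuations.  Since
   d * gam m <= gam (d + m), with a definite loss when d <> 3, the number of
   holes is O(gam n), and if every vertex lies in at least c * gam n holes then
   the degrees are bounded and the second moment of 3|S| - n over all holes S
   is O(gam n).

   A vertex b outside a hole S that sees two far apart vertices of S either
   cuts S in two long pieces, which is rare by the loss above, or spans a short
   arc of S that can be exchanged for b.  Exchanges at distant places change the
   length of S independently, so by Bessel's inequality only few vertices b can
   do this for many S.  Hence some large ball contains none of them; inside it
   the growing process must follow disjoint layers of size 3, consecutive ones
   completely joined: a piece of a cyclic braid.

   Cutting the graph there, the odd holes become induced paths with an even
   number of inner vertices between two fixed vertices.  A graph with almost the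
   maximal number of such paths is layered throughout, because a vertex not joined to
   exactly the next layer loses an eighth of the paths of its siblings.  So an
   extremal graph all of whose vertices lie in many odd holes is a cyclic braid with clusters of
   size 2, 3 and 4; its odd holes are the transversals of the clusters, and it
   remains to maximise a product of cluster sizes with odd number of factors.

   Finally, if M(n) is the maximum and f(n) this product, then M(n-1) > 4/5 M(n)
   makes M/f grow by 16/15 from n to n - 1; as M/f is bounded and equals 1 as
   soon as the inequality fails, the inequality never holds for large n. *)

Require Import Defs.
From mathcomp Require Import all_boot all_order all_algebra.
From mathcomp Require Import zify ring lra.

Set Implicit Arguments.
Unset Strict Implicit.
Unset Printing Implicit Defensive.

Import Order.TTheory GRing.Theory Num.Theory.

(** * Weights of branching processes *)

(** Two weights divide the work. [gam] is deliberately not sharp and blind to parity, so that every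
    branching number other than 3 costs a fixed factor; but the extremal graphs themselves use the
    sizes 2 and 4, so this weight alone cannot identify them. [E9] is sharp and respects parity, but
    its recursion is about paths between two fixed ends. A single clean segment of bounded length
    links the two. It opens the cycle, and a hole that avoids its layer [X 2] avoids a long run of
    layers of size 3, hence lives on so many fewer vertices that such holes make up less than 1/32
    of the maximum, which is the gap of the exact recursion.

    The obstacle to finding the segment is that the branching process sees only edges towards
    vertices that are still available. A perfectly regular process may hide edges back to vertices
    deleted as neighbours of the path. The deleted end of such an edge is chordal in many holes,
    which is why often chordal vertices have to be shown rare beforehand. *)

Section Weights.
Local Open Scope ring_scope.
Variable R : archiRealFieldType.

(* gam m has order 3 ^ (m / 3); the values 36/25 and 52/25 at the residues 1 and
   2 leave room for the factor beta in every step with d <> 3 branches, which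
   the true maxima 4/3 and 2 would not. *)
Definition gam_small (r : nat) : R :=
  match r with 0 => 1 | 1 => 36%:R / 25%:R | _ => 52%:R / 25%:R end.

Definition gam (m : nat) : R := 3%:R ^+ (m %/ 3) * gam_small (m %% 3).

(** The case d = 2 of [gam_step_neq3] allows any factor up to 27/26, and [cube_le_betaX] asks for at
    least (101/100)^3; 33/32 lies between. *)
Definition beta : R := 33%:R / 32%:R.

Lemma gam_add3 m : gam m.+3 = 3%:R * gam m.
Proof.
rewrite /gam -(addn3 m) modnDr divnDr //= divnn addn1 exprS -mulrA //.
Qed.

Lemma gam_ind (P : nat -> Prop) : P 0 -> P 1 -> P 2 ->
  (forall m, P m -> P m.+3) -> forall m, P m.
Proof.
move=> P0 P1 P2 PS m.
suff [] : [/\ P m, P m.+1 & P m.+2] by [].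
elim: m => [|m [H0 H1 H2]]; first by split.
by split=> //; apply: PS.
Qed.

Lemma gam0 : gam 0 = 1. Proof. by rewrite /gam /= expr0 mul1r. Qed.
Lemma gam1 : gam 1 = 36%:R / 25%:R. Proof. by rewrite /gam /= expr0 mul1r. Qed.
Lemma gam2 : gam 2 = 52%:R / 25%:R. Proof. by rewrite /gam /= expr0 mul1r. Qed.

Lemma gam_gt0 m : 0 < gam m.
Proof.
elim/gam_ind: m => [|||m IH]; rewrite ?gam_add3 ?gam0 ?gam1 ?gam2; lra.
Qed.

Lemma gam_ge0 m : 0 <= gam m. Proof. exact: ltW (gam_gt0 m). Qed.

Lemma gamS_ge m : 36%:R / 25%:R * gam m <= gam m.+1.
Proof.
elim/gam_ind: m => [|||m IH]; rewrite ?gam_add3 ?gam0 ?gam1 ?gam2; lra.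
Qed.

Lemma gamS_le m : gam m.+1 <= 3%:R / 2%:R * gam m.
Proof.
elim/gam_ind: m => [|||m IH]; rewrite ?gam_add3 ?gam0 ?gam1 ?gam2; lra.
Qed.

Lemma gamSS_ge m : 27%:R / 13%:R * gam m <= gam m.+2.
Proof.
elim/gam_ind: m => [|||m IH]; rewrite ?gam_add3 ?gam0 ?gam1 ?gam2; lra.
Qed.

Lemma gam_ge_exp m k : (36%:R / 25%:R) ^+ k * gam m <= gam (k + m)%N.
Proof.
elim: k => [|k IH]; first by rewrite expr0 mul1r.
rewrite addSn; apply: le_trans (gamS_ge _); rewrite exprS -[X in X <= _]mulrA.
by rewrite ler_pM2l //; lra.
Qed.

Lemma gam_le_exp m k : gam (k + m)%N <= (3%:R / 2%:R) ^+ k * gam m.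
Proof.
elim: k => [|k IH]; first by rewrite expr0 mul1r.
rewrite addSn; apply: le_trans (gamS_le _) _; rewrite exprS -[X in _ <= X]mulrA.
by rewrite ler_pM2l //; lra.
Qed.

Lemma gam_homo m k : (m <= k)%N -> gam m <= gam k.
Proof.
move=> /subnK <-; apply: le_trans (gam_ge_exp _ _).
by apply: ler_peMl; [exact: ltW (gam_gt0 _) | apply: exprn_ege1; lra].
Qed.

Lemma beta_ge1 : 1 <= beta. Proof. rewrite /beta; lra. Qed.
Lemma betaX_ge0 k : 0 <= beta ^+ k.
Proof. by apply: exprn_ge0; rewrite /beta; lra. Qed.
Lemma betaX_ge1 k : 1 <= beta ^+ k.
Proof. exact: exprn_ege1 beta_ge1. Qed.

Lemma gam_ge_betaX m : beta ^+ m <= gam m.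
Proof.
apply: (@le_trans _ _ ((36%:R / 25%:R) ^+ m)).
  by rewrite lerXn2r ?nnegrE //; rewrite /beta; lra.
by have := gam_ge_exp 0 m; rewrite gam0 mulr1 addn0.
Qed.

(** For d >= 4, three of the d vertices yield the factor 3 exactly and each further one at least
    36/25. Already at d = 4 this gives 108/25, more than 4 times [beta], and it grows faster than
    d. *)
Lemma gam_step_neq3 d m : d != 3 -> beta * d%:R * gam m <= gam (d + m)%N.
Proof.
have g0 := gam_gt0 m.
case: d => [|[|[|[|d]]]] // _; rewrite ?mulr0 ?mul0r ?(ltW (gam_gt0 _)) //.
- have := gamS_ge m; rewrite /beta add1n; lra.
- have := gamSS_ge m; rewrite /beta add2n; lra.
rewrite [(_ + m)%N](_ : _ = (d.+1 + m).+3) ?gam_add3; last by lia.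
have H := gam_ge_exp m d.+1.
have : beta * d.+4%:R <= 3%:R * (36%:R / 25%:R) ^+ d.+1 :> R.
  elim: d {H} => [|d IH]; first by rewrite expr1 /beta; lra.
  rewrite exprS (_ : d.+1.+4 = (1 + d.+4)%N) // natrD mulrDr mulr1.
  move: IH; set x := _ ^+ _; set y := beta * _ => IH.
  have : beta * 4%:R <= y.
    by rewrite ler_wpM2l // ?ler_nat // /beta; lra.
  rewrite {1 2}/beta; lra.
move=> H2; have : beta * d.+4%:R * gam m <= 3%:R * (36%:R / 25%:R) ^+ d.+1 * gam m.
  by rewrite ler_pM2r.
move=> H3; apply: (le_trans H3); rewrite -mulrA ler_pM2l //.
Qed.

Lemma gam_step d m : d%:R * gam m <= gam (d + m)%N.
Proof.
have g0 := gam_gt0 m.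
have [->|d3] := eqVneq d 3; first by rewrite add3n gam_add3.
apply: le_trans (gam_step_neq3 m d3); rewrite ler_pM2r //.
by rewrite ler_peMl ?beta_ge1 // ler0n.
Qed.

(** b + 1 stays below 100 times the b-th power of 101/100, and the cube of this base is below
    [beta]. The third power is what the second moment of the hole lengths will need. *)
Lemma cube_le_betaX b : (b%:R + 1) ^+ 3 <= 100%:R ^+ 3 * beta ^+ b :> R.
Proof.
have H : b%:R + 1 <= 100%:R * (101%:R / 100%:R) ^+ b :> R.
  elim: b => [|b IH]; first by rewrite expr0; lra.
  rewrite exprS -natr1; move: IH; set x := _ ^+ b => IH.
  have : 1 <= x by apply: exprn_ege1; lra.
  lra.
apply: (@le_trans _ _ ((100%:R * (101%:R / 100%:R) ^+ b) ^+ 3)).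
  by rewrite lerXn2r ?nnegrE // ?addr_ge0 ?ler0n // mulr_ge0 ?exprn_ge0 //; lra.
rewrite exprMn -!exprM mulnC exprM.
rewrite ler_pM2l ?exprn_gt0 ?ltr0n //.
by rewrite lerXn2r ?nnegrE // /beta; lra.
Qed.

Lemma betaE : beta = 33%:R / 32%:R. Proof. by []. Qed.

End Weights.

Global Opaque gam beta.

Arguments Defs.adj : simpl never.

(** * Induced paths and holes *)

Section InducedPaths.

Variables (V : finType) (G : sgraph V).
Local Notation adj := (adj G).
Local Notation N := (neighbours G).

Lemma adjC x y : adj x y = adj y x.
Proof.
by change (([set x; y] \in val G) = ([set y; x] \in val G)); rewrite setUC.
Qed.

Lemma adjxx x : adj x x = false.
Proof.
apply/negP=> xx; have /forallP/(_ [set x; x]) := valP G.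
by rewrite [_ \in _]xx setUid cards1.
Qed.

Lemma adj_neq x y : adj x y -> x != y.
Proof. by move=> xy; apply/eqP=> e; rewrite e adjxx in xy. Qed.

Lemma in_nbr x y : (y \in N x) = adj x y.
Proof. by rewrite inE. Qed.

(* u followed by p and then y is an induced path with p inside R, provided that
   neither u nor y is in R. *)
Fixpoint ipath (y u : V) (R : {set V}) (p : seq V) : bool :=
  if p is x :: p' then
    [&& ~~ adj u y, x \in N u :&: R & ipath y x (R :\: N u) p']
  else adj u y.

Fixpoint induced_path (s : seq V) : bool :=
  if s is x :: s' then
    [&& (if s' is z :: s'' then adj x z && all (fun w => ~~ adj x w) s''
         else true), x \notin s' & induced_path s']
  else true.

Definition hole_seq (c : seq V) : Prop :=
  uniq c /\ {in c &, forall x y, adj x y = (y == next c x) || (x == next c y)}.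

Lemma hole_seq_rot k c : hole_seq c -> hole_seq (rot k c).
Proof.
move=> [Uc Hc]; split; first by rewrite rot_uniq.
by move=> x y; rewrite !mem_rot => xc yc; rewrite !next_rot // Hc.
Qed.

Lemma next_nth_lt (x0 : V) c i : uniq c -> i < size c ->
  next c (nth x0 c i) = nth x0 c (i.+1 %% size c).
Proof.
case: c => // z c Uc ic; rewrite next_nth mem_nth // index_uniq //.
case: (ltnP i.+1 (size (z :: c))) => h.
  by rewrite modn_small //= (set_nth_default x0).
have -> : i.+1 = size (z :: c) by apply/eqP; rewrite eqn_leq h ic.
rewrite modnn /= nth_default //; by move: h ic => /=; lia.
Qed.

Lemma hole_seq_nthP (x0 : V) c : 3 <= size c ->
  hole_seq c <->
  uniq c /\ forall i j, i < j < size c ->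
    adj (nth x0 c i) (nth x0 c j) =
      (j == i.+1) || ((i == 0) && (j == (size c).-1)).
Proof.
move=> c3; have c0 : 0 < size c by lia.
have key i j : uniq c -> i < j < size c ->
  (nth x0 c j == next c (nth x0 c i)) || (nth x0 c i == next c (nth x0 c j))
   = (j == i.+1) || ((i == 0) && (j == (size c).-1)).
  move=> Uc /andP [ij jc]; have ic := ltn_trans ij jc.
  rewrite !next_nth_lt // !nth_uniq ?ltn_mod ?c0 //.
  rewrite (modn_small (leq_ltn_trans ij jc)).
  case: (ltnP j.+1 (size c)) => h.
    rewrite modn_small //; lia.
  have -> : j.+1 = size c by apply/eqP; rewrite eqn_leq h jc.
  rewrite modnn; lia.
split=> [] [Uc Hc]; split=> //.
  move=> i j H; rewrite Hc ?mem_nth ?key //; case/andP: H => // ij jc.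
  exact: ltn_trans ij jc.
move=> x y /(nthP x0) [i ic <-] /(nthP x0) [j jc <-].
case: (ltngtP i j) => [ij|ij|<-].
- by rewrite key ?ij // Hc ?ij.
- by rewrite adjC orbC key ?ij // Hc ?ij.
rewrite adjxx orbb next_nth_lt // nth_uniq // ?ltn_mod ?c0 //.
case: (ltnP i.+1 (size c)) => h; first by rewrite modn_small // -addn1 -{1}[i]addn0 eqn_add2l.
have ei : i.+1 = size c by apply/eqP; rewrite eqn_leq h ic.
by rewrite ei modnn; apply/esym/negbTE; lia.
Qed.

Lemma induced_path_nthP (x0 : V) s :
  induced_path s <->
  uniq s /\ forall i j, i < j < size s ->
    adj (nth x0 s i) (nth x0 s j) = (j == i.+1).
Proof.
elim: s => [|x s IH]; first by split=> // _; split=> // i j /andP [_].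
split=> [/and3P [H xs /IH [Us Hs]]|[/andP [xs Us] Hs]].
  split; first by rewrite /= xs.
  move=> [|i] [|j] //=; rewrite !ltnS; last by move/Hs ->.
  move=> js; case: s H js {xs IH Us Hs} => // z s /andP [xz al] js.
  case: j js => [|j] js //=.
  by apply/negbTE; apply: (allP al); apply: mem_nth.
apply/and3P; split=> //; last first.
  apply/IH; split=> // i j H; by have := Hs i.+1 j.+1 H.
case: s {IH xs Us} Hs => // z s Hs; rewrite (Hs 0 1) //=.
apply/(all_nthP x0) => i si; by rewrite (Hs 0 i.+2).
Qed.

Lemma induced_path_uniq s : induced_path s -> uniq s.
Proof.
case: s => // x s; by move/(induced_path_nthP x) => [].
Qed.

Lemma ipath_of_induced y u (R : {set V}) p :
  induced_path (u :: rcons p y) -> {subset p <= R} -> ipath y u R p.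
Proof.
elim: p u R => [|x p IH] u R.
  by move=> /and3P [/andP []].
rewrite rcons_cons => /and3P [/andP [ux al] _ ip] pR.
change [&& ~~ adj u y, x \in N u :&: R & ipath y x (R :\: N u) p].
move: al; rewrite all_rcons => /andP [-> /allP al].
rewrite inE in_nbr ux pR ?mem_head //= IH // => z zp.
by rewrite inE in_nbr al // pR // inE zp orbT.
Qed.

Lemma ipath_sub y u (R : {set V}) p : ipath y u R p -> {subset p <= R}.
Proof.
elim: p u R => [|x p IH] u R //= /and3P [_ xR /IH pR] z.
rewrite inE => /orP [/eqP ->|/pR]; first by case/setIP: xR.
by rewrite inE => /andP [].
Qed.

Lemma ipath_mono y u (R R' : {set V}) p :
  R \subset R' -> ipath y u R p -> ipath y u R' p.
Proof.
elim: p u R R' => [|x p IH] u R R' RR' //= /and3P [-> xR ip].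
rewrite (IH _ _ _ _ ip) ?setSD // andbT /=.
by apply: (subsetP _ _ xR); apply: setIS.
Qed.

Lemma ipath_restrict y u (R R' : {set V}) p :
  {subset p <= R'} -> ipath y u R p -> ipath y u R' p.
Proof.
elim: p u R R' => [|x p IH] u R R' pR //= /and3P [-> xR ip] /=.
rewrite inE (pR x) ?mem_head // andbT; case/setIP: xR => -> _ /=.
apply: (IH _ (R :\: N u)) => // z zp.
have := ipath_sub ip zp; rewrite !inE => /andP [-> _].
by rewrite pR // inE zp orbT.
Qed.

Lemma ipath_induced y u (R : {set V}) p :
  u \notin R -> y \notin R -> u != y -> ipath y u R p ->
  induced_path (u :: rcons p y).
Proof.
elim: p u R => [|x p IH] u R uR yR uy.
  by rewrite /= => ->; rewrite inE uy.
move=> /and3P [nuy /setIP [ux xR] ip].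
have xy : x != y by apply: contraNneq yR => <-.
rewrite in_nbr in ux; rewrite rcons_cons.
have sub := ipath_sub ip.
change [&& adj u x && all (fun w => ~~ adj u w) (rcons p y),
  u \notin x :: rcons p y & induced_path (x :: rcons p y)].
rewrite ux all_rcons nuy (IH _ _ _ _ xy ip) ?inE ?ux ?(negbTE yR) ?andbF //=.
rewrite andbT negb_or (adj_neq ux) mem_rcons inE negb_or uy /=; apply/andP; split.
  by apply/allP => z /sub; rewrite inE in_nbr => /andP [].
by apply: contra uR => /sub; rewrite inE => /andP [].
Qed.

(** The next vertex of an induced path is the only neighbour of the current one in its vertex set,
    so the order can be read off from the set. This lets holes be counted as sets while paths are
    generated as sequences. *)
Lemma ipath_inj y u (R : {set V}) p q :
  ipath y u R p -> ipath y u R q -> p =i q -> p = q.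
Proof.
elim: p u R q => [|x p IH] u R [|z q] //.
- by move=> _ _ /(_ z); rewrite mem_head.
- by move=> _ _ /(_ x); rewrite mem_head.
move=> /and3P [_ xu ip] /and3P [_ zu iq] e.
have xz : x = z.
  have : x \in z :: q by rewrite -e mem_head.
  rewrite inE => /orP [/eqP //|/(ipath_sub iq)].
  by rewrite inE; case/setIP: xu => ->.
subst z; congr (_ :: _); apply: (IH _ _ _ ip iq) => w.
have := e w; rewrite !inE; case: (eqVneq w x) => //= -> _.
have nx r : ipath y x (R :\: N u) r -> x \notin r.
  move=> ir; apply/negP=> /(ipath_sub ir); rewrite inE.
  by case/setIP: xu => ->.
by rewrite (negbTE (nx _ ip)) (negbTE (nx _ iq)).
Qed.

(** [k] is fuel bounding the number of inner vertices. Once the current vertex sees [y], the only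
    induced way on is to stop. *)
Fixpoint pths k y u (R : {set V}) : seq (seq V) :=
  if adj u y then [:: [::]] else
  if k is k'.+1 then
    flatten [seq [seq x :: p | p <- pths k' y x (R :\: N u)]
            | x <- enum (N u :&: R)]
  else [::].

Lemma mem_pths k y u R p : (p \in pths k y u R) = ipath y u R p && (size p <= k).
Proof.
elim: k u R p => [|k IH] u R p.
  rewrite [pths _ _ _ _]/=; case: p => [|x p]; last by case: ifP; rewrite /= ?andbF.
  by rewrite /= andbT; case: ifP.
rewrite [pths _ _ _ _]/=; case uy: (adj u y).
  by case: p => [|x p] /=; rewrite ?uy ?inE.
case: p => [|x p].
  rewrite /= uy /=; apply/flatten_mapP => -[x _ /mapP []] //.
rewrite [ipath _ _ _ _]/= uy /= ltnS.
apply/flatten_mapP/idP => [[z zu /mapP [q qp [-> ->]]]|/andP [/andP [xu ip] sp]].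
  by rewrite IH in qp; rewrite mem_enum in zu; rewrite zu.
exists x; first by rewrite mem_enum.
by apply/mapP; exists p => //; rewrite IH ip.
Qed.

Lemma pths_uniq k y u R : uniq (pths k y u R).
Proof.
elim: k u R => [|k IH] u R; first by rewrite /=; case: ifP.
rewrite [pths _ _ _ _]/=; case: ifP => // _.
elim: (enum _) (enum_uniq (N u :&: R)) => //= x s IHs /andP [xs us].
rewrite cat_uniq IHs // map_inj_uniq ?IH ?andbT //=; last by move=> ? ? [].
apply/hasPn => p /flatten_mapP [z zs /mapP [q _ ->]].
apply/negP => /mapP [q' _ [e _]]; by rewrite -e zs in xs.
Qed.

Section Sums.
Variables (T : nmodType).
Local Open Scope ring_scope.

Lemma sum_pthsS k y u R (F : seq V -> T) :
  \sum_(p <- pths k.+1 y u R) F p =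
  if adj u y then F [::] else
  \sum_(x in N u :&: R) \sum_(p <- pths k y x (R :\: N u)) F (x :: p).
Proof.
rewrite [pths _ _ _ _]/=; case: ifP => _; first by rewrite big_seq1.
rewrite big_flatten big_map big_enum /=.
by apply: eq_bigr => x _; rewrite big_map.
Qed.

End Sums.

Lemma hole_seq_of_path v u y p :
  induced_path (u :: rcons p y) -> p != [::] ->
  v \notin u :: rcons p y -> adj v u -> adj v y ->
  {in p, forall z, ~~ adj v z} ->
  hole_seq (v :: u :: rcons p y).
Proof.
move=> ip p0 vn vu vy vp.
have [Us Hs] := (induced_path_nthP v _).1 ip.
have p1 : 0 < size p by rewrite lt0n size_eq0.
apply/(hole_seq_nthP v); first by rewrite /= size_rcons; lia.
split; first by rewrite cons_uniq vn Us.
move=> i j; rewrite [size _]/= size_rcons => ij.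
case: i ij => [|i] /andP [ij jl]; last first.
  case: j ij jl => // j ij jl.
  rewrite -[nth v _ i.+1]/(nth v (u :: rcons p y) i).
  rewrite -[nth v _ j.+1]/(nth v (u :: rcons p y) j).
  rewrite Hs; first by rewrite eqSS orbF.
  by rewrite /= size_rcons; apply/andP; split.
case: j jl ij => // j jl _; rewrite -[nth v _ 0]/v.
case: j jl => [|j] jl; first by rewrite /= vu.
rewrite -[nth v _ j.+2]/(nth v (rcons p y) j) nth_rcons.
case: ifP => jp; first by rewrite (negbTE (vp _ _)) ?mem_nth //= !eqSS ltn_eqF.
have ej : j = size p by apply/eqP; rewrite eqn_leq (leqNgt (size p)) jp andbT -ltnS -ltnS.
by rewrite ej /= !eqxx vy.
Qed.

Lemma hole_seq_path v u y p :
  hole_seq (v :: u :: rcons p y) -> p != [::] ->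
  [/\ induced_path (u :: rcons p y), v \notin u :: rcons p y, adj v u, adj v y
    & {in p, forall z, ~~ adj v z}].
Proof.
move=> hs p0.
have p1 : 0 < size p by rewrite lt0n size_eq0.
have [] := (hole_seq_nthP v _).1 hs; first by rewrite /= size_rcons; lia.
rewrite cons_uniq => /andP [vn Us] H.
have sz : size (v :: u :: rcons p y) = (size p).+3 by rewrite /= size_rcons.
rewrite sz in H.
split=> //.
- apply/(induced_path_nthP v); split=> // i j; rewrite /= size_rcons => ij.
  by rewrite (H i.+1 j.+1) ?eqSS ?orbF.
- by have := H 0 1; rewrite /= => ->; rewrite ?eqxx.
- by have := H 0 (size p).+2; rewrite /= nth_rcons ltnn eqxx => ->; rewrite ?eqxx ?orbT.
move=> z /(nthP v) [i ip <-]; have := H 0 i.+2.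
rewrite [nth v _ i.+2]/= nth_rcons ip => ->; first by rewrite /= !eqSS ltn_eqF.
by rewrite /= !ltnS ltnW.
Qed.

Lemma hole_seq_induces c : hole_seq c -> 3 <= size c ->
  induces_cycle G [set:: c].
Proof.
move=> [Uc Hc] c3.
have sz : #|[set:: c]| = size c.
  by rewrite cardsE (card_uniqP Uc).
rewrite /induces_cycle sz c3 /=; apply/existsP.
exists (in_tuple c).
rewrite /= Uc eqxx /=.
apply/forallP => x; apply/implyP; rewrite inE => xc.
apply/forallP => y; apply/implyP; rewrite inE => yc.
by apply/eqP; apply: Hc.
Qed.

Lemma induces_hole_seq S : induces_cycle G S ->
  exists c, [/\ hole_seq c, [set:: c] = S & size c = #|S|].
Proof.
case/andP=> _ /existsP [c /and3P [Uc /eqP cS H]].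
exists c; rewrite size_tuple; split=> //; split=> // x y xc yc.
have xS : x \in S by rewrite -cS inE.
have yS : y \in S by rewrite -cS inE.
by move/forallP: H => /(_ x)/implyP/(_ xS)/forallP/(_ y)/implyP/(_ yS)/eqP.
Qed.

(** Parity is left out on purpose: exchanging arcs does not preserve it, and the second moment
    argument needs a family closed under exchanges. *)
Definition hole (S : {set V}) := induces_cycle G S && (5 <= #|S|).

Lemma odd_hole_hole S : odd_hole G S -> hole S.
Proof. by rewrite /hole => /and3P [-> _ ->]. Qed.

Lemma hole_rooted S v : hole S -> v \in S ->
  exists u y p, [/\ hole_seq (v :: u :: rcons p y),
    S = [set:: v :: u :: rcons p y], #|S| = (size p).+3 & 1 < size p].
Proof.
move=> /andP [/induces_hole_seq [c [hc cS sc]] S5] vS.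
have vc : v \in c by rewrite -cS inE in vS.
have [i d rot_c] := rot_to vc.
have := hole_seq_rot i hc; rewrite rot_c => hd.
have sd : size (v :: d) = #|S| by rewrite -rot_c size_rot.
have Sd : S = [set:: v :: d].
  by rewrite -rot_c -cS; apply/setP => z; rewrite !inE mem_rot.
case: d sd hd {rot_c} Sd => [|u d]; first by move=> /= e; rewrite -e in S5.
case/lastP: d => [|p y]; first by move=> /= e; rewrite -e in S5.
move=> sd hd Sd; exists u, y, p; split=> //; move: sd; rewrite /= size_rcons; lia.
Qed.

Lemma ipath_hole v u y p : u \in N v -> y \in N v -> u != y -> 1 < size p ->
  ipath y u (~: (v |: N v)) p ->
  hole_seq (v :: u :: rcons p y) /\ hole [set:: v :: u :: rcons p y].
Proof.
rewrite !in_nbr => vu vy uy p1 ip.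
have p0 : p != [::] by case: p p1 {ip}.
have inR z : adj v z -> z \notin ~: (v |: N v).
  by move=> vz; rewrite !inE vz orbT.
have sub := ipath_sub ip.
have vp z : z \in p -> (v != z) && ~~ adj v z.
  by move/sub; rewrite !inE negb_or eq_sym.
have ind := ipath_induced (inR _ vu) (inR _ vy) uy ip.
have hs : hole_seq (v :: u :: rcons p y).
  apply: hole_seq_of_path => //; last by move=> z /vp /andP [].
  rewrite inE (negbTE (adj_neq vu)) mem_rcons inE (negbTE (adj_neq vy)) /=.
  by apply/negP => /vp; rewrite eqxx.
split=> //; apply/andP; split.
  by apply: hole_seq_induces => //=; rewrite size_rcons; lia.
by rewrite cardsE (card_uniqP hs.1) /= size_rcons; lia.
Qed.

End InducedPaths.

Global Opaque Defs.adj.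

(** * Elementary estimates for finite sums *)

Section SumLemmas.
Local Open Scope ring_scope.
Variable F : archiRealFieldType.

Lemma ler_sum_subseq (T : eqType) (s1 s2 : seq T) (f : T -> F) :
  (forall x, 0 <= f x) -> uniq s1 -> {subset s1 <= s2} ->
  \sum_(x <- s1) f x <= \sum_(x <- s2) f x.
Proof.
move=> f0; elim: s1 s2 => [|x s1 IH] s2 /=.
  by rewrite big_nil => _ _; apply: sumr_ge0.
move=> /andP [xs1 U1] sub.
have xs2 : x \in s2 by apply: sub; rewrite mem_head.
rewrite big_cons (perm_big _ (perm_to_rem xs2)) big_cons lerD2l.
apply: IH => // z zs1; have := sub z; rewrite inE zs1 orbT => /(_ isT) zs2.
have zx : z != x by apply: contraNneq xs1 => <-.
by move: zs2; rewrite (perm_mem (perm_to_rem xs2)) inE (negbTE zx).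
Qed.

Lemma sum_const_le (I : finType) (A : {set I}) (f : I -> F) (c : F) d :
  0 <= c -> (#|A| <= d)%N -> (forall i, i \in A -> f i <= c) ->
  \sum_(i in A) f i <= d%:R * c.
Proof.
move=> c0 Ad fc; apply: (@le_trans _ _ (\sum_(i in A) c)); first exact: ler_sum.
by rewrite sumr_const -[c *+ _]mulr_natl ler_wpM2r // ler_nat.
Qed.

Lemma size_sum1 (T : Type) (s : seq T) : (size s)%:R = \sum_(x <- s) (1 : F).
Proof. by rewrite big_const_seq count_predT iter_addr_0. Qed.

Lemma exists_ge_avg (I : finType) (A : {set I}) (f : I -> F) (c : F) :
  c * #|A|%:R <= \sum_(i in A) f i -> (0 < #|A|)%N ->
  exists2 i, i \in A & c <= f i.
Proof.
move=> H A0; case: (boolP [exists (i | i \in A), c <= f i]).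
  by move=> /existsP [i /andP [iA ci]]; exists i.
rewrite negb_exists => /forallP H2.
have : \sum_(i in A) f i < \sum_(i in A) c.
  case/card_gt0P: A0 => i0 i0A.
  rewrite (bigD1 i0) //= [ltRHS](bigD1 i0) //= ltr_leD //.
    by have := H2 i0; rewrite i0A /= -ltNge.
  apply: ler_sum => i /andP [iA _]; apply: ltW.
  by have := H2 i; rewrite iA /= -ltNge.
by rewrite sumr_const -[c *+ _]mulr_natr ltNge H.
Qed.

End SumLemmas.

(** * Weighted counts of holes and the second moment of their lengths *)

Section WeightedPaths.

Variables (F : archiRealFieldType) (V : finType) (G : sgraph V).
Local Notation adj := (adj G).
Local Notation N := (neighbours G).
Local Notation pths := (pths G).
Local Notation hole := (hole G).
Local Notation gam := (@gam F).
Local Notation beta := (beta F).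

(* Number of losses of a factor beta along p; vertices of R that p never
   reaches are losses as well. *)
Fixpoint bad (u : V) (R : {set V}) (p : seq V) : nat :=
  if p is x :: p' then (#|N u :&: R| != 3) + bad x (R :\: N u) p' else #|R|.

Lemma card_split (u : V) (R : {set V}) : #|R| = (#|N u :&: R| + #|R :\: N u|)%N.
Proof. by rewrite [N u :&: R]setIC cardsID. Qed.

Section PathWeights.
Local Open Scope ring_scope.

Lemma sum_betaX_bad k y u R :
  \sum_(p <- pths k y u R) beta ^+ bad u R p <= gam #|R|.
Proof.
elim: k u R => [|k IH] u R.
  rewrite [pths _ _ _ _]/=; case: ifP => _; last by rewrite big_nil ltW ?gam_gt0.
  by rewrite big_seq1 gam_ge_betaX.
rewrite sum_pthsS; case: ifP => _; first by rewrite gam_ge_betaX.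
set d := #|N u :&: R|.
have E x : \sum_(p <- pths k y x (R :\: N u)) beta ^+ bad u R (x :: p) =
  beta ^+ (d != 3%N) * \sum_(p <- pths k y x (R :\: N u)) beta ^+ bad x (R :\: N u) p.
  by rewrite big_distrr /=; apply: eq_bigr => p _; rewrite exprD.
apply: (@le_trans _ _ (d%:R * (beta ^+ (d != 3%N) * gam #|R :\: N u|))).
  apply: sum_const_le => //.
    by rewrite mulr_ge0 ?ltW ?gam_gt0 ?exprn_gt0 //; have := beta_ge1 F; lra.
  move=> x _; rewrite E ler_pM2l ?IH // exprn_gt0 //.
  by have := beta_ge1 F; lra.
rewrite (card_split u R) -/d.
have [->|d3] := eqVneq d 3%N; first by rewrite expr0 mul1r gam_step.
by rewrite expr1 mulrCA mulrA gam_step_neq3.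
Qed.

Lemma size_pths_le k y u R : (size (pths k y u R))%:R <= gam #|R|.
Proof.
rewrite size_sum1; apply: le_trans (sum_betaX_bad k y u R).
by apply: ler_sum => p _; apply: betaX_ge1.
Qed.

End PathWeights.

(** A step without loss deletes exactly three vertices of the reservoir, a step with loss at most D,
    and the leftover vertices are losses themselves. *)
Lemma size_bad D y u R p : 3 <= D -> (forall v, #|N v| <= D) ->
  ipath G y u R p ->
  3 * size p <= #|R| + D * bad u R p /\ #|R| <= 3 * size p + D * bad u R p.
Proof.
move=> D3 HD; elim: p u R => [|x p IH] u R /=; first by split; nia.
move=> /and3P [_ xu /IH [h1 h2]]; rewrite (card_split u R).
have dD : #|N u :&: R| <= D by apply: leq_trans (subset_leq_card (subsetIl _ _)) _.
case: eqP => d3; rewrite ?mul0n ?mulnDr ?muln1 ?add0n; split; lia.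
Qed.

(** Holes are sets; fixing one cyclic order for each makes positions on S, and the losses counted
    from a given start, functions of S. The default [[::]] occurs only when S has no such order. *)
Definition hole_cycle (S : {set V}) : seq V :=
  if [pick c : #|S|.-tuple V | [&& uniq c, [set:: c] == S &
      [forall x in S, forall y in S,
        adj x y == (y == next c x) || (x == next c y)]]] is Some c
  then c else [::].

Lemma hole_cycleP S : hole S ->
  [/\ hole_seq G (hole_cycle S), [set:: hole_cycle S] = S &
      size (hole_cycle S) = #|S|].
Proof.
move=> /andP [/andP [_ /existsP [c0 H0]] _]; rewrite /hole_cycle.
case: pickP => [c /and3P [Uc /eqP cS H]|]; last by move/(_ c0); rewrite H0.
rewrite size_tuple; split=> //; split=> // x y xc yc.
have xS : x \in S by rewrite -cS inE.
have yS : y \in S by rewrite -cS inE.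
by move/forallP: H => /(_ x)/implyP/(_ xS)/forallP/(_ y)/implyP/(_ yS)/eqP.
Qed.

Definition hole_from (S : {set V}) (v : V) : seq V :=
  rot (index v (hole_cycle S)) (hole_cycle S).

Lemma hole_fromP S v : hole S -> v \in S ->
  exists u y p, [/\ hole_from S v = v :: u :: rcons p y,
    hole_seq G (v :: u :: rcons p y), S = [set:: v :: u :: rcons p y] &
    #|S| = (size p).+3 /\ 1 < size p].
Proof.
move=> hS vS; have [hc cS sc] := hole_cycleP hS.
have vc : v \in hole_cycle S by rewrite -cS inE in vS.
have hd := hole_seq_rot (index v (hole_cycle S)) hc; rewrite -/(hole_from S v) in hd.
have sd : size (hole_from S v) = #|S| by rewrite size_rot.
have Sd : S = [set:: hole_from S v].
  by rewrite -[LHS]cS; apply/setP => z; rewrite !inE mem_rot.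
have e0 : exists d, hole_from S v = v :: d.
  rewrite /hole_from /rot drop_index //=; by eexists.
case: e0 => d e; rewrite e in sd hd Sd *.
have S5 : 4 < #|S| by case/andP: hS.
case: d sd hd {e} Sd => [|u d]; first by move=> /= e; rewrite -e in S5.
case/lastP: d => [|p y]; first by move=> /= e; rewrite -e in S5.
move=> sd hd Sd; exists u, y, p; split=> //; move: sd; rewrite /= size_rcons; lia.
Qed.

(** In [v :: u :: q] the vertex [u] and the last vertex of [q] are the two neighbours of [v] on the
    hole. Only the path between them is charged, in the reservoir of non-neighbours of [v]. *)
Definition bad_from (l : seq V) : nat :=
  if l is v :: u :: q then bad u (~: (v |: N v)) (take (size q).-1 q) else 0.

Lemma bad_fromE v u p y :
  bad_from (v :: u :: rcons p y) = bad u (~: (v |: N v)) p.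
Proof. by rewrite /bad_from size_rcons /= -cats1 take_size_cat. Qed.

Lemma hole_from_path S v : hole S -> v \in S ->
  exists u y p, [/\ hole_from S v = v :: u :: rcons p y, u \in N v, y \in N v,
    p \in pths #|V| y u (~: (v |: N v)) & #|S| = (size p).+3].
Proof.
move=> hS vS; have [u [y [p [e hs eS [sz p1]]]]] := hole_fromP hS vS.
have p0 : p != [::] by case: p p1 {e hs eS sz}.
have [ip vn vu vy vp] := hole_seq_path hs p0.
exists u, y, p; split; rewrite ?in_nbr //.
rewrite mem_pths; apply/andP; split.
  apply: (ipath_of_induced ip) => z zp; rewrite !inE negb_or.
  rewrite vp // andbT.
  apply: contraNneq vn => <-; by rewrite inE mem_rcons inE zp !orbT.
by apply: leq_trans (max_card (mem S)); rewrite sz -addn3 leq_addr.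
Qed.

Section HoleCounts.
Local Open Scope ring_scope.

(** [hole_from] fixes one of the two directions of traversal and S is recovered from the list, so
    the left sum embeds term by term in the right one. *)
Lemma sum_holes_from (v : V) (f : seq V -> F) : (forall l, 0 <= f l) ->
  \sum_(S | hole S && (v \in S)) f (hole_from S v) <=
  \sum_(u in N v) \sum_(y in N v) \sum_(p <- pths #|V| y u (~: (v |: N v)))
     f (v :: u :: rcons p y).
Proof.
move=> f0.
pose L1 u := [seq v :: u :: rcons yp.2 yp.1 |
   yp <- flatten [seq [seq (y, p) | p <- pths #|V| y u (~: (v |: N v))] | y <- enum (N v)]].
pose L' := flatten [seq L1 u | u <- enum (N v)].
have -> : \sum_(u in N v) \sum_(y in N v) \sum_(p <- pths #|V| y u (~: (v |: N v)))
     f (v :: u :: rcons p y) = \sum_(l <- L') f l.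
  rewrite /L' big_flatten big_map big_enum /=; apply: eq_bigr => u _.
  rewrite /L1 big_map big_flatten big_map big_enum /=; apply: eq_bigr => y _.
  by rewrite big_map.
pose A := [set S | hole S && (v \in S)].
have -> : \sum_(S | hole S && (v \in S)) f (hole_from S v) =
   \sum_(l <- [seq hole_from Z v | Z <- enum A]) f l.
  rewrite big_map big_enum /=; apply: eq_bigl => S; by rewrite inE.
apply: ler_sum_subseq => //.
  rewrite map_inj_in_uniq ?enum_uniq // => S S'.
  rewrite !mem_enum !inE => /andP [h1 v1] /andP [h2 v2] e.
  have [u [y [p [e1 _ -> _]]]] := hole_fromP h1 v1.
  have [u' [y' [p' [e2 _ -> _]]]] := hole_fromP h2 v2.
  by rewrite -e1 -e2 e.
move=> l /mapP [S]; rewrite mem_enum inE => /andP [hS vS] ->.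
have [u [y [p [-> vu vy pp _]]]] := hole_from_path hS vS.
apply/flatten_mapP; exists u; first by rewrite mem_enum.
apply/mapP; exists (y, p) => //.
apply/flatten_mapP; exists y; first by rewrite mem_enum.
by apply/mapP; exists p.
Qed.

Lemma sum_betaX_bad_from D v : (#|N v| <= D)%N ->
  \sum_(S | hole S && (v \in S)) beta ^+ bad_from (hole_from S v) <=
  D%:R ^+ 2 * gam #|~: (v |: N v)|.
Proof.
move=> dD; have g0 := @gam_gt0 F.
apply: le_trans (@sum_holes_from v (fun l => beta ^+ bad_from l) _) _.
  by move=> l; apply: betaX_ge0.
rewrite expr2 -mulrA; apply: sum_const_le => //.
  by rewrite mulr_ge0 ?ler0n // ltW.
move=> u _; apply: sum_const_le; rewrite ?ltW // => y _.
under eq_bigr do rewrite bad_fromE.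
exact: sum_betaX_bad.
Qed.

Lemma card_holes_at D v : (#|N v| <= D)%N ->
  #|[set S | hole S && (v \in S)]|%:R <= D%:R ^+ 2 * gam #|~: (v |: N v)|.
Proof.
move=> dD; apply: le_trans (sum_betaX_bad_from dD).
rewrite -sum1dep_card natr_sum; apply: ler_sum => S _.
by have := @betaX_ge1 F (bad_from (hole_from S v)).
Qed.

End HoleCounts.

Lemma card_nonnbr v : #|~: (v |: N v)| = #|V| - #|N v|.+1.
Proof.
rewrite cardsCs setCK cardsU1 in_nbr adjxx /=; congr (_ - _).
Qed.

Lemma card_hole_bad D S v : 3 <= D -> (forall v, #|N v| <= D) ->
  hole S -> v \in S ->
  3 * #|S| <= #|V| + (D + 10) * (bad_from (hole_from S v)).+1 /\
  #|V| <= 3 * #|S| + (D + 10) * (bad_from (hole_from S v)).+1.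
Proof.
move=> D3 HD hS vS.
have [u [y [p [-> vu vy + sz]]]] := hole_from_path hS vS.
rewrite mem_pths => /andP [ip _]; rewrite bad_fromE.
have [] := size_bad D3 HD ip; rewrite card_nonnbr.
have := HD v; have : #|N v| < #|V|.
  by rewrite -cardsT; apply/proper_card/properP; split; [exact: subsetT|exists v; rewrite ?in_nbr ?adjxx].
set b := bad _ _ _; nia.
Qed.

Section Variance.
Local Open Scope ring_scope.
Variable D : nat.
Hypothesis D3 : (3 <= D)%N.
Hypothesis HD : forall v, (#|N v| <= D)%N.

Lemma gam_nonnbr v : gam #|~: (v |: N v)| <= gam #|V|.
Proof. by apply: gam_homo; rewrite max_card. Qed.

(** Double counting of the pairs of a hole and a vertex on it; the factor |S| is the number of
    possible starts. *)
Lemma sum_holes_betaX (f : {set V} -> F) (c : F) : 0 <= c ->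
  (forall S v, hole S -> v \in S -> f S <= c * beta ^+ bad_from (hole_from S v)) ->
  \sum_(S | hole S) #|S|%:R * f S <= c * D%:R ^+ 2 * (#|V|%:R * gam #|V|).
Proof.
move=> c0 H.
have -> : \sum_(S | hole S) #|S|%:R * f S = \sum_(v : V) \sum_(S | hole S && (v \in S)) f S.
  rewrite (exchange_big_dep hole) /=; last by move=> v S _ /andP [].
  apply: eq_bigr => S hS; rewrite hS /= sumr_const mulr_natl.
  by congr (_ *+ _); apply: eq_card => v; rewrite !inE.
have -> : c * D%:R ^+ 2 * (#|V|%:R * gam #|V|) = #|V|%:R * (c * (D%:R ^+ 2 * gam #|V|)).
  ring.
rewrite -cardsT -[X in X <= _](@eq_bigl _ _ _ _ _ (mem [set: V])); last by move=> v; rewrite !inE.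
apply: sum_const_le => //.
  by apply: mulr_ge0 => //; apply: mulr_ge0 (gam_ge0 _ _); rewrite exprn_ge0 ?ler0n.
move=> v _.
apply: (@le_trans _ _ (\sum_(S | hole S && (v \in S)) c * beta ^+ bad_from (hole_from S v))).
  by apply: ler_sum => S /andP [hS vS]; apply: H.
rewrite -mulr_sumr ler_wpM2l //.
apply: le_trans (sum_betaX_bad_from (HD v)) _.
rewrite ler_wpM2l ?exprn_ge0 ?ler0n //; rewrite cardsT; exact: gam_nonnbr.
Qed.

(* If S has b losses from one of its vertices then |3|S| - n| <= (D + 10)(b + 1),
   and beta ^ b dominates the cube of b + 1. *)
Definition var_const : F :=
  6%:R * (2%:R * ((D + 10)%:R ^+ 3 * 100%:R ^+ 3) * D%:R ^+ 2).

Lemma var_const_gt0 : 0 < var_const.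
Proof.
have h1 : 0 < (D + 10)%:R :> F by rewrite ltr0n addn_gt0 orbT.
have h2 : 0 < D%:R :> F by rewrite ltr0n (leq_trans _ D3).
have h3 : 0 < 100%:R :> F by rewrite ltr0n.
by rewrite /var_const; do ![apply: mulr_gt0 | apply: exprn_gt0] => //; rewrite ltr0n.
Qed.

(** Either 2t <= n, and then n <= 6s, or n < 2t, and a third power of t pays for the factor n. Short
    holes are thus the reason why the variance bound passes through third powers. *)
Lemma var_pointwise (n s t : nat) : (0 < s)%N -> (3 * s <= n + t)%N -> (n <= 3 * s + t)%N ->
  (t <= n - 3 * s + (3 * s - n))%N ->
  (n * t ^ 2 <= 6 * (s * (t ^ 2 + t ^ 3)))%N.
Proof.
move=> s0 h1 h2 h3.
rewrite (_ : t ^ 2 = t * t)%N ?mulnn // (_ : t ^ 3 = t * (t * t))%N ?mulnn ?expnS ?expn1 //.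
set q := (t * t)%N; case: (leqP (2 * t) n) => h.
  have : (n <= 6 * s)%N by lia.
  nia.
have : (n * q <= (2 * t) * q)%N by rewrite leq_mul2r ltnW ?orbT.
nia.
Qed.

Lemma variance_bound :
  \sum_(S | hole S) ((3 * #|S|)%:R - #|V|%:R) ^+ 2 <= var_const * gam #|V|.
Proof.
case: (posnP #|V|) => [V0|Vp].
  rewrite big1; first by apply: mulr_ge0 (gam_ge0 _ _); apply: ltW var_const_gt0.
  by move=> S /andP [_ S5]; have := leq_trans S5 (max_card (mem S)); rewrite V0.
pose t (S : {set V}) := (#|V| - 3 * #|S| + (3 * #|S| - #|V|))%N.
have tE (S : {set V}) : ((3 * #|S|)%:R - #|V|%:R) ^+ 2 = (t S)%:R ^+ 2 :> F.
  rewrite /t; case: (leqP #|V| (3 * #|S|)) => h.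
    by rewrite (eqP h) add0n natrB.
  by rewrite (_ : 3 * #|S| - #|V| = 0)%N ?addn0 ?natrB ?(ltnW h) //; [ring | lia].
have H : \sum_(S | hole S) #|S|%:R * ((t S)%:R ^+ 2 + (t S)%:R ^+ 3) <=
   (2%:R * ((D + 10)%:R ^+ 3 * 100%:R ^+ 3)) * D%:R ^+ 2 * (#|V|%:R * gam #|V|) :> F.
  apply: sum_holes_betaX; first by rewrite !mulr_ge0 ?exprn_ge0 ?ler0n.
  move=> S v hS vS; have [h1 h2] := card_hole_bad D3 HD hS vS.
  set b := bad_from _ in h1 h2 *.
  have tb : (t S <= (D + 10) * b.+1)%N by rewrite /t; lia.
  have t3 : (t S)%:R ^+ 3 <= (D + 10)%:R ^+ 3 * 100%:R ^+ 3 * beta ^+ b :> F.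
    rewrite -mulrA; apply: (@le_trans _ _ ((D + 10)%:R ^+ 3 * (b%:R + 1) ^+ 3)).
      rewrite -exprMn natr1 -natrM lerXn2r ?nnegrE ?ler0n //.
      by rewrite ler_nat.
    by rewrite ler_wpM2l ?exprn_ge0 ?ler0n ?cube_le_betaX.
  have t23 : (t S)%:R ^+ 2 <= (t S)%:R ^+ 3 :> F.
    rewrite -!natrX ler_nat; case: (t S) => // k; rewrite leq_pexp2l //.
  apply: le_trans (lerD t23 (lexx _)) _.
  by rewrite -mulr2n -[_ *+ 2]mulr_natl -[X in _ <= X]mulrA ler_pM2l ?ltr0n.
have nV : 0 < #|V|%:R :> F by rewrite ltr0n.
rewrite -(ler_pM2l nV) mulr_sumr.
apply: (@le_trans _ _ (6%:R * \sum_(S | hole S) #|S|%:R * ((t S)%:R ^+ 2 + (t S)%:R ^+ 3))).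
  rewrite mulr_sumr; apply: ler_sum => S hS; rewrite tE.
  rewrite -!natrX -!natrD -!natrM ler_nat.
  apply: var_pointwise; rewrite /t; try lia.
  by case/andP: hS; lia.
move: H; rewrite /var_const; set C := 2%:R * (_ ^+ 3 * _ ^+ 3); move: C => C.
set X := \sum_(_ | _) _ => H.
rewrite (_ : _ * (_ * gam _) = 6%:R * (C * D%:R ^+ 2 * (#|V|%:R * gam #|V|))); last by ring.
by rewrite ler_pM2l ?ltr0n.
Qed.

End Variance.

End WeightedPaths.

Lemma nth_rot_mod (T : Type) (x0 : T) c i k : i < size c -> k < size c ->
  nth x0 (rot i c) k = nth x0 c ((i + k) %% size c).
Proof.
move=> ic kc; rewrite /rot nth_cat size_drop nth_drop.
case: ltnP => h; first by rewrite modn_small //; lia.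
rewrite nth_take; last by lia.
congr (nth _ _ _); rewrite (_ : i + k = (k - (size c - i)) + size c); last by lia.
by rewrite modnDr modn_small //; lia.
Qed.

Lemma sum_periodic L (f : nat -> nat) s : (forall i, f (i + L) = f i) ->
  \sum_(i < L) f (i + s) = \sum_(i < L) f i.
Proof.
move=> per; elim: s => [|s IH]; first by apply: eq_bigr => i _; rewrite addn0.
rewrite -IH; case: L per {IH} => [|L] per; first by rewrite !big_ord0.
rewrite big_ord_recr [RHS]big_ord_recl /= addnC add0n; congr (_ + _).
  by rewrite -addSnnS addnC per.
by apply: eq_bigr => i _; rewrite /bump leq0n add1n addSnnS.
Qed.

(** * Vertices with two far apart neighbours on a hole *)

Section LongChords.

Variables (F : archiRealFieldType) (V : finType) (G : sgraph V).
Local Notation adj := (adj G).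
Local Notation N := (neighbours G).
Local Notation hole := (hole G).

(** The vertices deleted at position t are those of R seen from it and from no earlier position;
    dropping the leftover at the end gives the inequality. *)
Lemma bad_ge (x0 : V) u (R : {set V}) p :
  \sum_(t < size p) (#|[set z in R | adj (nth x0 (u :: p) t) z &&
     all (fun k => ~~ adj (nth x0 (u :: p) k) z) (iota 0 t)]| != 3)
  <= bad G u R p.
Proof.
elim: p u R => [|x p IH] u R; first by rewrite big_ord0.
rewrite [size _]/= big_ord_recl [bad _ _ _ _]/=; apply: leq_add.
  rewrite (_ : [set z in R | _] = N u :&: R) //.
  by apply/setP=> z; rewrite !inE andbT andbC.
apply: leq_trans (IH x (R :\: N u)); apply: eq_leq; apply: eq_bigr => t _.
congr (nat_of_bool (_ != _)); apply: eq_card => z.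
rewrite !inE (_ : nat_of_ord (lift ord0 t) = t.+1) //.
rewrite -[iota 0 t.+1]/(0 :: iota (1 + 0) t) iotaDl /= all_map.
rewrite (eq_all (a2 := fun k => ~~ adj (nth x0 (x :: p) k) z)) //.
by case: (z \in R); case: (adj u z); rewrite ?andbF ?andbT.
Qed.

(** Positions on S are taken modulo |S|; for a hole the default [x0] is never reached. *)
Definition cyc_at (x0 : V) (S : {set V}) (k : nat) : V :=
  nth x0 (hole_cycle G S) (k %% #|S|).

Lemma cyc_at_mod x0 (S : {set V}) i j : i = j %[mod #|S|] ->
  cyc_at x0 S i = cyc_at x0 S j.
Proof. by rewrite /cyc_at => ->. Qed.

Lemma cyc_at_per x0 S k : cyc_at x0 S (k + #|S|) = cyc_at x0 S k.
Proof. by rewrite /cyc_at modnDr. Qed.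

Lemma cyc_at_mem x0 S k : hole S -> cyc_at x0 S k \in S.
Proof.
move=> hS; have [_ cS sz] := hole_cycleP hS.
suff: cyc_at x0 S k \in [set:: hole_cycle G S] by rewrite cS.
rewrite inE mem_nth // sz ltn_mod.
by case/andP: hS => _; apply: leq_trans.
Qed.

Lemma cyc_at_surj x0 S v : hole S -> v \in S ->
  exists2 i, i < #|S| & v = cyc_at x0 S i.
Proof.
move=> hS; have [_ cS sz] := hole_cycleP hS.
rewrite -{1}cS inE => /(nthP x0) [i]; rewrite sz => iL <-.
by exists i => //; rewrite /cyc_at modn_small.
Qed.

Lemma cyc_at_adj x0 S i j : hole S -> i < j < i + #|S| ->
  adj (cyc_at x0 S i) (cyc_at x0 S j) = (j == i.+1) || (j.+1 == i + #|S|).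
Proof.
move=> hS; have [[Uc Hc] cS sz] := hole_cycleP hS.
have S5 : 4 < #|S| by case/andP: hS.
have L0 : 0 < #|S| by lia.
have nx k : next (hole_cycle G S) (cyc_at x0 S k) = cyc_at x0 S k.+1.
  rewrite /cyc_at next_nth_lt ?sz ?ltn_mod // -addn1 modnDml addn1 //.
have mem k : cyc_at x0 S k \in hole_cycle G S.
  by rewrite mem_nth // sz ltn_mod.
move=> /andP [ij jL]; rewrite Hc // !nx /cyc_at !nth_uniq ?sz ?ltn_mod //.
congr orb; apply/eqP/eqP.
- move/eqP; rewrite eqn_mod_dvd // => /dvdnP [q eq].
  by case: q eq => [|q]; lia.
- by move=> ->.
- move/eqP; rewrite eq_sym eqn_mod_dvd; last by lia.
  case/dvdnP => q eq; case: q eq => [|[|q]]; lia.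
by move=> ->; rewrite modnDr.
Qed.

Lemma cyc_at_inj x0 S i j : hole S -> i < j < i + #|S| ->
  cyc_at x0 S i != cyc_at x0 S j.
Proof.
move=> hS; have [[Uc Hc] cS sz] := hole_cycleP hS.
have S5 : 4 < #|S| by case/andP: hS.
move=> /andP [ij jL]; rewrite /cyc_at nth_uniq ?sz ?ltn_mod //; try lia.
rewrite eq_sym eqn_mod_dvd; last by lia.
by apply/negP => /dvdnP [q eq]; case: q eq => [|q]; lia.
Qed.

(* Vertices deleted from the reservoir at the t-th vertex after the start i of S. *)
Definition newset x0 S i t : {set V} :=
  [set z | [&& adj (cyc_at x0 S (i + t)) z, z != cyc_at x0 S i &
    all (fun k => ~~ adj (cyc_at x0 S (i + k)) z) (iota 0 t)]].

Lemma bad_from_ge x0 S i : hole S -> i < #|S| ->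
  \sum_(t < #|S| - 3) (#|newset x0 S i t.+1| != 3) <=
  bad_from G (hole_from G S (cyc_at x0 S i)).
Proof.
move=> hS iL; have [[Uc Hc] cS sz] := hole_cycleP hS.
have vS : cyc_at x0 S i \in S by apply: cyc_at_mem.
have [u [y [p [e hs eS [szS p1]]]]] := hole_fromP hS vS.
have er : hole_from G S (cyc_at x0 S i) = rot i (hole_cycle G S).
  by rewrite /hole_from /cyc_at index_uniq ?sz ?ltn_mod ?modn_small //; lia.
rewrite e bad_fromE; set v := cyc_at x0 S i in e *.
apply: leq_trans (bad_ge x0 _ _ _).
rewrite szS -addn3 addnK; apply: eq_leq; apply: eq_bigr => t _.
have tp : t < size p by [].
have nt k : k <= size p -> nth x0 (u :: p) k = cyc_at x0 S (i + k.+1).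
  move=> kp; rewrite /cyc_at -sz -nth_rot_mod ?sz //; last by lia.
  rewrite -er e [nth _ (_ :: _) k.+1]/= -rcons_cons nth_rcons /=.
  by rewrite ltnS kp.
congr (nat_of_bool (_ != _)); apply: eq_card => z.
rewrite !inE nt ?(ltnW tp) // -[iota 0 t.+1]/(0 :: iota (1 + 0) t) iotaDl /= all_map.
rewrite addn0 -/v negb_or.
rewrite (_ : all _ (iota 0 t) = all (fun k => ~~ adj (nth x0 (u :: p) k) z) (iota 0 t)).
  by case: (adj (cyc_at _ _ _) z); case: (z != v); case: (adj v z); rewrite ?andbT ?andbF.
apply: eq_in_all => k; rewrite mem_iota add0n => /andP [_ kt].
by rewrite /= nt ?add1n //; apply: ltnW; apply: ltn_trans kt tp.
Qed.

(* The neighbours of b at the positions j - g and j of S are consecutive among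
   the neighbours of b; |S| is added so that the subtraction does not truncate. *)
Definition long r x0 (S : {set V}) j g b :=
  [&& r <= g, g <= #|S| - r, b \notin S, adj b (cyc_at x0 S (j + #|S|)),
   adj b (cyc_at x0 S (j + #|S| - g)) &
   all (fun k => ~~ adj b (cyc_at x0 S (j + #|S| - k))) (iota 1 g.-1)].

Definition has_long r x0 (S : {set V}) b :=
  has (fun j => has (fun g => long r x0 S j g b) (iota 0 #|V|)) (iota 0 #|S|).

(** The losses at the fixed position j are compared over all starts. Moving the start back shrinks
    the set of vertices first seen at j, and [b] drops out exactly when the start reaches j - g. So
    this set has more than three elements for all nearer starts, or fewer than three for that start
    and all farther ones; both ranges contain at least r - 2 starts. *)
Lemma long_bad r x0 S j g b : hole S -> 3 <= r -> long r x0 S j g b ->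
  r - 2 <= \sum_(t < #|S| - 3) (#|newset x0 S (j + #|S| - t.+1) t.+1| != 3).
Proof.
move=> hS r3 /and5P [rg gL bS bj /andP [bg /allP bk]].
set L := #|S| in gL bj bg bk *; set x := cyc_at x0 S.
pose n t := newset x0 S (j + L - t) t.
have nE t z : 0 < t <= L -> (z \in n t) =
   [&& adj (x (j + L)) z, z != x (j + L - t) &
       all (fun k => ~~ adj (x (j + L - k)) z) (iota 1 t)].
  move=> /andP [t0 tL]; rewrite /n inE -/x subnK; last by lia.
  congr [&& _, _ & _].
  apply/allP/allP => H k; rewrite mem_iota => kt.
    have := H (t - k); rewrite mem_iota (_ : j + L - t + (t - k) = j + L - k); last by lia.
    by apply; lia.
  have := H (t - k); rewrite mem_iota (_ : j + L - (t - k) = j + L - t + k); last by lia.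
  by apply; lia.
have step t : 0 < t -> t < L - 1 -> n t.+1 \subset n t.
  move=> t0 tL; apply/subsetP => z; rewrite !nE; try lia.
  move=> /and3P [-> _ /allP H]; apply/and3P; split=> //; last first.
    by apply/allP => k; rewrite mem_iota => kt; apply: H; rewrite mem_iota; lia.
  have K : ~~ adj (x (j + L - t.+1)) z by apply: H; rewrite mem_iota; lia.
  apply: contraNneq K => ->; rewrite /x cyc_at_adj //; last by rewrite -/L; lia.
  by apply/orP; left; apply/eqP; lia.
have mono t t' : 0 < t -> t <= t' -> t' < L -> n t' \subset n t.
  move=> t0; elim: t' => [|t' IH]; first by lia.
  rewrite leq_eqVlt => /orP [/eqP <- //|tt'] tL.
  by apply: subset_trans (step t' _ _) (IH _ _); lia.
have bng : b \notin n g.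
  rewrite nE; last by lia.
  apply/negP => /and3P [_ _ /allP H].
  by have := H g; rewrite mem_iota adjC /x bg => /(_ _)/negP; apply; lia.
have bng1 : b \in n g.-1.
  rewrite nE; last by lia.
  rewrite adjC bj /=; apply/andP; split.
    by apply: contraNneq bS => ->; apply: cyc_at_mem.
  by apply/allP => k kg; rewrite adjC; apply: bk.
have lt : #|n g| < #|n g.-1|.
  apply: proper_card; apply/properP; split; last by exists b.
  by apply: mono; lia.
have cnt (a c : nat) : a <= c <= L - 3 -> (forall t, a <= t < c -> #|n t.+1| != 3) ->
   c - a <= \sum_(t < L - 3) (#|n t.+1| != 3).
  move=> /andP [ac cL] H.
  rewrite -(big_mkord xpredT (fun t => nat_of_bool (#|n t.+1| != 3))).
  rewrite (big_cat_nat (leq0n c) cL) (big_cat_nat (leq0n a) ac) /=.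
  apply: leq_trans (leq_addr _ _); apply: leq_trans (leq_addl _ _).
  rewrite -[c - a]muln1 -sum_nat_const_nat; rewrite !big_nat.
  by apply: leq_sum => t /H ->.
case: (leqP 3 #|n g|) => h.
  apply: leq_trans (cnt 0 g.-1 _ _); try lia.
  move=> t /andP [_ tg].
  have : #|n g.-1| <= #|n t.+1| by apply: subset_leq_card; apply: mono; lia.
  lia.
apply: leq_trans (cnt g.-1 (L - 3) _ _); try lia.
move=> t /andP [tg tL].
have : #|n t.+1| <= #|n g| by apply: subset_leq_card; apply: mono; lia.
lia.
Qed.

(** Regrouping the losses over all starts and times along diagonals charges them to the position at
    which they occur. A position that ends a long gap absorbs r - 2 of them and accounts for at most
    D vertices [b]. *)
Lemma long_count D r x0 S : (forall v, #|N v| <= D) -> 3 <= r -> hole S ->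
  (r - 2) * #|[set b | has_long r x0 S b]| <=
  D * \sum_(v in S) bad_from G (hole_from G S v).
Proof.
move=> HD r3 hS; set L := #|S|; set x := cyc_at x0 S.
have [[Uc Hc] cS sz] := hole_cycleP hS.
have S5 : 4 < #|S| by case/andP: hS.
have -> : \sum_(v in S) bad_from G (hole_from G S v) =
    \sum_(i < L) bad_from G (hole_from G S (x i)).
  rewrite (eq_bigl (mem (hole_cycle G S))); last by move=> v; rewrite -{1}cS !inE.
  rewrite -big_uniq //= (big_nth x0) sz big_mkord; apply: eq_bigr => i _.
  by rewrite /x /cyc_at modn_small.
pose B i t := nat_of_bool (#|newset x0 S i t.+1| != 3).
have Bper i t : B (i + L) t = B i t.
  rewrite /B; congr (nat_of_bool (_ != _)); apply: eq_card => z.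
  rewrite !inE -[i + L + _]addnAC /L !cyc_at_per; congr [&& _, _ & _].
  by apply: eq_all => k; rewrite -addnA [#|S| + k]addnC addnA cyc_at_per.
have H1 : \sum_(j < L) \sum_(t < L - 3) B (j + L - t.+1) t <=
    \sum_(i < L) bad_from G (hole_from G S (x i)).
  apply: (@leq_trans (\sum_(i < L) \sum_(t < L - 3) B i t)); last first.
    by apply: leq_sum => i _; apply: bad_from_ge.
  rewrite exchange_big [leqRHS]exchange_big /=; apply: leq_sum => t _.
  rewrite -(sum_periodic (L - t.+1) (fun i => Bper i t)).
  apply: leq_sum => j _; rewrite addnBA //; have := ltn_ord t; lia.
apply: leq_trans (leq_mul (leqnn D) H1).
pose A := [set j : 'I_L | [exists b, has (fun g => long r x0 S j g b) (iota 0 #|V|)]].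
have H2 : (r - 2) * #|A| <= \sum_(j < L) \sum_(t < L - 3) B (j + L - t.+1) t.
  rewrite (bigID (mem A)) /=; apply: leq_trans (leq_addr _ _).
  rewrite mulnC -sum_nat_const; apply: leq_sum => j.
  by rewrite inE => /existsP [b /hasP [g _ lb]]; apply: long_bad lb.
apply: leq_trans (leq_mul (leqnn D) H2); rewrite mulnCA leq_mul2l; apply/orP; right.
apply: (@leq_trans #|\bigcup_(j in A) N (x (j + L))|).
  apply: subset_leq_card; apply/subsetP => b; rewrite inE => /hasP [j].
  rewrite mem_iota add0n => /andP [_ jL] hg; apply/bigcupP.
  exists (Ordinal jL); first by rewrite inE; apply/existsP; exists b.
  by case/hasP: hg => g _ /and5P [_ _ _ bj _]; rewrite in_nbr adjC.
rewrite mulnC -sum_nat_const; 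
apply: (@leq_trans (\sum_(j in A) #|N (x (j + L))|)); last first.
  by apply: leq_sum => j _; apply: HD.
elim/big_ind2: _ => [|a b c d h1 h2|j _] //; first by rewrite cards0.
by apply: leq_trans (leq_card_setU _ _) (leq_add h1 h2).
Qed.

Local Open Scope ring_scope.

Lemma sum_bad_from D : (forall v, (#|N v| <= D)%N) ->
  (\sum_(S | hole S) \sum_(v in S) bad_from G (hole_from G S v))%:R <=
  100%:R ^+ 3 * D%:R ^+ 2 * (#|V|%:R * gam F #|V|).
Proof.
move=> HD; rewrite (exchange_big_dep xpredT) //= natr_sum.
rewrite (_ : _ * _ = #|V|%:R * (100%:R ^+ 3 * (D%:R ^+ 2 * gam F #|V|))); last first.
  by move: (100%:R ^+ 3) => c; ring.
rewrite -[X in _ <= X%:R * _]cardsT.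
rewrite [X in X <= _](eq_bigl (mem [set: V])); last by move=> v; rewrite !inE.
apply: sum_const_le => //.
  by apply: mulr_ge0; rewrite ?exprn_ge0 ?ler0n // mulr_ge0 ?exprn_ge0 ?ler0n ?gam_ge0.
move=> v _; rewrite natr_sum.
apply: (@le_trans _ _ (\sum_(S | hole S && (v \in S)) 100%:R ^+ 3 * beta F ^+ bad_from G (hole_from G S v))).
  apply: ler_sum => S _; apply: le_trans (cube_le_betaX _ _).
  rewrite natr1 -natrX ler_nat; set b := bad_from _ _.
  by apply: leq_trans (leqnSn b) _; rewrite -{1}[b.+1]expn1 leq_pexp2l.
rewrite -mulr_sumr ler_wpM2l ?exprn_ge0 ?ler0n //.
apply: le_trans (sum_betaX_bad_from F (HD v)) _.
by rewrite ler_wpM2l ?exprn_ge0 ?ler0n // gam_nonnbr.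
Qed.

Lemma long_bound D r x0 : (forall v, (#|N v| <= D)%N) -> (3 <= r)%N ->
  (r - 2)%:R * \sum_(S | hole S) #|[set b | has_long r x0 S b]|%:R <=
  100%:R ^+ 3 * D%:R ^+ 3 * (#|V|%:R * gam F #|V|).
Proof.
move=> HD r3; have H := sum_bad_from HD.
apply: (@le_trans _ _ (D%:R * (\sum_(S | hole S) \sum_(v in S) bad_from G (hole_from G S v))%:R)).
  rewrite mulr_sumr natr_sum mulr_sumr; apply: ler_sum => S hS.
  by rewrite -!natrM ler_nat long_count.
apply: le_trans (ler_wpM2l (ler0n _ D) H) _.
by move: (100%:R ^+ 3) => c; rewrite le_eqVlt; apply/orP; left; apply/eqP; ring.
Qed.

End LongChords.

Global Opaque cyc_at.

(** * Exchanging short arcs *)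

Section Swap.

Variables (V : finType) (G : sgraph V).
Local Notation adj := (adj G).
Local Notation hole := (hole G).
Local Notation induced_path := (induced_path G).

Lemma induced_path_consE x z s : induced_path (x :: z :: s) =
  [&& adj x z && all (fun w => ~~ adj x w) s, x \notin z :: s & induced_path (z :: s)].
Proof. by []. Qed.

Lemma induced_path_catr s t : induced_path (s ++ t) -> induced_path t.
Proof.
by elim: s => // x s IH; rewrite cat_cons => /and3P [_ _ /IH].
Qed.

Lemma induced_path_rev s : induced_path s -> induced_path (rev s).
Proof.
case: s => // x s; set q := x :: s => /(induced_path_nthP G x) [Uq Hq].
apply/(induced_path_nthP G x); split; first by rewrite rev_uniq.
move=> i j; rewrite size_rev => /andP [ij jq].
rewrite !nth_rev ?(ltn_trans ij jq) // adjC Hq; last first.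
  by move: (size q) jq => m; lia.
by apply/eqP/eqP; move: (size q) jq => m; lia.
Qed.

Lemma induced_path_cat s x w : induced_path (rcons s x) ->
  induced_path (x :: w) ->
  {in s & w, forall a b, ~~ adj a b && (a != b)} ->
  induced_path (s ++ x :: w).
Proof.
elim: s => // a s IH; rewrite rcons_cons => ax xw H.
have IHs : induced_path (s ++ x :: w).
  apply: IH => //; first by case/and3P: ax.
  by move=> z t zs tw; apply: H => //; rewrite inE zs orbT.
have Ha b : b \in w -> ~~ adj a b && (a != b) by apply: H; rewrite mem_head.
have aw : a \notin w by apply/negP => /Ha /andP [_]; rewrite eqxx.
rewrite cat_cons; case: s {IH H} ax IHs => [|z s] ax IHs.
  have [ax' ne] : adj a x /\ a != x.
    by move: ax; rewrite /= inE => /and3P [/andP [-> _] -> _].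
  rewrite cat0s in IHs *; rewrite induced_path_consE ax' IHs in_cons.
  rewrite (negbTE ne) (negbTE aw) !andbT /=.
  by apply/allP => b /Ha /andP [].
move: ax; rewrite rcons_cons cat_cons induced_path_consE => /and3P [/andP [az al] ne _].
rewrite cat_cons in IHs.
rewrite induced_path_consE az IHs andbT; apply/andP; split.
  rewrite all_cat /=; move: al; rewrite all_rcons => /andP [-> ->].
  by apply/allP => b /Ha /andP [].
move: ne; rewrite !inE mem_rcons mem_cat !inE !negb_or => /and3P [-> -> ->].
by rewrite aw.
Qed.

(** On an induced path only the second vertex sees the first, so the two paths agree vertex by
    vertex. *)
Lemma induced_path_prefix f q T : induced_path (f :: q) ->
  induced_path (f :: T) -> {subset T <= q} -> exists w, q = T ++ w.
Proof.
elim: T f q => [|t T IH] f q; first by move=> *; exists q.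
move=> ifq ifT sub.
have tq : t \in q by apply: sub; rewrite mem_head.
case: q tq ifq sub => [//|z q] tq ifq sub.
have ft : adj f t by move: ifT; rewrite induced_path_consE => /and3P [/andP []].
have zt : z = t.
  move: ifq; rewrite induced_path_consE => /and3P [/andP [_ /allP H] _ _].
  move: tq; rewrite inE => /orP [/eqP //|/H]; by rewrite ft.
subst z; have [w ->] : exists w, q = T ++ w; last by exists w.
apply: IH (_ : induced_path (t :: q)) _ _.
- by move: ifq; rewrite induced_path_consE => /and3P [].
- by move: ifT; rewrite induced_path_consE => /and3P [].
move=> z zT; have := sub z; rewrite !inE zT orbT => /(_ isT) /orP [/eqP e|//].
move: ifT; rewrite induced_path_consE => /and3P [_ _ /induced_path_uniq /=].
by rewrite -e zT.
Qed.

Lemma hole_rooted_dir S e f : hole S -> e \in S -> f \in S -> adj e f ->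
  exists p y, [/\ hole_seq G (e :: f :: rcons p y),
    S = [set:: e :: f :: rcons p y] & 1 < size p].
Proof.
move=> hS eS fS ef; have [u [y [p [hs eqS _ p1]]]] := hole_rooted hS eS.
have p0 : p != [::] by case: p p1 {hs eqS}.
have [ip vn vu vy vp] := hole_seq_path hs p0.
have := fS; rewrite eqS inE in_cons eq_sym (negbTE (adj_neq ef)) /=.
rewrite inE mem_rcons inE => /or3P [/eqP ->|/eqP ->|fp].
- by exists p, y.
- exists (rev p), u; rewrite size_rev; split=> //; last first.
    apply/setP => z; rewrite !inE !mem_rcons !inE mem_rev.
    by case: (z == e); case: (z == u); case: (z == y).
  apply: hole_seq_of_path => //.
  + by have := induced_path_rev ip; rewrite rev_cons rev_rcons rcons_cons.
  + by case: p p0 {ip hs eqS p1 vn vp} => // a p _; rewrite rev_cons -size_eq0 size_rcons.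
  + by move: vn; rewrite !inE !mem_rcons !inE mem_rev !negb_or => /and3P [-> -> ->].
  + by move=> z; rewrite mem_rev; apply: vp.
by have := vp _ fp; rewrite ef.
Qed.

(* e, f and l, e' are the pairs of consecutive vertices of the hole around the
   exchanged arcs A and B. *)
Definition swap_data (e f l e' : V) (A B : seq V) : bool :=
  [&& induced_path (f :: rcons A l), induced_path (f :: rcons B l),
      A != [::], B != [::], ~~ has (mem B) A,
      [&& adj e f, adj l e', e != l, e' != f & e != e'] &
      (e \notin A ++ B) && (e' \notin A ++ B)].

Definition swap_zone (A B : seq V) : {set V} := [set:: A ++ B].

(** The condition on neighbours is imposed on both arcs, whichever of them S contains; this makes it
    invariant under the exchange. *)
Definition swappable (e f l e' : V) (A B : seq V) (S : {set V}) : bool :=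
  [&& [&& e \in S, f \in S, l \in S & e' \in S],
      (S :&: swap_zone A B == [set:: A]) || (S :&: swap_zone A B == [set:: B]) &
      [forall z in swap_zone A B, forall w in S,
        adj z w ==> [|| w \in swap_zone A B, w == f | w == l]]].

Definition flip (Z S : {set V}) : {set V} := (S :\: Z) :|: (Z :\: S).

Lemma in_flip (Z S : {set V}) x : (x \in flip Z S) = (x \in S) (+) (x \in Z).
Proof. by rewrite !inE; case: (x \in S); case: (x \in Z). Qed.

Lemma flipK (Z S : {set V}) : flip Z (flip Z S) = S.
Proof. by apply/setP => x; rewrite !in_flip -addbA addbb addbF. Qed.

Lemma swap_dataC e f l e' A B : swap_data e f l e' A B -> swap_data e f l e' B A.
Proof.
move=> /and5P [h1 h2 h3 h4 /and3P [h5 h6 h7]].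
rewrite /swap_data h1 h2 h3 h4 h6 /=; apply/andP; split.
  apply/hasPn => x xA; apply: contra h5 => xB; apply/hasP; by exists x.
by move: h7; rewrite !mem_cat ![(_ \in A) || _]orbC.
Qed.

Lemma swap_zoneC A B : swap_zone A B = swap_zone B A.
Proof. by apply/setP => x; rewrite !inE !mem_cat orbC. Qed.

Lemma swappableC e f l e' A B S :
  swappable e f l e' A B S = swappable e f l e' B A S.
Proof. by rewrite /swappable swap_zoneC orbC. Qed.

(** Traversed from [e] towards [f], the hole begins with [e], [f], the arc A and [l], by
    [induced_path_prefix]. Since B has no neighbours on the rest of the hole except [f] and [l], it
    can be put in place of A. *)
Lemma swap_hole_half e f l e' A B S : swap_data e f l e' A B ->
  hole S -> swappable e f l e' A B S ->
  S :&: swap_zone A B = [set:: A] -> hole (flip (swap_zone A B) S).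
Proof.
move=> /and5P [ifA ifB A0 B0 /and3P [dAB /and5P [ef le' nel ne'f nee'] /andP [eZ e'Z]]].
move=> hS /and3P [/and4P [eS fS lS e'S] _ /forallP HZ] SZ.
have HZ' z w : z \in swap_zone A B -> w \in S -> adj z w ->
    [|| w \in swap_zone A B, w == f | w == l].
  by move=> zZ wS zw; have := HZ z; rewrite zZ => /forallP/(_ w); rewrite wS zw.
have [p [y [hs eqS p1]]] := hole_rooted_dir hS eS fS ef.
have p0 : p != [::] by case: p p1 {hs eqS}.
have [ip vn vu vy vp] := hole_seq_path hs p0.
have Uall := hs.1.
have AS z : z \in A -> z \in S.
  by move=> zA; have : z \in S :&: swap_zone A B; [rewrite SZ inE | case/setIP].
have BS z : z \in B -> z \notin S.
  move=> zB; apply/negP => zS; have : z \in [set:: A].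
    by rewrite -SZ !inE mem_cat zB orbT zS.
  by rewrite inE => zA; case/hasP: dAB; exists z.
have inq z : z \in S -> z != e -> z != f -> z \in rcons p y.
  by rewrite eqS inE !in_cons => /or3P [/eqP ->|/eqP ->|//]; rewrite eqxx.
have UA := induced_path_uniq ifA.
have [w ew] : exists w, rcons p y = rcons A l ++ w.
  apply: induced_path_prefix ip ifA _ => z.
  move=> zA; apply: inq.
  - by move: zA; rewrite mem_rcons inE => /orP [/eqP ->|/AS].
  - apply: contraTneq zA => ->; rewrite mem_rcons inE (negbTE nel) /=.
    by move: eZ; rewrite mem_cat negb_or => /andP [].
  - by apply: contraTneq zA => ->; case/andP: UA.
(* [e'] provides a vertex beyond [l], so the new cycle has length at least 5 even if B is a single
   vertex. *)
have e'w : e' \in w.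
  have : e' \in rcons p y by apply: inq => //; rewrite eq_sym.
  rewrite ew mem_cat mem_rcons inE eq_sym (negbTE (adj_neq le')) /=.
  by move: e'Z; rewrite mem_cat negb_or => /andP [/negbTE -> _].
case/lastP: w e'w ew => [//|w y'] _ ew.
have /rcons_inj [pE yE] : rcons p y = rcons (A ++ l :: w) y'.
  by rewrite ew cat_rcons rcons_cat rcons_cons.
subst y' p; clear ew.
have lwS z : z \in l :: rcons w y -> z \in S.
  rewrite eqS !inE !mem_rcons !inE mem_cat inE.
  by case: (z == l); case: (z == y); case: (z \in w); rewrite ?orbT.
have lwA z : z \in rcons w y -> [/\ z != f, z != l & z \notin A].
  move=> zw; move: Uall; rewrite rcons_cat rcons_cons.
  rewrite 2!cons_uniq cat_uniq cons_uniq => /and5P [_ fn _ /hasPn H /andP [ln _]].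
  split.
  - by apply: contraNneq fn => <-; rewrite mem_cat inE zw !orbT.
  - by apply: contraNneq ln => <-.
  by apply: (H z); rewrite inE zw orbT.
have ew z : z \in rcons w y -> z != e.
  move=> zw; apply: contraTneq vn => <-; rewrite negbK inE.
  by rewrite rcons_cat rcons_cons mem_cat inE zw !orbT.
have Bw b z : b \in B -> z \in rcons w y -> ~~ adj b z.
  move=> bB zw; apply/negP => bz; have [zf zl zA] := lwA z zw.
  have zS : z \in S by apply: lwS; rewrite inE zw orbT.
  have := HZ' b z; rewrite !inE !mem_cat bB orbT zS bz => /(_ isT isT isT).
  rewrite (negbTE zf) (negbTE zl) (negbTE zA) /= orbF => zB.
  by have := BS z zB; rewrite zS.
have hs' : hole_seq G (e :: f :: rcons (B ++ l :: w) y).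
  apply: hole_seq_of_path => //.
  - rewrite rcons_cat rcons_cons -cat_cons; apply: induced_path_cat.
    + by rewrite rcons_cons.
    + move: ip; rewrite rcons_cat rcons_cons -cat_cons; exact: induced_path_catr.
    move=> a b; rewrite inE => /orP [/eqP ->|aB] bw.
      have [bf _ _] := lwA b bw; rewrite [f == b]eq_sym bf andbT.
      move: ip; rewrite rcons_cat rcons_cons.
      case: (A) A0 => // a0 A' _; rewrite cat_cons induced_path_consE.
      move=> /and3P [/andP [_]]; rewrite all_cat /= => /and3P [_ _ /allP H] _ _.
      exact: H.
    rewrite Bw //=; apply: contraNneq (BS a aB) => ->.
    by apply: lwS; rewrite inE bw orbT.
  - by case: (B) B0.
  - move: vn; rewrite !inE !rcons_cat !mem_cat !rcons_cons !in_cons !negb_or.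
    move=> /and4P [-> _ -> ->]; rewrite andbT /=.
    by rewrite andbT; move: eZ; rewrite mem_cat negb_or => /andP [].
  move=> z; rewrite mem_cat => /orP [zB|zw].
    apply/negP => ez; have := HZ' z e; rewrite !inE mem_cat zB orbT eS adjC ez.
    move=> /(_ isT isT isT); rewrite (negbTE eZ) (negbTE nel) orbF /=.
    by rewrite (negbTE (adj_neq ef)).
  by apply: vp; rewrite mem_cat zw orbT.
have -> : flip (swap_zone A B) S = [set:: e :: f :: rcons (B ++ l :: w) y].
  apply/setP => z; rewrite in_flip [in RHS]inE.
  have [zB|zB] := boolP (z \in B).
    by rewrite (negbTE (BS z zB)) !inE !rcons_cat !mem_cat zB !orbT.
  have [zA|zA] := boolP (z \in A).
    rewrite AS // !inE mem_cat zA /=; apply/esym/negbTE.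
    rewrite rcons_cat mem_cat rcons_cons in_cons (negbTE zB) /= !negb_or.
    have h1 : z != e by apply: contraNneq eZ => <-; rewrite mem_cat zA.
    have h2 : z != f.
      by move: UA; rewrite cons_uniq mem_rcons inE negb_or => /andP [/andP [_ h] _]; apply: contraNneq h => <-.
    have h3 : z != l.
      move: UA; rewrite cons_uniq rcons_uniq => /and3P [_ h _].
      by apply: contraNneq h => <-.
    rewrite h1 h2 h3 /=; apply/negP => zw; have [_ _] := lwA z zw; by rewrite zA.
  rewrite [z \in swap_zone A B]inE mem_cat (negbTE zA) (negbTE zB) addbF eqS.
  by rewrite !inE !rcons_cat !mem_cat (negbTE zA) (negbTE zB).
apply/andP; split.
  by apply: hole_seq_induces hs' _; rewrite /= size_rcons size_cat /= addnS.
rewrite cardsE (card_uniqP hs'.1) /= size_rcons size_cat /=.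
by case: (B) B0 => [|b0 B1] // _; rewrite addnS /= addSn.
Qed.

Lemma swap_hole e f l e' A B S : swap_data e f l e' A B ->
  hole S -> swappable e f l e' A B S -> hole (flip (swap_zone A B) S).
Proof.
move=> sd hS sw; have := sw; case/and3P => _ /orP [/eqP h|/eqP h] _.
  exact: swap_hole_half sd hS sw h.
rewrite swap_zoneC; apply: swap_hole_half (swap_dataC sd) hS _ _.
  by rewrite -swappableC.
by rewrite swap_zoneC.
Qed.

Lemma swap_ends e f l e' A B : swap_data e f l e' A B ->
  [/\ e \notin swap_zone A B, f \notin swap_zone A B, l \notin swap_zone A B
    & e' \notin swap_zone A B].
Proof.
move=> /and5P [/induced_path_uniq UA /induced_path_uniq UB _ _ /and3P [_ _ /andP [eZ e'Z]]].
move: UA UB; rewrite !cons_uniq !rcons_uniq !mem_rcons !inE !negb_or !mem_cat.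
move=> /and3P [/andP [_ h1] h2 _] /and3P [/andP [_ h3] h4 _].
move: eZ e'Z; rewrite !mem_cat !negb_or => eZ e'Z.
rewrite ?(negbTE h1); by rewrite ?mem_cat ?negb_or ?h1 ?h2 ?h3 ?h4.
Qed.

Lemma swappable_flip e f l e' A B S : swap_data e f l e' A B ->
  swappable e f l e' A B S -> swappable e f l e' A B (flip (swap_zone A B) S).
Proof.
move=> sd; have [eZ fZ lZ e'Z] := swap_ends sd.
move=> /and3P [/and4P [eS fS lS e'S] SZ /forallP HZ].
have dAB : ~~ has (mem B) A by case/and5P: sd => _ _ _ _ /and3P [].
apply/and3P; split.
- by rewrite !in_flip (negbTE eZ) (negbTE fZ) (negbTE lZ) (negbTE e'Z) eS fS lS e'S.
- rewrite orbC; case/orP: SZ => /eqP SZ; apply/orP; [left|right]; apply/eqP/setP => z.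
    have := congr1 (fun X : {set V} => z \in X) SZ; rewrite !inE mem_cat.
    have : ~~ ((z \in A) && (z \in B)).
      by apply: contra dAB => /andP [zA zB]; apply/hasP; exists z.
    by case: (z \in S); case: (z \in A); case: (z \in B).
  have := congr1 (fun X : {set V} => z \in X) SZ; rewrite !inE mem_cat.
  have : ~~ ((z \in A) && (z \in B)).
    by apply: contra dAB => /andP [zA zB]; apply/hasP; exists z.
  by case: (z \in S); case: (z \in A); case: (z \in B).
apply/forallP => z; apply/implyP => zZ; apply/forallP => w; apply/implyP.
rewrite in_flip; case: (boolP (w \in swap_zone A B)) => wZ; first by rewrite implybT.
rewrite addbF => wS; have := HZ z; rewrite zZ => /forallP/(_ w).
by rewrite wS (negbTE wZ).
Qed.

Lemma swappable_indep e f l e' A B (Z S : {set V}) :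
  [disjoint Z & [set e; f; l; e']] ->
  [disjoint Z & swap_zone A B] ->
  (forall z w, z \in swap_zone A B -> w \in Z -> ~~ adj z w) ->
  swappable e f l e' A B (flip Z S) = swappable e f l e' A B S.
Proof.
move=> d1 d2 H; rewrite /swappable.
have nZ x : x \in [set e; f; l; e'] -> (x \in flip Z S) = (x \in S).
  by move=> xe; rewrite in_flip (disjointFl d1 xe) addbF.
rewrite !nZ ?inE ?eqxx ?orbT //; congr [&& _, _ & _].
  have -> : flip Z S :&: swap_zone A B = S :&: swap_zone A B; last by [].
  apply/setP => x; rewrite [LHS]inE [RHS]inE in_flip.
  by case: (boolP (x \in swap_zone A B)) => xZ; rewrite ?andbF // (disjointFl d2 xZ) addbF.
apply: eq_forallb => z; case: (boolP (z \in swap_zone A B)) => // zZ /=.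
apply: eq_forallb => w; rewrite in_flip.
case: (boolP (w \in Z)) => wZ; rewrite ?addbF //.
by rewrite (negbTE (H _ _ zZ wZ)) !implybT.
Qed.

Lemma card_flip (Z S : {set V}) : #|flip Z S| = #|S :\: Z| + #|Z :\: S|.
Proof.
rewrite cardsU (_ : _ :&: _ = set0) ?cards0 ?subn0 //.
by apply/setP => x; rewrite !inE; case: (x \in S); case: (x \in Z).
Qed.

End Swap.

(** * A Bessel inequality for independent involutions *)

Section Bessel.
Local Open Scope ring_scope.
Variables (F : archiRealFieldType) (I J : finType) (H : pred I).
Variables (P : J -> pred I) (T : J -> I -> I) (g : I -> F).
Hypothesis TH : forall j i, H i -> P j i -> H (T j i).
Hypothesis TP : forall j i, H i -> P j i -> P j (T j i).
Hypothesis TK : forall j i, H i -> P j i -> T j (T j i) = i.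
Let phi j i : F := if P j i then g i - g (T j i) else 0.
Hypothesis Tphi : forall j k i, j != k -> H i -> P j i -> phi k (T j i) = phi k i.

Lemma bessel_reindex j (f : I -> F) :
  \sum_(i | H i && P j i) f i = \sum_(i | H i && P j i) f (T j i).
Proof.
rewrite (reindex_onto (T j) (T j)) /=; last first.
  by move=> i /andP [hi pi]; rewrite TK.
apply: eq_bigl => i; apply/andP/andP => [[/andP [h p] /eqP <-]|[h p]].
  by split; [apply: TH | apply: TP].
by rewrite TH // TP // TK.
Qed.

Lemma sum_phi j (f : I -> F) :
  \sum_(i | H i) f i * phi j i = \sum_(i | H i && P j i) f i * phi j i.
Proof.
rewrite (bigID (P j)) /= [X in _ + X]big1 ?addr0 // => i /andP [_ /negbTE n].
by rewrite /phi n mulr0.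
Qed.

Lemma phi_T j i : H i -> P j i -> phi j (T j i) = - phi j i.
Proof. by move=> h p; rewrite /phi TP // p TK // opprB. Qed.

Lemma bessel_self j :
  \sum_(i | H i) g i * phi j i = 2%:R^-1 * \sum_(i | H i) phi j i ^+ 2.
Proof.
under [in RHS]eq_bigr do rewrite expr2.
rewrite !sum_phi.
set X := LHS; set Y := \sum_(_ | _) _ * _.
suff : X + X = Y by lra.
rewrite {2}/X bessel_reindex /X -big_split /=; apply: eq_bigr => i /andP [h p].
by rewrite phi_T // mulrN -mulrBl {2}/phi p.
Qed.

Lemma bessel_orth j k : j != k -> \sum_(i | H i) phi k i * phi j i = 0.
Proof.
move=> jk; rewrite sum_phi; set X := LHS.
suff : X = - X by lra.
rewrite {1}/X bessel_reindex -sumrN; apply: eq_bigr => i /andP [h p].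
by rewrite phi_T // Tphi // mulrN.
Qed.

(** On its domain [P j], the involution [T j] changes the sign of [phi j] and fixes every other
    [phi k]. Hence distinct ones are orthogonal, and the inner product of g with [phi j] is half the
    squared norm of [phi j]. Expanding the squared norm of g minus half the sum of all [phi j] gives
    the inequality. *)
Lemma bessel : \sum_j \sum_(i | H i) phi j i ^+ 2 <= 4%:R * \sum_(i | H i) g i ^+ 2.
Proof.
pose s i := \sum_j phi j i.
have E0 : 0 <= \sum_(i | H i) (g i - 2%:R^-1 * s i) ^+ 2.
  by apply: sumr_ge0 => i _; apply: sqr_ge0.
have E1 : \sum_(i | H i) (g i - 2%:R^-1 * s i) ^+ 2 =
  \sum_(i | H i) g i ^+ 2 - \sum_(i | H i) g i * s i
   + 4%:R^-1 * \sum_(i | H i) s i * s i.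
  rewrite mulr_sumr -sumrB -big_split /=; apply: eq_bigr => i _; by field.
have E2 : \sum_(i | H i) g i * s i = 2%:R^-1 * \sum_j \sum_(i | H i) phi j i ^+ 2.
  under eq_bigr do rewrite mulr_sumr.
  rewrite exchange_big mulr_sumr /=; apply: eq_bigr => j _; exact: bessel_self.
have E3 : \sum_(i | H i) s i * s i = \sum_j \sum_(i | H i) phi j i ^+ 2.
  under eq_bigr do rewrite {2}/s mulr_sumr.
  rewrite exchange_big /=; apply: eq_bigr => j _.
  under eq_bigr do rewrite /s mulr_suml.
  rewrite exchange_big (bigD1 j) //= [X in _ + X]big1 ?addr0; last first.
    by move=> k kj; apply: bessel_orth; rewrite eq_sym.
  by apply: eq_bigr => i _; rewrite expr2.
rewrite E1 E2 E3 in E0; lra.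
Qed.

End Bessel.

(** Let p and q be the first and last position of P after the free window. The gap from q round to p
    contains the window, so it is at least r. As gaps between r and L - r are excluded, it exceeds L
    - r, which means q - p < r. *)
Lemma periodic_arc (P : pred nat) L r i0 :
  (forall k, P (k + L) = P k) -> 3 <= r ->
  (forall k, k < r -> ~~ P (i0 + k)) ->
  (exists2 k, k < L & P (i0 + k)) ->
  (forall j g, r <= g -> g <= L - r -> P (j + L) -> P (j + L - g) ->
     exists2 k, 0 < k < g & P (j + L - k)) ->
  exists p s, [/\ 0 < p, s < r, P p, P (p + s) &
    forall k, k < L -> P (p + k) -> k <= s].
Proof.
move=> per r3 Hi0 [k0 k0L Pk0] nl.
have exQ : exists k, (k < L) && P (i0 + k) by exists k0; rewrite k0L.
have Qub k : (k < L) && P (i0 + k) -> k <= L by move=> /andP [/ltnW].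
case: (ex_minnP exQ) => p /andP [pL Pp] pmin.
case: (ex_maxnP exQ Qub) => q /andP [qL Pq] qmax.
have pr : r <= p by rewrite leqNgt; apply/negP => /Hi0; rewrite Pp.
have pq : p <= q by apply: pmin; rewrite qL.
have pmin' k : k < L -> P (i0 + k) -> p <= k by move=> h h'; apply: pmin; rewrite h.
have qmax' k : k < L -> P (i0 + k) -> k <= q by move=> h h'; apply: qmax; rewrite h.
clear pmin qmax exQ Qub.
exists (i0 + p), (q - p); split=> //.
- by clear -pr r3; lia.
- rewrite ltnNge; apply/negP => h.
  have [||||k kg Pk] := nl (i0 + p) (L - (q - p)); first by clear -h pr qL; lia.
  + by clear -h; lia.
  + by rewrite per.
  + by rewrite (_ : i0 + p + L - (L - (q - p)) = i0 + q) //; clear -pq qL; lia.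
  case: (leqP k p) => kp.
    have : p <= p - k.
      apply: pmin'; first by clear -pL; lia.
      by rewrite -per (_ : i0 + (p - k) + L = i0 + p + L - k) //; clear -kp; lia.
    by clear -kg kp; lia.
  have : p + L - k <= q.
    apply: qmax'; first by clear -kp pL; lia.
    by rewrite (_ : i0 + (p + L - k) = i0 + p + L - k) //; clear -kg; lia.
  by clear -kg pq qL; lia.
- by rewrite -addnA subnKC.
move=> k kL Pk; case: (ltnP (p + k) L) => h.
  have : p + k <= q by apply: qmax' => //; rewrite addnA.
  by clear; lia.
have : p <= p + k - L.
  apply: pmin'; first by clear -h kL pL; lia.
  by rewrite -per (_ : i0 + (p + k - L) + L = i0 + p + k) //; clear -h; lia.
by clear -kL h; lia.
Qed.

(** * Vertices attached to a short arc of a hole *)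

Section Arcs.

Variables (V : finType) (G : sgraph V).
Local Notation adj := (adj G).
Local Notation N := (neighbours G).
Local Notation hole := (hole G).
Local Notation cyc_at := (cyc_at G).

(** For a hole S the last three conditions say that u and w are at distance at least 3 along S,
    without referring to a cyclic order. *)
Definition chordal (b : V) (S : {set V}) : bool :=
  (b \notin S) && [exists u in S, exists w in S,
    [&& adj b u, adj b w, u != w, ~~ adj u w &
      [forall z in S, ~~ (adj u z && adj z w)]]].

Lemma cyc_at_from x0 (S : {set V}) a w : hole S -> w \in S ->
  exists2 d, d < #|S| & w = cyc_at x0 S (a + d).
Proof.
move=> hS wS; have S5 : 4 < #|S| by case/andP: hS.
have [i iL ->] := cyc_at_surj x0 hS wS.
exists ((i + (#|S| - a %% #|S|)) %% #|S|); first by rewrite ltn_mod; lia.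
apply: cyc_at_mod; rewrite modnDmr.
have aL : a %% #|S| < #|S| by rewrite ltn_mod; lia.
rewrite (_ : a + _ = (a %/ #|S|).+1 * #|S| + i) ?modnMDl //.
by rewrite {1}(divn_eq a #|S|) mulSn; lia.
Qed.

(** Pigeonhole: D + 1 disjoint windows of length r against at most D neighbours of [b]. *)
Lemma free_window D r x0 (S : {set V}) b : hole S -> #|N b| <= D -> D.+1 * r <= #|S| ->
  exists i0, forall k, k < r -> ~~ adj b (cyc_at x0 S (i0 + k)).
Proof.
move=> hS dD rL.
case: (boolP [exists w : 'I_D.+1, all (fun k => ~~ adj b (cyc_at x0 S (w * r + k))) (iota 0 r)]).
  move=> /existsP [w /allP H]; exists (w * r) => k kr; apply: H.
  by rewrite mem_iota.
rewrite negb_exists => /forallP H; exfalso.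
have Hw (w : 'I_D.+1) : exists k, (k < r) && adj b (cyc_at x0 S (w * r + k)).
  have := H w; rewrite -has_predC => /hasP [k]; rewrite mem_iota /= negbK => kr bk.
  by exists k; rewrite kr.
pose h w := xchoose (Hw w); pose f (w : 'I_D.+1) := cyc_at x0 S (w * r + h w).
have hr w : h w < r by case/andP: (xchooseP (Hw w)).
have fN w : f w \in N b by rewrite in_nbr; case/andP: (xchooseP (Hw w)).
have neq (w w' : 'I_D.+1) : w < w' -> f w != f w'.
  move=> ww; apply: cyc_at_inj => //.
  have := hr w; have := hr w'; have := ltn_ord w'.
  move: (h w) (h w') ww rL => m m'; move: (#|S|) => L.
  case: w w' => [w ?] [w' ?] /=; nia.
have finj : injective f.
  move=> w w' e; apply/val_inj; case: (ltngtP w w') => // ww.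
    by have := neq _ _ ww; rewrite e eqxx.
  by have := neq _ _ ww; rewrite e eqxx.
have : #|f @: [set: 'I_D.+1]| <= #|N b|.
  by apply: subset_leq_card; apply/subsetP => z /imsetP [w _ ->].
rewrite card_imset // cardsT card_ord; lia.
Qed.

Lemma cyc_at_adjS x0 (S : {set V}) k : hole S ->
  adj (cyc_at x0 S k) (cyc_at x0 S k.+1).
Proof.
move=> hS; have S5 : 4 < #|S| by case/andP: hS.
rewrite cyc_at_adj ?eqxx // leqnn /= -addn1 ltn_add2l; exact: leq_trans S5.
Qed.

Lemma cyc_at_near x0 (S : {set V}) k k' : hole S -> k <= k' <= k + 2 ->
  cyc_at x0 S k != cyc_at x0 S k' -> ~~ adj (cyc_at x0 S k) (cyc_at x0 S k') ->
  (forall z, z \in S -> ~~ (adj (cyc_at x0 S k) z && adj z (cyc_at x0 S k'))) ->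
  False.
Proof.
move=> hS kk n1 n2 n3.
have [e|[e|e]] : k' = k \/ k' = k.+1 \/ k' = k.+2 by lia.
- by rewrite e eqxx in n1.
- by rewrite e cyc_at_adjS in n2.
by have := n3 _ (cyc_at_mem x0 k.+1 hS); rewrite e !cyc_at_adjS.
Qed.

Lemma chordal_arc D r x0 (S : {set V}) b : hole S -> #|N b| <= D ->
  D.+1 * r <= #|S| -> 3 <= r -> chordal b S -> ~~ has_long G r x0 S b ->
  exists a s, [/\ 3 <= s < r, adj b (cyc_at x0 S a.+1),
     adj b (cyc_at x0 S (a.+1 + s)) &
     forall k, k < #|S| -> adj b (cyc_at x0 S (a.+1 + k)) -> k <= s].
Proof.
move=> hS dD rL r3 /andP [bS /exists_inP [u uS /exists_inP [w wS]]].
move=> /and5P [bu bw uw nuw /forall_inP Hz] nl.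
have [i0 Hi0] := free_window x0 hS dD rL.
have LV : #|S| <= #|V| by apply: (max_card (mem S)).
have L5 : 4 < #|S| by case/andP: hS.
have [p [s [p0 sr bp bs Hk]]] : exists p s, [/\ 0 < p, s < r,
    adj b (cyc_at x0 S p), adj b (cyc_at x0 S (p + s)) &
    forall k, k < #|S| -> adj b (cyc_at x0 S (p + k)) -> k <= s].
  apply: (@periodic_arc (fun k => adj b (cyc_at x0 S k)) #|S| r i0) => //.
  - by move=> k; rewrite cyc_at_per.
  - by have [d dL e] := cyc_at_from x0 i0 hS uS; exists d; rewrite // -e.
  move=> j g rg gL bj bg; case: (boolP (has (fun k => adj b (cyc_at x0 S (j + #|S| - k))) (iota 1 g.-1))).
    by move=> /hasP [k]; rewrite mem_iota => kg bk; exists k => //; clear -kg; lia.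
  move=> nk; exfalso; case/negP: nl; apply/hasP; exists (j %% #|S|).
    by rewrite mem_iota add0n ltn_mod; clear -L5; lia.
  apply/hasP; exists g; first by rewrite mem_iota add0n; clear -L5 LV gL rg r3; lia.
  have xj k : k <= #|S| -> cyc_at x0 S (j %% #|S| + #|S| - k) = cyc_at x0 S (j + #|S| - k).
    by move=> kL; apply: cyc_at_mod; rewrite -!addnBA // modnDml.
  have gL' : g <= #|S| by clear -gL; lia.
  have xj0 : cyc_at x0 S (j %% #|S| + #|S|) = cyc_at x0 S (j + #|S|).
    by have := xj 0 (leq0n _); rewrite !subn0.
  rewrite /long rg gL bS xj0 xj // bj bg /=.
  apply/allP => k kg; rewrite xj; last first.
    by move: kg; rewrite mem_iota; clear -gL'; lia.
  by apply: contra nk => bk; apply/hasP; exists k.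
(* The successor form leaves a position before the arc, which becomes the vertex [e] of
   [swap_data]. *)
have es : exists a, a.+1 = p by exists p.-1; rewrite prednK.
case: es => a ea; exists a, s; rewrite ea; split=> //; rewrite sr andbT.
have [ku kuL eu] := cyc_at_from x0 p hS uS; have [kw kwL ew] := cyc_at_from x0 p hS wS.
have hu : ku <= s by apply: Hk => //; rewrite -eu.
have hw : kw <= s by apply: Hk => //; rewrite -ew.
rewrite leqNgt; apply/negP => s2.
case: (leqP ku kw) => k.
  have hk : p + ku <= p + kw <= p + ku + 2 by clear -hu hw s2 k; lia.
  have := @cyc_at_near x0 S _ _ hS hk; rewrite -eu -ew; apply; [exact: uw|exact: nuw|exact: Hz].
have hk : p + kw <= p + ku <= p + kw + 2 by clear -hu hw s2 k; lia.
have := @cyc_at_near x0 S _ _ hS hk; rewrite -eu -ew; apply; first by rewrite eq_sym.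
  by rewrite adjC.
by move=> z zS; rewrite andbC adjC [adj w z]adjC; apply: Hz.
Qed.

(** These are phi 2, ..., phi s, the vertices strictly between the ends phi 1 and phi (s + 1) of the
    arc. *)
Definition arc_mid (phi : nat -> V) (s : nat) : seq V :=
  mkseq (fun i => phi i.+2) s.-1.

(** All neighbours of [b] on S lie on the arc and both its ends see [b], so [b] alone can replace
    the inner vertices. There are s - 1 >= 2 of these, so the exchange changes the length. *)
Lemma arc_swap D r x0 (S : {set V}) b : hole S -> #|N b| <= D -> D.+1 * r <= #|S| ->
  3 <= r -> chordal b S -> ~~ has_long G r x0 S b ->
  exists a s, let phi k := cyc_at x0 S (a + k) in
  [/\ 3 <= s < r, adj b (phi 1),
    swap_data G (phi 0) (phi 1) (phi s.+1) (phi s.+2) (arc_mid phi s) [:: b] &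
    swappable G (phi 0) (phi 1) (phi s.+1) (phi s.+2) (arc_mid phi s) [:: b] S].
Proof.
move=> hS dD rL r3 cb nl.
have [a [s [/andP [s3 sr] bf bl Hk]]] := chordal_arc hS dD rL r3 cb nl.
have bS : b \notin S by case/andP: cb.
exists a, s => phi.
have L5 : 4 < #|S| by case/andP: hS.
have sL : s + 5 <= #|S|.
  have D0 : 0 < D.
    by apply: leq_trans dD; apply/card_gt0P; exists (phi 1); rewrite in_nbr /phi addn1.
  by apply: leq_trans rL; clear -D0 s3 sr; nia.
have phiS k : phi k \in S by apply: cyc_at_mem.
have adjE i j : i < j -> j <= s.+2 -> adj (phi i) (phi j) = (j == i.+1).
  move=> ij js; rewrite /phi cyc_at_adj //; last by lia.
  by rewrite -addnS eqn_add2l -addnS -addnA eqn_add2l; lia.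
have neqE i j : i < j -> j <= s.+2 -> phi i != phi j.
  by move=> ij js; apply: cyc_at_inj => //; lia.
have bf' : adj b (phi 1) by rewrite /phi addn1.
have bl' : adj b (phi s.+1) by rewrite /phi addnS -addSn.
have neqF i j : i < j -> j <= s.+2 -> phi i = phi j -> False.
  by move=> ij js e; have := neqE i j ij js; rewrite e eqxx.
have bphi k : phi k != b by apply: contraNneq bS => <-.
have szA : size (arc_mid phi s) = s.-1 by rewrite size_mkseq.
have memA z : reflect (exists2 i, 2 <= i <= s & z = phi i) (z \in arc_mid phi s).
  apply: (iffP idP) => [/(nthP b) [i]|[i i2 ->]].
    rewrite szA => iA <-; exists i.+2; first by lia.
    by rewrite nth_mkseq.
  apply/(nthP b); exists i.-2; first by rewrite szA; lia.
  by rewrite nth_mkseq; [congr phi|]; clear -i2; lia.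
have nA i : i <= s.+2 -> ~~ (2 <= i <= s) -> phi i \notin arc_mid phi s.
  move=> i2 ni; apply/negP => /memA [j j2 e].
  have : i != j by apply: contraNneq ni => ->.
  rewrite neq_ltn => /orP [ij|ij].
    by apply: (neqF i j ij _ e); clear -j2; lia.
  by apply: (neqF j i ij i2 (esym e)).
have pathE : phi 1 :: rcons (arc_mid phi s) (phi s.+1) = mkseq (fun i => phi i.+1) s.+1.
  apply: (@eq_from_nth _ b); first by rewrite size_mkseq [size _]/= size_rcons szA; clear -s3; lia.
  move=> i; rewrite [size _]/= size_rcons szA => iA; rewrite nth_mkseq; last by lia.
  case: i iA => [|i] iA //=; rewrite nth_rcons szA; case: ltnP => h.
    by rewrite nth_mkseq.
  have -> : i = s.-1 by clear -iA h; lia.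
  by rewrite eqxx [s.-1.+2](_ : _ = s.+1) //; clear -s3; lia.
split=> //.
- by rewrite s3.
- apply/and5P; split=> //.
  + rewrite pathE; apply/(induced_path_nthP G b); split.
      apply/mkseq_uniqP => i j; rewrite !inE => iS jS e; apply/eqP.
      case: (ltngtP i j) => // ij.
        by case: (neqF i.+1 j.+1 _ _ e); [exact: ij | exact: leq_trans jS _].
      by case: (neqF j.+1 i.+1 _ _ (esym e)); [exact: ij | exact: leq_trans iS _].
    move=> i j; rewrite size_mkseq => /andP [ij js].
    by rewrite !nth_mkseq ?(ltn_trans ij js) // adjE //; lia.
  + apply/and3P; split.
    * by rewrite adjC bf' /= adjE ?eqSS //; clear -s3; lia.
    * by rewrite !inE negb_or bphi neqE //; lia.
    by rewrite /= bl' inE eq_sym bphi.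
  + by rewrite -size_eq0 szA; clear -s3; lia.
  apply/and3P; split.
  + by apply/hasPn => z /memA [i _ ->]; rewrite /= inE bphi.
  + apply/and5P; split; [by rewrite adjE|by rewrite adjE ?eqxx|exact: neqE| |exact: neqE].
    by rewrite eq_sym; apply: neqE.
  rewrite !mem_cat !inE !negb_or !bphi !andbT; apply/andP; split; apply: nA; clear -s3; lia.
apply/and3P; split.
- by rewrite !phiS.
- apply/orP; left; apply/eqP/setP => z; rewrite !inE mem_cat inE.
  case: (boolP (z \in arc_mid phi s)) => [/memA [i _ ->]|_]; first by rewrite phiS.
  by case: eqP => [->|]; rewrite ?(negbTE bS) ?andbF.
apply/forall_inP => z; rewrite inE mem_cat => zZ; apply/forall_inP => w wS.
apply/implyP => zw.
have [d dL ew] := cyc_at_from x0 a.+1 hS wS.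
have wphi : w = phi d.+1 by rewrite ew /phi addnS -addSn.
have target d' : d' <= s -> w = phi d'.+1 ->
   [|| w \in swap_zone (arc_mid phi s) [:: b], w == phi 1 | w == phi s.+1].
  move=> ds ->; rewrite inE mem_cat.
  case: d' ds => [|d'] ds; first by rewrite [phi 1 == phi 1]eqxx !orbT.
  case: (ltnP d' s.-1) => h; last first.
    have -> : d'.+2 = s.+1 by clear -ds h; lia.
    by rewrite [phi s.+1 == phi s.+1]eqxx !orbT.
  by rewrite (introT (memA _)) //; exists d'.+2 => //; clear -h; lia.
case/orP: zZ => [/memA [i i2 ez]|]; last first.
  rewrite inE => /eqP ez; apply: target wphi.
  by apply: Hk => //; rewrite -ew -ez.
have [j jL ej] := cyc_at_from x0 (a + i) hS wS.
have ez' : z = cyc_at x0 S (a + i) by [].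
case: j jL ej => [|j] jL ej.
  by move: zw; rewrite ez' {1}ej addn0 adjxx.
move: zw; rewrite ez' {1}ej cyc_at_adj //; last by clear -jL; lia.
case/orP => /eqP e.
  apply: (target i); first by clear -i2; lia.
  by rewrite ej e /phi addnS.
apply: (target i.-2); first by clear -i2; lia.
rewrite ej /phi -(cyc_at_per G x0 S (a + i.-2.+1)); apply: cyc_at_mod.
by congr (_ %% _); clear -e i2; lia.
Qed.

End Arcs.

(** * Few vertices are often chordal *)

Section Balls.

Variables (V : finType) (G : sgraph V).
Local Notation adj := (adj G).
Local Notation N := (neighbours G).

Fixpoint ball (k : nat) (v : V) : {set V} :=
  if k is k'.+1 then ball k' v :|: \bigcup_(x in ball k' v) N x else [set v].

Lemma ball_center k v : v \in ball k v.
Proof. by elim: k => [|k IH] /=; rewrite inE ?IH. Qed.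

Lemma ball_mono j k v : j <= k -> ball j v \subset ball k v.
Proof.
elim: k => [|k IH]; first by rewrite leqn0 => /eqP ->.
rewrite leq_eqVlt => /orP [/eqP -> //|/IH h].
exact: subset_trans h (subsetUl _ _).
Qed.

Lemma ball_adj k v x y : x \in ball k v -> adj x y -> y \in ball k.+1 v.
Proof.
move=> xk xy; rewrite /= inE; apply/orP; right; apply/bigcupP.
by exists x; rewrite ?in_nbr.
Qed.

Lemma ball_trans i j v x y : x \in ball i v -> y \in ball j x -> y \in ball (i + j) v.
Proof.
move=> xi; elim: j y => [|j IH] y /=; first by rewrite addn0 inE => /eqP ->.
rewrite addnS inE => /orP [/IH h|/bigcupP [z /IH zi]].
  exact: subsetP (ball_mono v (leqnSn _)) _ h.
by rewrite in_nbr; apply: ball_adj.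
Qed.

Lemma ball_sym k v x : x \in ball k v -> v \in ball k x.
Proof.
elim: k x => [|k IH] x /=; first by rewrite !inE eq_sym.
rewrite inE => /orP [/IH h|/bigcupP [z /IH zi]].
  exact: subsetP (ball_mono x (leqnSn k)) _ h.
rewrite in_nbr adjC => xz; rewrite -/(ball k.+1 x) -add1n.
by apply: ball_trans zi; apply: ball_adj xz; rewrite inE.
Qed.

Lemma card_ball D k v : (forall v, #|N v| <= D) -> #|ball k v| <= D.+1 ^ k.
Proof.
move=> HD; elim: k => [|k IH] /=; first by rewrite cards1.
apply: leq_trans (leq_card_setU _ _) _; rewrite expnS mulSn.
apply: leq_add => //; apply: (@leq_trans (\sum_(x in ball k v) #|N x|)).
  elim/big_ind2: _ => [|a b c d h1 h2|j _] //; first by rewrite cards0.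
  by apply: leq_trans (leq_card_setU _ _) (leq_add h1 h2).
apply: (@leq_trans (\sum_(x in ball k v) D)); first by apply: leq_sum.
by rewrite sum_nat_const mulnC leq_mul2l IH orbT.
Qed.

(** Greedy choice: each selected vertex rules out at most [beta] candidates, where [beta] is here a
    bound on the sizes of the sets [B x]. *)
Lemma far_select (B : V -> {set V}) beta m (X : {set V}) :
  (forall x, #|B x| <= beta) -> (forall x, x \in B x) -> m * beta < #|X| ->
  exists s, [/\ size s = m, {subset s <= X} &
    pairwise (fun x y => y \notin B x) s].
Proof.
move=> HB Bx; elim: m X => [|m IH] X mX; first by exists [::].
have [x xX] : exists x, x \in X by apply/card_gt0P; apply: leq_ltn_trans mX.
have [|s [ss sX ps]] := IH (X :\: B x).
  have := cardsID (B x) X; have := HB x.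
  have : #|X :&: B x| <= #|B x| by apply: subset_leq_card; apply: subsetIr.
  by move: mX; rewrite mulSn; lia.
exists (x :: s); rewrite /= ss ps; split=> //.
  by move=> z; rewrite inE => /orP [/eqP -> //|/sX]; rewrite inE => /andP [].
by rewrite andbT; apply/allP => z /sX; rewrite inE => /andP [].
Qed.

End Balls.

Section FarSwaps.

Variables (F : archiRealFieldType) (V : finType) (G : sgraph V).
Local Notation adj := (adj G).
Local Notation N := (neighbours G).
Local Notation hole := (hole G).
Local Notation ball := (ball G).

Variables (D : nat) (m rho : nat) (e f l e' b : 'I_m -> V) (A B : 'I_m -> seq V).
Hypothesis D3 : 3 <= D.
Hypothesis HD : forall v, #|N v| <= D.
Hypothesis sd : forall j, swap_data G (e j) (f j) (l j) (e' j) (A j) (B j).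
Hypothesis szAB : forall j, size (A j) != size (B j).
Local Notation Z j := (swap_zone (A j) (B j)).
Hypothesis ball_e : forall j, [set e j; f j; l j; e' j] \subset ball rho (b j).
Hypothesis ball_Z : forall j, Z j \subset ball rho (b j).
Hypothesis far : forall j k, j != k -> b j \notin ball (rho + rho).+1 (b k).

Lemma far_disjoint j k x y : j != k -> x \in ball rho (b j) -> y \in ball rho (b k) ->
  (x != y) && ~~ adj y x.
Proof.
move=> jk xj yk; have jx := ball_sym xj; apply/andP; split.
  apply: contraNneq (far jk) => exy; rewrite exy in jx.
  exact: subsetP (ball_mono G _ (leqnSn _)) _ (ball_trans yk jx).
apply: contra (far jk) => yx; rewrite -addSn.
exact: ball_trans (ball_adj yk yx) jx.
Qed.

Lemma far_indep j k S : j != k ->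
  swappable G (e k) (f k) (l k) (e' k) (A k) (B k) (flip (Z j) S) =
  swappable G (e k) (f k) (l k) (e' k) (A k) (B k) S.
Proof.
move=> jk; apply: swappable_indep.
- rewrite disjoint_subset; apply/subsetP => x /(subsetP (ball_Z j)) xj.
  rewrite inE; apply/negP => /(subsetP (ball_e k)) xk.
  by have := far_disjoint jk xj xk; rewrite eqxx.
- rewrite disjoint_subset; apply/subsetP => x /(subsetP (ball_Z j)) xj.
  rewrite inE; apply/negP => /(subsetP (ball_Z k)) xk.
  by have := far_disjoint jk xj xk; rewrite eqxx.
move=> z w /(subsetP (ball_Z k)) zk /(subsetP (ball_Z j)) wj.
by case/andP: (far_disjoint jk wj zk).
Qed.

Lemma far_flip_zone j k S : j != k -> Z k :\: flip (Z j) S = Z k :\: S /\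
   flip (Z j) S :&: Z k = S :&: Z k.
Proof.
move=> jk; have H x : x \in Z k -> (x \in flip (Z j) S) = (x \in S).
  move=> xk; rewrite in_flip; case: (boolP (x \in Z j)) => xj; last by rewrite addbF.
  have := far_disjoint jk (subsetP (ball_Z j) _ xj) (subsetP (ball_Z k) _ xk).
  by rewrite eqxx.
split; apply/setP => x; rewrite [LHS]inE [RHS]inE.
  by case: (boolP (x \in Z k)) => [/H ->|]; rewrite ?andbF.
by case: (boolP (x \in Z k)) => [/H ->|]; rewrite ?andbF.
Qed.

Lemma card_flip_diff (Y S : {set V}) : #|flip Y S| + #|S :&: Y| = #|S| + #|Y :\: S|.
Proof. by rewrite card_flip -(cardsID Y S); lia. Qed.

Local Open Scope ring_scope.

(** [bessel] is applied to g S = 3|S| - n. Exchanging arcs of different sizes changes g by at least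
    3, and exchanges at distant places do not influence each other, so the left side is bounded by
    four times the second moment. *)
Lemma far_swaps_bound :
  \sum_j #|[set S | hole S && swappable G (e j) (f j) (l j) (e' j) (A j) (B j) S]|%:R
   <= 4%:R * (var_const F D * gam F #|V|).
Proof.
pose P j S := swappable G (e j) (f j) (l j) (e' j) (A j) (B j) S.
pose T j S := flip (Z j) S.
pose g (S : {set V}) : F := (3 * #|S|)%:R - #|V|%:R.
have gT j S : g S - g (T j S) = 3%:R * (#|S :&: Z j|%:R - #|Z j :\: S|%:R).
  have := congr1 (fun k : nat => k%:R : F) (card_flip_diff (Z j) S).
  rewrite /= !natrD /g /T !natrM => h; lra.
have := @bessel F {set V} 'I_m hole P T g _ _ _ _.
have h1 j S : hole S -> P j S -> hole (T j S) by apply: swap_hole.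
have h2 j S : hole S -> P j S -> P j (T j S) by move=> _; apply: swappable_flip.
have h3 j S : hole S -> P j S -> T j (T j S) = S by move=> *; apply: flipK.
move=> /(_ h1 h2 h3); set h4 := (X in (X -> _) -> _); have H4 : h4.
  move=> j k S jk hS pS; rewrite /P far_indep // !gT.
  by have [-> ->] := far_flip_zone S jk.
move=> /(_ H4) H; apply: le_trans (le_trans _ H) _; last first.
  by rewrite ler_pM2l ?ltr0n // variance_bound.
apply: ler_sum => j _; rewrite -sum1dep_card natr_sum.
rewrite [X in _ <= X](bigID (P j)) /=.
apply: ler_wpDr; first by apply: sumr_ge0 => S _; apply: sqr_ge0.
apply: ler_sum => S /andP [hS pS]; rewrite ifT // gT.
have [cA cB] : #|[set:: A j]| = size (A j) /\ #|[set:: B j]| = size (B j).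
  case/and5P: (sd j) => /induced_path_uniq UA /induced_path_uniq UB _ _ _.
  move: UA UB; rewrite !cons_uniq !rcons_uniq => /and3P [_ _ UA] /and3P [_ _ UB].
  by rewrite !cardsE !(card_uniqP _).
have cZ : #|Z j| = (size (A j) + size (B j))%N.
  rewrite (_ : Z j = [set:: A j] :|: [set:: B j]); last by apply/setP => x; rewrite !inE mem_cat.
  rewrite cardsU cA cB (_ : _ :&: _ = set0) ?cards0 ?subn0 //.
  apply/setP => x; rewrite !inE; apply/negbTE.
  case/and5P: (sd j) => _ _ _ _ /and3P [dAB _ _].
  by apply: contra dAB => /andP [xA xB]; apply/hasP; exists x.
have cD := cardsID S (Z j); rewrite setIC in cD.
have : (#|S :&: Z j| != #|Z j :\: S|)%N.
  case/and3P: pS => _ /orP [/eqP h|/eqP h] _; rewrite h ?cA ?cB in cD *;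
   have := szAB j; lia.
rewrite -(eqr_nat F) => nz.
have : 1 <= `|(#|S :&: Z j|%:R - #|Z j :\: S|%:R : F)|.
  case: (ltngtP #|S :&: Z j| #|Z j :\: S|) => h.
  - rewrite distrC ger0_norm; last by rewrite subr_ge0 ler_nat; exact: ltnW h.
    rewrite -(natrB _ (ltnW h)) ler1n subn_gt0; exact: h.
  - rewrite ger0_norm; last by rewrite subr_ge0 ler_nat; exact: ltnW h.
    rewrite -(natrB _ (ltnW h)) ler1n subn_gt0; exact: h.
  by rewrite h eqxx in nz.
set t := _ - _ => t1; rewrite -(normr1 F) -[X in _ <= X]real_normK ?num_real //.
rewrite normr1 -[X in X <= _](expr1n _ 2) lerXn2r ?nnegrE ?normr_ge0 //.
rewrite normrM normr_nat; move: (`|t|) t1 => u; lra.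
Qed.

End FarSwaps.

Section FewChordal.
Local Open Scope ring_scope.
Variables (F : archiRealFieldType).

Lemma nat_above (x : F) : exists k : nat, x < k%:R.
Proof.
exists (Num.bound `|x|); apply: le_lt_trans (ler_norm x) _.
exact: archi_boundP (normr_ge0 x).
Qed.

Lemma exists_ge_pigeon (I T : finType) (X : {set I}) (Y : {set T}) (Q : T -> pred I) (c : F) tau :
  (forall i, i \in X -> exists2 t, t \in Y & Q t i) -> (#|Y| <= tau)%N -> (0 < tau)%N ->
  c <= #|X|%:R -> 0 < c -> exists2 t, t \in Y & c / tau%:R <= #|[set i in X | Q t i]|%:R.
Proof.
move=> H Ytau tau0 cX c0.
have Y0 : (0 < #|Y|)%N.
  have : 0 < #|X|%:R :> F by apply: lt_le_trans cX.
  rewrite ltr0n => /card_gt0P [i /H [t tY _]]; apply/card_gt0P; by exists t.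
apply: exists_ge_avg => //.
apply: (@le_trans _ _ c).
  rewrite -mulrA ler_piMr // ?(ltW c0) // mulrC ler_pdivrMr ?ltr0n // mul1r.
  by rewrite ler_nat.
apply: le_trans cX _; rewrite -natr_sum ler_nat.
under eq_bigr do rewrite -sum1dep_card.
rewrite (exchange_big_dep (mem X)) /=; last by move=> t i _ /andP [].
rewrite -sum1_card; apply: leq_sum => i iX.
have [t tY qti] := H i iX.
by rewrite (bigD1 t) ?tY ?iX.
Qed.

(** Near b there are at most [tau] possible exchanges, so one of them is available in at least eps /
    tau * gam n of the holes. Among more than M such vertices b, m can be chosen pairwise far apart,
    and their exchanges together contradict [far_swaps_bound]. Neither m nor M depends on the
    graph. *)
Lemma few_chordal_short (D r : nat) (eps : F) : (3 <= D)%N -> (3 <= r)%N -> 0 < eps ->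
  exists M : nat, forall (V : finType) (G : sgraph V) (x0 : V) (X : {set V}),
    (forall v, (#|neighbours G v| <= D)%N) ->
    (forall b, b \in X -> eps * gam F #|V| <=
      #|[set S | [&& hole G S, (D.+1 * r <= #|S|)%N, chordal G b S &
           ~~ has_long G r x0 S b]]|%:R) ->
    (#|X| <= M)%N.
Proof.
move=> D3 r3 eps0.
have [rho erho] : exists rho, rho = r.+4 by exists r.+4.
(* A factor r for the length s of the arc, and r + 3 positions each filled by a vertex of the ball
   of radius [rho] around b. *)
pose tau := (r * (D.+1 ^ rho) ^ r.+3)%N.
have tau0 : (0 < tau)%N by rewrite muln_gt0 expn_gt0 expn_gt0 /=; lia.
have [m Hm] := nat_above (4%:R * var_const F D * tau%:R / eps).
exists (m * D.+1 ^ (rho + rho).+1)%N => V G x0 X HD HX.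
rewrite leqNgt; apply/negP => mX.
have Hb (b : V) : b \in X -> exists phi : nat -> V, exists s,
   [/\ (3 <= s < r)%N,
    swap_data G (phi 0) (phi 1) (phi s.+1) (phi s.+2) (arc_mid phi s) [:: b],
    forall k, (k < r.+3)%N -> phi k \in ball G rho b &
    eps / tau%:R * gam F #|V| <=
     #|[set S | hole G S && swappable G (phi 0) (phi 1) (phi s.+1) (phi s.+2)
                              (arc_mid phi s) [:: b] S]|%:R].
  move=> bX; have hb := HX b bX; set XX := [set S | _] in hb.
  pose fn (p : {ffun 'I_r.+3 -> V}) k := p (inord k).
  pose Y := setX [set: 'I_r] [set p : {ffun 'I_r.+3 -> V} | p \in ffun_on (mem (ball G rho b))].
  pose Q (t : 'I_r * {ffun 'I_r.+3 -> V}) S :=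
    [&& (3 <= t.1)%N,
     swap_data G (fn t.2 0) (fn t.2 1) (fn t.2 t.1.+1) (fn t.2 t.1.+2) (arc_mid (fn t.2) t.1) [:: b] &
     swappable G (fn t.2 0) (fn t.2 1) (fn t.2 t.1.+1) (fn t.2 t.1.+2) (arc_mid (fn t.2) t.1) [:: b] S].
  have HY : (#|Y| <= tau)%N.
    rewrite cardsX cardsT card_ord cardsE card_ffun_on card_ord leq_mul2l.
    by apply/orP; right; rewrite leq_exp2r // card_ball.
  have HQ S : S \in XX -> exists2 t, t \in Y & Q t S.
    rewrite inE => /and4P [hS rS cS lS].
    have [a [s [/andP [s3 sr] bphi sdat swp]]] := arc_swap hS (HD b) rS r3 cS lS.
    set phi := fun k => cyc_at G x0 S (a + k) in bphi sdat swp.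
    have step k : adj G (phi k) (phi k.+1) by rewrite /phi addnS cyc_at_adjS.
    have inb k : phi k.+1 \in ball G k.+1 b.
      elim: k => [|k IH]; last exact: ball_adj IH (step _).
      by apply: (ball_adj _ bphi); rewrite inE.
    have inb' k : (k < r.+3)%N -> phi k \in ball G rho b.
      case: k => [|k] kr; last first.
        by apply: subsetP (inb k); apply: ball_mono; rewrite erho; move: kr; clear; lia.
      have : phi 0 \in ball G 2 b by apply: (ball_adj (inb 0)); rewrite adjC step.
      by apply: subsetP; apply: ball_mono; rewrite erho.
    pose p := [ffun k : 'I_r.+3 => phi k].
    have fnE k : (k < r.+3)%N -> fn p k = phi k by move=> kr; rewrite /fn ffunE inordK.
    have midE : arc_mid (fn p) s = arc_mid phi s.
      rewrite /arc_mid /mkseq; apply/eq_in_map => i; rewrite mem_iota => /andP [_ ib].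
      by apply: fnE; move: sr ib; clear; lia.
    exists (Ordinal sr, p).
      rewrite !inE /=; apply/ffun_onP => k; rewrite ffunE; exact: inb'.
    rewrite /Q /= s3 midE !fnE //; try (by move: sr; clear; lia).
    by rewrite sdat.
  have [|t tY ht] := exists_ge_pigeon HQ HY tau0 hb.
    exact: mulr_gt0 eps0 (gam_gt0 _ _).
  have [S0 QS0] : exists S, Q t S.
    have : 0 < #|[set i in XX | Q t i]|%:R :> F.
      apply: lt_le_trans ht; apply: divr_gt0; last by rewrite ltr0n.
      exact: mulr_gt0 eps0 (gam_gt0 _ _).
    by rewrite ltr0n => /card_gt0P [S]; rewrite inE => /andP [_ q]; exists S.
  case/and3P: QS0 => t3 sdat _.
  exists (fn t.2), t.1; split=> //.
  - by rewrite t3 ltn_ord.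
  - move=> k kr; move: tY; case: (t) => t1 t2; rewrite in_setX => /andP [_].
    by rewrite inE => /ffun_onP H; apply: H.
  rewrite mulrAC; apply: le_trans ht _; rewrite ler_nat; apply: subset_leq_card.
  apply/subsetP => S; rewrite !inE => /andP [/and4P [hS _ _ _]].
  by rewrite /Q t3 sdat hS.
have [s [ss sX ps]] := far_select (fun x => card_ball (rho + rho).+1 x HD)
   (fun x => ball_center G _ x) mX.
pose b (j : 'I_m) := nth x0 s j.
have bX j : b j \in X by apply: sX; rewrite mem_nth // ss.
have [phi Hphi] : exists phi : 'I_m -> nat -> V, forall j, exists s,
   [/\ (3 <= s < r)%N,
    swap_data G (phi j 0) (phi j 1) (phi j s.+1) (phi j s.+2) (arc_mid (phi j) s) [:: b j],
    forall k, (k < r.+3)%N -> phi j k \in ball G rho (b j) &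
    eps / tau%:R * gam F #|V| <=
     #|[set S | hole G S && swappable G (phi j 0) (phi j 1) (phi j s.+1) (phi j s.+2)
                              (arc_mid (phi j) s) [:: b j] S]|%:R].
  apply: (@fin_all_exists _ (fun _ => nat -> V)
    (fun j ph => exists s, [/\ (3 <= s < r)%N,
    swap_data G (ph 0) (ph 1) (ph s.+1) (ph s.+2) (arc_mid ph s) [:: b j],
    forall k, (k < r.+3)%N -> ph k \in ball G rho (b j) &
    eps / tau%:R * gam F #|V| <=
     #|[set S | hole G S && swappable G (ph 0) (ph 1) (ph s.+1) (ph s.+2)
                              (arc_mid ph s) [:: b j] S]|%:R])).
  by move=> j; apply: Hb.
have [q Hq] := fin_all_exists Hphi.
have := @far_swaps_bound F V G D m rho (fun j => phi j 0) (fun j => phi j 1)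
  (fun j => phi j (q j).+1) (fun j => phi j (q j).+2) b
  (fun j => arc_mid (phi j) (q j)) (fun j => [:: b j]) D3 HD.
have k1 j : swap_data G (phi j 0) (phi j 1) (phi j (q j).+1) (phi j (q j).+2) (arc_mid (phi j) (q j)) [:: b j].
  by case: (Hq j).
have k2 j : size (arc_mid (phi j) (q j)) != size [:: b j].
  case: (Hq j) => /andP [h _] _ _ _; rewrite size_mkseq; clear -h; apply/eqP => /=; lia.
have inb j k : (k < r.+3)%N -> phi j k \in ball G rho (b j) by case: (Hq j) => _ _ h _; apply: h.
have qr j : (3 <= q j < r)%N by case: (Hq j).
have k3 j : [set phi j 0; phi j 1; phi j (q j).+1; phi j (q j).+2] \subset ball G rho (b j).
  apply/subsetP => x; rewrite !inE -!orbA => /or4P [] /eqP ->; apply: inb => //;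
  have := qr j; clear; lia.
have k4 j : swap_zone (arc_mid (phi j) (q j)) [:: b j] \subset ball G rho (b j).
  apply/subsetP => x; rewrite inE mem_cat => /orP [/mapP [i]|]; last first.
    by rewrite inE => /eqP ->; apply: ball_center.
  rewrite mem_iota => hi ->; apply: inb; have := qr j; move: hi; clear; lia.
have k5 j k : j != k -> b j \notin ball G (rho + rho).+1 (b k).
  move=> jk; case: (ltngtP j k) => h.
  - apply: contra (_ : b k \notin ball G (rho + rho).+1 (b j)); first exact: ball_sym.
    by have /(pairwiseP x0)/(_ j k) := ps; rewrite !inE ss; apply.
  - by have /(pairwiseP x0)/(_ k j) := ps; rewrite !inE ss; apply.
  by case/eqP: jk; apply: val_inj.
move=> /(_ k1 k2 k3 k4 k5) Hfin.
have : m%:R * (eps / tau%:R * gam F #|V|) <= 4%:R * (var_const F D * gam F #|V|).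
  apply: le_trans Hfin.
  rewrite -[in X in X <= _](card_ord m) -sum1_card natr_sum mulr_suml.
  by apply: ler_sum => j _; rewrite mul1r; case: (Hq j).
move: (gam F #|V|) (gam_gt0 F #|V|) (var_const F D) Hm => g g0 K Hm.
rewrite !mulrA (ler_pM2r g0) leNgt => /negP; apply.
by rewrite -ltr_pdivrMr ?invr_gt0 ?ltr0n // invrK -ltr_pdivrMr.
Qed.

(** A hole in which b is chordal has a long gap at b, or has fewer than (D + 1) r vertices, or
    admits an exchange at b. Each kind gets a third of eps. The first is frequent for few b by
    [long_bound], once r is large; the second is rare by the variance bound; the third is frequent
    for a bounded number of b. *)
Lemma few_chordal (D : nat) (eps kappa : F) : (3 <= D)%N -> 0 < eps -> 0 < kappa ->
  exists n0 : nat, forall (V : finType) (G : sgraph V),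
    (n0 <= #|V|)%N -> (forall v, (#|neighbours G v| <= D)%N) ->
    #|[set b | eps * gam F #|V| <= #|[set S | hole G S && chordal G b S]|%:R]|%:R
      <= kappa * #|V|%:R.
Proof.
move=> D3 eps0 kappa0.
have eps3 : 0 < eps / 3%:R by rewrite divr_gt0 ?ltr0n.
have [C1 eC1] : exists C1 : F, C1 = 100%:R ^+ 3 * D%:R ^+ 3 by eexists.
have [r0 Hr0] := nat_above (C1 / (eps / 3%:R) / (kappa / 2%:R)).
pose r := (r0 + 3)%N.
have r3 : (3 <= r)%N by rewrite /r; lia.
have [M HM] := few_chordal_short D3 r3 eps3.
have [n1 Hn1] := nat_above (M%:R / (kappa / 2%:R)).
have [n2 Hn2] := nat_above (var_const F D / (eps / 3%:R)).
pose L0 := (D.+1 * r)%N.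
exists (n1 + (3 * L0 + n2.+1))%N => V G nV HD.
have n0 : 0 < #|V|%:R :> F by rewrite ltr0n; clear -nV; lia.
have g0 := gam_gt0 F #|V|.
have [x0 _] : exists x : V, x \in V.
  by apply/card_gt0P; rewrite -(ltr0n F).
pose E b := [set S | hole G S && chordal G b S].
pose Lg b := [set S | hole G S && has_long G r x0 S b].
pose Sm := [set S | hole G S && (#|S| < L0)%N].
pose Sh b := [set S | [&& hole G S, (L0 <= #|S|)%N, chordal G b S & ~~ has_long G r x0 S b]].
have cover b : #|E b|%:R <= #|Lg b|%:R + #|Sm|%:R + #|Sh b|%:R :> F.
  rewrite -!natrD ler_nat.
  apply: leq_trans (leq_trans (leq_card_setU (Lg b :|: Sm) (Sh b)) _).
    apply: subset_leq_card; apply/subsetP => S; rewrite !inE => /andP [-> ->] /=.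
    by case: ltnP => _; case: has_long; rewrite ?orbT.
  by rewrite leq_add2r leq_card_setU.
have HSm : #|Sm|%:R <= eps / 3%:R * gam F #|V|.
  have H := variance_bound F D3 HD.
  have : #|Sm|%:R * n2.+1%:R <= var_const F D * gam F #|V|.
    apply: le_trans H; rewrite (bigID (fun S => S \in Sm)) /=.
    apply: ler_wpDr; first by apply: sumr_ge0 => S _; apply: sqr_ge0.
    rewrite -[#|Sm|]sum1_card natr_sum mulr_suml [X in _ <= X](eq_bigl (mem Sm)); last first.
      by move=> S; rewrite !inE; case: (hole G S).
    apply: ler_sum => S; rewrite inE mul1r => /andP [hS SL].
    have h : (3 * #|S| + n2.+1 <= #|V|)%N by clear -nV SL; lia.
    have h3 : (3 * #|S| <= #|V|)%N by apply: leq_trans h; apply: leq_addr.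
    rewrite -sqrrN opprB -(natrB _ h3) -natrX ler_nat.
    have h1 : (n2.+1 <= #|V| - 3 * #|S|)%N by rewrite leq_subRL.
    apply: (leq_trans h1); rewrite -{1}[X in (X <= _)%N]expn1 leq_pexp2l //.
    exact: leq_trans h1.
  rewrite -ler_pdivlMr ?ltr0n // => h; apply: le_trans h _.
  rewrite ler_pdivrMr ?ltr0n //.
  have hv : var_const F D <= eps / 3%:R * n2.+1%:R.
    rewrite mulrC -ler_pdivrMr //; apply: ltW; apply: lt_le_trans Hn2 _.
    by rewrite ler_nat.
  move: (gam F #|V|) g0 (var_const F D) (eps / 3%:R) hv => g g0 K e hv.
  by rewrite [X in _ <= X]mulrAC ler_pM2r.
pose XL := [set b | eps / 3%:R * gam F #|V| <= #|Lg b|%:R].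
pose XS := [set b | eps / 3%:R * gam F #|V| <= #|Sh b|%:R].
have HXS : (#|XS| <= M)%N by apply: (HM V G x0) => // b; rewrite inE.
have HXL : #|XL|%:R <= kappa / 2%:R * #|V|%:R.
  have H := @long_bound F V G D r x0 HD r3.
  have H2 : #|XL|%:R * (eps / 3%:R * gam F #|V|) <=
      \sum_(S | hole G S) #|[set b | has_long G r x0 S b]|%:R.
    apply: (@le_trans _ _ (\sum_b #|Lg b|%:R)).
      rewrite (bigID (mem XL)) /=.
      apply: ler_wpDr; first by apply: sumr_ge0 => b _; apply: ler0n.
      rewrite -[#|XL|]sum1_card natr_sum mulr_suml; apply: ler_sum => b.
      by rewrite inE mul1r.
    rewrite -!natr_sum ler_nat.
    under eq_bigr do rewrite -sum1dep_card.
    under [leqRHS]eq_bigr do rewrite -sum1dep_card.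
    rewrite (exchange_big_dep (hole G)) /=; last by move=> b S _ /andP [].
    by apply: leq_sum => S hS; rewrite hS.
  have r2 : 0 < (r - 2)%:R :> F by rewrite ltr0n; clear; rewrite /r; lia.
  have H3 : (r - 2)%:R * (#|XL|%:R * (eps / 3%:R * gam F #|V|)) <=
     C1 * (#|V|%:R * gam F #|V|).
    by rewrite eC1; apply: le_trans H; rewrite ler_pM2l.
  have H4 : (r - 2)%:R * #|XL|%:R * (eps / 3%:R) <= C1 * #|V|%:R.
    move: H3 g0; move: (gam F #|V|) (eps / 3%:R) => g e H3 g0.
    by rewrite -(ler_pM2r g0) -[X in X <= _]mulrA -[X in X <= _]mulrA -[X in _ <= X]mulrA.
  have H5 : C1 <= (r - 2)%:R * (eps / 3%:R) * (kappa / 2%:R).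
    rewrite -ler_pdivrMr ?divr_gt0 ?ltr0n // -ler_pdivrMr //.
    rewrite [X in X <= _]mulrAC; apply: ltW; apply: lt_le_trans Hr0 _.
    by rewrite ler_nat /r; clear; lia.
  rewrite -(ler_pM2l r2) -(ler_pM2r eps3); apply: le_trans H4 _.
  rewrite (_ : _ * _ * (eps / _) = (r - 2)%:R * (eps / 3%:R) * (kappa / 2%:R) * #|V|%:R); last by ring.
  by rewrite ler_pM2r.
apply: (@le_trans _ _ (#|XL|%:R + #|XS|%:R)).
  rewrite -natrD ler_nat; apply: leq_trans (leq_card_setU XL XS).
  apply: subset_leq_card; apply/subsetP => b; rewrite !inE => hb.
  case: (leP (eps / 3%:R * gam F #|V|) #|Lg b|%:R) => //= hL.
  have := cover b; move: hb; rewrite -/(E b) -/(Sh b) => hb hc.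
  move: (gam _ _) HSm hL hb hc => gg; lra.
have : #|XS|%:R <= kappa / 2%:R * #|V|%:R.
  apply: (@le_trans _ _ M%:R); first by rewrite ler_nat.
  rewrite mulrC -ler_pdivrMr ?divr_gt0 ?ltr0n //.
  by apply: ltW; apply: lt_le_trans Hn1 _; rewrite ler_nat; clear -nV; lia.
lra.
Qed.

End FewChordal.

(** * Growing a path without losses *)

Section Reach.

Variables (V : finType) (G : sgraph V).
Local Notation adj := (adj G).
Local Notation N := (neighbours G).
Local Notation hole := (hole G).
Local Notation pths := (pths G).
Local Notation ball := (ball G).

Variables (v y u0 : V).
Hypothesis vu0 : u0 \in N v.
Hypothesis vy : y \in N v.
Hypothesis u0y : u0 != y.

Definition cnt k u R := size (pths k y u R).

(* reach s t q u k R Del: after s steps through the vertices q, the path is at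
   u, and t vertices Del of the reservoir have been discarded on the way; k bounds
   the length of the rest. *)
Inductive reach : nat -> nat -> seq V -> V -> nat -> {set V} -> {set V} -> Prop :=
| Reach0 : reach 0 0 [::] u0 #|V| (~: (v |: N v)) set0
| ReachStep s t q u k R Del x : reach s t q u k.+1 R Del -> ~~ adj u y ->
    x \in N u :&: R -> reach s.+1 t (rcons q u) x k (R :\: N u) Del
| ReachDel s t q u k R Del w : reach s t q u k R Del -> w \in R ->
    reach s t.+1 q u k (R :\ w) (w |: Del).

(** Discarding vertices only restricts what may follow, so prepending the steps already made gives a
    path from the root in the full reservoir. *)
Lemma reach_full s t q u k R Del p : reach s t q u k R Del -> ipath G y u R p ->
  exists2 p0, q ++ u :: p = u0 :: p0 & ipath G y u0 (~: (v |: N v)) p0.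
Proof.
move=> H; elim: H p => {s t q u k R Del} [p ip|s t q u k R Del x _ IH uy xu p ip|
    s t q u k R Del w _ IH wR p ip].
- by exists p.
- rewrite cat_rcons; apply: (IH (x :: p)).
  by rewrite /= uy xu.
by apply: IH; apply: ipath_mono ip; apply: subsetDl.
Qed.

Lemma reach_out s t q u k R Del z : reach s t q u k R Del -> z \notin R ->
  z \in Del \/ z = v \/ exists2 q0, q0 \in v :: q & adj q0 z.
Proof.
elim=> {s t q u k R Del} [|s t q u k R Del x _ IH uy xu|s t q u k R Del w _ IH wR].
- rewrite !inE negbK => /orP [/eqP ->|vz]; first by right; left.
  by right; right; exists v; rewrite ?inE ?eqxx.
- rewrite !inE negb_and negbK => /orP [uz|/IH [h|[h|[q0 q0q h]]]].
  + by right; right; exists u; rewrite // inE mem_rcons inE eqxx orbT.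
  + by left.
  + by right; left.
  right; right; exists q0 => //; move: q0q; rewrite !inE mem_rcons inE.
  by case/orP => -> //; rewrite !orbT.
rewrite !inE negb_and negbK => /orP [/eqP ->|/IH [h|[h|h]]].
- by left; rewrite eqxx.
- by left; rewrite h orbT.
- by right; left.
by right; right.
Qed.

Lemma reach_in s t q u k R Del z : reach s t q u k R Del -> z \in R ->
  z != v /\ forall q0, q0 \in v :: q -> ~~ adj q0 z.
Proof.
elim=> {s t q u k R Del} [|s t q u k R Del x _ IH uy xu|s t q u k R Del w _ IH wR].
- rewrite !inE negb_or => /andP [zv nz]; split=> // q0.
  by rewrite inE => /eqP ->.
- rewrite !inE => /andP [nz /IH [zv H]]; split=> // q0.
  rewrite inE mem_rcons inE => /or3P [h|/eqP -> //|h]; apply: H; rewrite inE ?h ?orbT //.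
by rewrite !inE => /andP [_ /IH].
Qed.

Lemma reach_end s t q u k R Del : reach s t q u k R Del ->
  [/\ u \notin R, y \notin R & u != y].
Proof.
have inR z : z \in N v -> z \notin ~: (v |: N v).
  by move=> vz; rewrite !inE -in_nbr vz orbT.
elim=> {s t q u k R Del} [|s t q u k R Del x _ [uR yR neq] uy xu|s t q u k R Del w _ [uR yR neq] wR].
- by rewrite !inR.
- rewrite !inE (negbTE yR) !andbF; case/setIP: xu; rewrite in_nbr => -> xR; split=> //.
  by apply: contraNneq yR => <-.
by rewrite !inE (negbTE uR) (negbTE yR) !andbF.
Qed.

Lemma reach_ball s t q u k R Del : reach s t q u k R Del ->
  u \in ball s.+1 v /\ forall q0, q0 \in v :: q -> q0 \in ball s.+1 v.
Proof.
elim=> {s t q u k R Del} [|s t q u k R Del x _ [IHu IHq] uy xu|s t q u k R Del w _ IH wR] //.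
  split; last by move=> q0; rewrite inE => /eqP ->; apply: ball_center.
  by apply: (ball_adj (ball_center G 0 v)); rewrite -in_nbr.
split; first by apply: (ball_adj IHu); case/setIP: xu; rewrite in_nbr.
move=> q0 h; have sub := subsetP (ball_mono G v (leqnSn s.+1)).
move: h; rewrite inE mem_rcons inE => /or3P [/eqP ->|/eqP ->|h].
- exact: ball_center.
- exact: sub.
by apply: sub; apply: IHq; rewrite inE h orbT.
Qed.

Lemma reach_card D s t q u k R Del : (forall z, #|N z| <= D) ->
  reach s t q u k R Del -> #|Del| <= t /\ #|V| <= #|R| + D.+1 * s.+1 + t.
Proof.
move=> HD; elim=> {s t q u k R Del} [|s t q u k R Del x _ [IH1 IH2] uy xu|s t q u k R Del w _ [IH1 IH2] wR].
- by rewrite cards0 card_nonnbr; have := HD v; split=> //; lia.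
- split=> //; have := card_split G u R.
  have : #|N u :&: R| <= D by apply: leq_trans (HD u); apply/subset_leq_card/subsetIl.
  by move: IH2; rewrite [D.+1 * s.+2]mulnS; clear; lia.
split; first by rewrite cardsU1; move: IH1; clear; case: (_ \notin _); lia.
by move: IH2; rewrite (cardsD1 w R) wR; clear; lia.
Qed.

Lemma reach_size s t q u k R Del : reach s t q u k R Del -> size q = s.
Proof.
elim=> {s t q u k R Del} [|s t q u k R Del x _ IH uy xu|s t q u k R Del w _ IH wR] //.
by rewrite size_rcons IH.
Qed.

Definition path_hole q u p : {set V} := [set:: v :: q ++ u :: rcons p y].

Lemma count_path_holes s t q u k R Del (Q : pred {set V}) (P : seq (seq V)) :
  reach s t q u k R Del -> uniq P ->
  (forall p, p \in P -> [/\ p \in pths k y u R, 2 <= s + size p & Q (path_hole q u p)]) ->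
  size P <= #|[set S | hole S && Q S]|.
Proof.
move=> re UP HP.
have full p : p \in P -> exists2 p0, q ++ u :: p = u0 :: p0 & ipath G y u0 (~: (v |: N v)) p0.
  by case/HP; rewrite mem_pths => /andP [ip _] _ _; apply: reach_full re ip.
have setE p p0 : q ++ u :: p = u0 :: p0 -> path_hole q u p = [set:: v :: u0 :: rcons p0 y].
  by move=> e; rewrite /path_hole -rcons_cons -rcons_cat e.
rewrite -(size_map (path_hole q u)).
have Umap : uniq (map (path_hole q u) P).
  rewrite map_inj_in_uniq // => p p' pP p'P e.
  have [p0 e0 i0] := full p pP; have [p1 e1 i1] := full p' p'P.
  rewrite (setE _ _ e0) (setE _ _ e1) in e.
  have out z : z \in N v -> z \notin ~: (v |: N v) by move=> h; rewrite !inE -in_nbr h orbT.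
  have mem p2 : ipath G y u0 (~: (v |: N v)) p2 ->
     p2 =i [set:: v :: u0 :: rcons p2 y] :&: ~: (v |: N v).
    move=> i2 z; rewrite [RHS]inE.
    have [zR|zR] := boolP (z \in ~: (v |: N v)); rewrite ?andbF ?andbT; last first.
      by apply/negbTE; apply: contra zR => /(ipath_sub i2).
    rewrite inE !in_cons mem_rcons in_cons.
    have /negbTE -> : z != v by apply: contraTneq zR => ->; rewrite !inE eqxx.
    have /negbTE -> : z != u0 by apply: contraTneq zR => ->; apply: out.
    by have /negbTE -> : z != y by apply: contraTneq zR => ->; apply: out.
  have e01 : p0 = p1 by apply: (ipath_inj i0 i1) => z; rewrite (mem _ i0) (mem _ i1) e.
  by move: e0; rewrite e01 -e1 => /(f_equal (drop (size q))); rewrite !drop_size_cat // => -[].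
rewrite -(card_uniqP Umap); apply: subset_leq_card; apply/subsetP => S /mapP [p pP ->].
have [p0 e0 i0] := full p pP; have [pp sp Qp] := HP p pP.
rewrite inE Qp andbT (setE _ _ e0).
have [] // := @ipath_hole V G v u0 y p0 vu0 vy u0y _ i0.
have := f_equal size e0; rewrite size_cat /= (reach_size re) addnS => -[<-]; exact: sp.
Qed.

(* No deviation from uniform branching into 3 within W steps, and no vertex of
   the reservoir is avoided by almost all paths. *)
Fixpoint robust (W k : nat) (u : V) (R : {set V}) : Prop :=
  if W is W'.+1 then exists2 k', k = k'.+1 &
    [/\ ~~ adj u y, #|N u :&: R| = 3,
     forall w, w \in R -> cnt k u R <= 20 * count (fun p => w \in p) (pths k y u R) &
     forall x, x \in N u :&: R -> cnt k u R <= 4 * cnt k' x (R :\: N u) /\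
        robust W' k' x (R :\: N u)]
  else True.

Lemma robust_weaken W k u R : robust W.+1 k u R -> robust W k u R.
Proof.
elim: W k u R => // W IH k u R [k' -> [h1 h2 h3 h4]].
exists k' => //; split=> // x /h4 [h5 h6]; split=> //; exact: IH.
Qed.

Lemma robust_le W W' k u R : W' <= W -> robust W k u R -> robust W' k u R.
Proof.
elim: W => [|W IH]; first by rewrite leqn0 => /eqP ->.
rewrite leq_eqVlt => /orP [/eqP -> //|h] /robust_weaken; exact: IH.
Qed.

Lemma cnt_step k u R : ~~ adj u y ->
  cnt k.+1 u R = \sum_(x in N u :&: R) cnt k x (R :\: N u).
Proof.
move=> uy; rewrite /cnt -sum1_size sum_pthsS (negbTE uy).
by apply: eq_bigr => x _; rewrite sum1_size.
Qed.

Lemma cnt_del k u R w : cnt k u R <= cnt k u (R :\ w) + count (fun p => w \in p) (pths k y u R).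
Proof.
rewrite /cnt -(count_predC (fun p : seq V => w \in p) (pths k y u R)) addnC leq_add2r.
rewrite -size_filter; apply: uniq_leq_size; first by rewrite filter_uniq ?pths_uniq.
move=> p; rewrite mem_filter /= => /andP [wp]; rewrite !mem_pths => /andP [ip ->].
rewrite andbT; apply: (ipath_restrict _ ip) => z zp; rewrite !inE.
by rewrite (ipath_sub ip zp) andbT; apply: contraNneq wp => <-.
Qed.

End Reach.

Section Gain.
Local Open Scope ring_scope.

Variables (F : archiRealFieldType) (V : finType) (G : sgraph V).
Local Notation adj := (adj G).
Local Notation N := (neighbours G).
Local Notation pths := (pths G).
Variables (v y u0 : V).
Local Notation cnt := (cnt G y).
Local Notation reach := (reach G v y u0).
Local Notation robust := (robust G y).

(** The number of continuations relative to its bound, with a charge of 10/11 for each discarded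
    vertex. The charge bounds the number of discarded vertices by the initial score alone. This
    breaks a circle: W is chosen after that bound, whereas the number of rounds depends on W. *)
Definition score (t k : nat) (u : V) (R : {set V}) : F :=
  (cnt k u R)%:R / gam F #|R| * (10%:R / 11%:R) ^+ t.

(** The factor 4 per level lets a gain found further down pay for the descent. With e = [eta W.+1],
    a child keeps at least 1 - 2e of the score and then gains 1 + 4e, and the product of the two is
    at least 1 + e. *)
Definition eta (W : nat) : F := 40%:R^-1 * 4%:R^-1 ^+ W.

Lemma eta_gt0 W : 0 < eta W.
Proof. by apply: mulr_gt0; [|apply: exprn_gt0]; rewrite invr_gt0 ltr0n. Qed.

Lemma etaS W : eta W = 4%:R * eta W.+1.
Proof. by rewrite /eta exprS; set x := _ ^+ W; field. Qed.

Lemma eta_le W : eta W <= 40%:R^-1.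
Proof.
rewrite /eta ler_piMr ?invr_ge0 ?ler0n // exprn_ile1 // ?invr_ge0 ?ler0n //.
by rewrite invf_le1 ?ltr0n // ler1n.
Qed.

Lemma pen_gt0 t : 0 < (10%:R / 11%:R : F) ^+ t.
Proof. by apply: exprn_gt0; apply: divr_gt0; rewrite ltr0n. Qed.

Lemma score_le1 t k u R : score t k u R <= 1.
Proof.
rewrite /score mulr_ile1 //.
- by rewrite divr_ge0 ?ler0n ?gam_ge0.
- exact: ltW (pen_gt0 t).
- by rewrite ler_pdivrMr ?gam_gt0 // mul1r; apply: size_pths_le.
by apply: exprn_ile1; lra.
Qed.

Lemma score_step t k u R x c : ~~ adj u y -> 0 < (cnt k.+1 u R)%:R :> F ->
  c * ((cnt k.+1 u R)%:R / gam F #|R|) <= (cnt k x (R :\: N u))%:R / gam F #|R :\: N u| ->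
  c * score t k.+1 u R <= score t k x (R :\: N u).
Proof. by move=> uy c0 H; rewrite /score mulrA ler_pM2r ?pen_gt0. Qed.

Lemma gain_neq3 t k u R : ~~ adj u y -> (0 < cnt k.+1 u R)%N -> #|N u :&: R| != 3%N ->
  exists2 x, x \in N u :&: R & beta F * score t k.+1 u R <= score t k x (R :\: N u).
Proof.
move=> uy c0 d3; set d := #|N u :&: R| in d3.
have d0 : (0 < d)%N.
  rewrite lt0n; apply: contraTneq c0 => e; rewrite -leqNgt cnt_step //.
  by rewrite (cards0_eq e) big_set0.
have H : ((cnt k.+1 u R)%:R / d%:R) * d%:R <= \sum_(x in N u :&: R) (cnt k x (R :\: N u))%:R :> F.
  by rewrite divfK ?pnatr_eq0 -?lt0n // -natr_sum -cnt_step.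
have [x xu Hx] := exists_ge_avg H d0.
exists x => //; apply: score_step; rewrite ?ltr0n //.
have g0 := gam_gt0 F #|R|; have g1 := gam_gt0 F #|R :\: N u|.
have := gam_step_neq3 F #|R :\: N u| d3; rewrite -(card_split G u R) => Hg.
rewrite ler_pdivlMr // mulrA mulrAC ler_pdivrMr //.
have d0' : 0 < d%:R :> F by rewrite ltr0n.
move: Hx; rewrite ler_pdivrMr //.
move: (cnt k.+1 u R)%:R (cnt k x (R :\: N u))%:R (ltr0n F (cnt k.+1 u R)) => C C1 hC.
move: c0; rewrite -hC => C0 hC1.
move: (gam F #|R|) (gam F #|R :\: N u|) g0 g1 Hg => g g' g0 g1 Hg.
have b0 : 0 < beta F by have := beta_ge1 F; lra.
move: (beta F) b0 Hg => b b0 Hg.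
apply: (@le_trans _ _ (b * (C1 * d%:R) * g')).
  by rewrite ler_pM2r // ler_pM2l.
have C10 : 0 <= C1.
  have : 0 < C1 * d%:R by apply: lt_le_trans hC1.
  by rewrite pmulr_lgt0 // => /ltW.
rewrite (_ : _ * _ * _ = C1 * (b * d%:R * g')); last by ring.
by rewrite ler_wpM2l.
Qed.

(** With three branches [gam] drops by exactly the factor 3, so the scores of the children average
    to that of the parent. If none of them exceeds it by the factor 1 + eta, none can fall below 1 -
    2 eta. *)
Lemma gain_eq3 t k u R W : ~~ adj u y -> (0 < cnt k.+1 u R)%N -> #|N u :&: R| = 3%N ->
  (exists2 x, x \in N u :&: R &
     (1 + eta W.+1) * score t k.+1 u R <= score t k x (R :\: N u)) \/
  (forall x, x \in N u :&: R ->
     (1 - 2%:R * eta W.+1) * score t k.+1 u R <= score t k x (R :\: N u) /\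
     (cnt k.+1 u R <= 4 * cnt k x (R :\: N u))%N).
Proof.
move=> uy c0 d3; have e0 := eta_gt0 W.+1; have e1 := eta_le W.+1.
case: (boolP [exists (x | x \in N u :&: R), (1 + eta W.+1) * score t k.+1 u R <= score t k x (R :\: N u)]).
  by move=> /existsP [x /andP [xu Hx]]; left; exists x.
rewrite negb_exists => /forallP Hn; right => x xu.
have Hlt z : z \in N u :&: R -> score t k z (R :\: N u) < (1 + eta W.+1) * score t k.+1 u R.
  by move=> zu; have := Hn z; rewrite zu /= -ltNge.
have gE : gam F #|R| = 3%:R * gam F #|R :\: N u|.
  by rewrite (card_split G u R) d3 add3n gam_add3.
have g1 := gam_gt0 F #|R :\: N u|; have p0 := pen_gt0 t.
have sum3 : \sum_(z in N u :&: R) score t k z (R :\: N u) = 3%:R * score t k.+1 u R.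
  rewrite /score -mulr_suml -mulr_suml -natr_sum -cnt_step // gE.
  move: (gam F _) g1 => g g1; field.
  by rewrite gt_eqF.
have low : (1 - 2%:R * eta W.+1) * score t k.+1 u R <= score t k x (R :\: N u).
  have : \sum_(z in (N u :&: R) :\ x) score t k z (R :\: N u) <= 2%:R * ((1 + eta W.+1) * score t k.+1 u R).
    apply: sum_const_le.
    - apply: mulr_ge0; first by lra.
      by rewrite /score mulr_ge0 ?divr_ge0 ?ler0n ?gam_ge0 // ltW.
    - by have := cardsD1 x (N u :&: R); rewrite d3 xu; lia.
    by move=> z; rewrite inE => /andP [_ /Hlt /ltW].
  move: sum3; rewrite (bigD1 x) //=.
  rewrite (eq_bigl (mem ((N u :&: R) :\ x))); last by move=> z; rewrite !inE andbC.
  move: (score t k.+1 u R) (score t k x _) (\sum_(_ in _) _) (eta _) e0 e1 => s s1 sg e e0 e1.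
  nra.
split=> //.
have : (1 - 2%:R * eta W.+1) * (cnt k.+1 u R)%:R <= 3%:R * (cnt k x (R :\: N u))%:R :> F.
  move: low; rewrite /score gE; move: (gam F _) g1 (_ ^+ t) p0 => g g1 p p0.
  move: (cnt k.+1 u R)%:R (cnt k x _)%:R (1 - _) => C C1 e.
  have gn : g != 0 by rewrite gt_eqF.
  rewrite (_ : e * _ = (e * C / 3%:R) * (p / g)); last by field.
  rewrite (_ : C1 / g * p = C1 * (p / g)); last by field.
  rewrite ler_pM2r ?divr_gt0 // ler_pdivrMr ?ltr0n // mulrC; lra.
move=> h; rewrite -(ler_nat F) natrM.
move: (cnt k.+1 u R)%:R (cnt k x _)%:R (ler0n F (cnt k.+1 u R)) (eta _) e0 e1 h => C C1 C0 e e0 e1 h.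
nra.
Qed.

(** Deleting w keeps 19/20 of the paths, lowers [gam] by a factor of at least 36/25 and is charged
    10/11; the product of the three numbers exceeds 6/5. *)
Lemma gain_del t k u (R : {set V}) w : w \in R ->
  (20 * count (fun p => w \in p) (pths k y u R) < cnt k u R)%N ->
  (6%:R / 5%:R) * score t k u R <= score t.+1 k u (R :\ w).
Proof.
move=> wR Hw; have := cnt_del G y k u R w; set c := count _ _ in Hw * => Hc.
have gS : 36%:R / 25%:R * gam F #|R :\ w| <= gam F #|R|.
  by rewrite (cardsD1 w R) wR add1n gamS_ge.
have g1 := gam_gt0 F #|R :\ w|; have g0 := gam_gt0 F #|R|.
have h1 : 19%:R / 20%:R * (cnt k u R)%:R <= (cnt k u (R :\ w))%:R :> F.
  have h : (19 * cnt k u R <= 20 * cnt k u (R :\ w))%N.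
    by move: Hc Hw; clear; lia.
  have : 19%:R * (cnt k u R)%:R <= 20%:R * (cnt k u (R :\ w))%:R :> F.
    by rewrite -!natrM ler_nat.
  by lra.
have p0 := pen_gt0 t; rewrite /score exprSr.
move: (_ ^+ t) p0 (gam F #|R :\ w|) g1 (gam F #|R|) g0 gS => p p0 g' g1 g g0 gS.
move: h1 (ler0n F (cnt k u R)); move: (cnt k u R)%:R (cnt k u (R :\ w))%:R => C C' h1 C0.
have gn : g' != 0 by rewrite gt_eqF.
have z0 : 0 <= C / g' by rewrite divr_ge0 // ltW.
have hC : C / g' * g' = C by rewrite divfK.
have ha : C / g <= 25%:R / 36%:R * (C / g').
  rewrite ler_pdivrMr // -{1}hC.
  rewrite (_ : 25%:R / 36%:R * (C / g') * g = C / g' * (25%:R / 36%:R * g)); last by ring.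
  by rewrite ler_wpM2l //; lra.
have hb : 19%:R / 20%:R * (C / g') <= C' / g'.
  by rewrite ler_pdivlMr // (_ : 19%:R / 20%:R * (C / g') * g' = 19%:R / 20%:R * C) //; field.
rewrite (_ : C' / g' * _ = (C' / g' * (10%:R / 11%:R)) * p); last by ring.
rewrite mulrA ler_pM2r //; move: (C / g') (C / g) (C' / g') z0 ha hb => z z1 z2; lra.
Qed.

(* A state that is not robust can be changed, within W steps, into one whose
   score is larger by a fixed factor; since the score is at most 1, this happens
   a bounded number of times. *)
Lemma gain_or_robust W s t q u k R Del : reach s t q u k R Del ->
  (4 ^ W * 2 <= cnt k u R)%N ->
  robust W k u R \/
  exists s' t' q' u' k' R' Del', [/\ reach s' t' q' u' k' R' Del', (s' <= s + W)%N &
    (1 + eta W) * score t k u R <= score t' k' u' R'].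
Proof.
elim: W s t q u k R Del => [|W IH] s t q u k R Del re Hc; first by left.
(* Two continuations exclude that u sees y, as then the empty one would be the only one. *)
have c2 : (2 <= cnt k u R)%N by apply: leq_trans Hc; rewrite leq_pmull // expn_gt0.
have e0 := eta_gt0 W.+1; have e1 := eta_le W.+1.
have s0 : 0 <= score t k u R by rewrite /score mulr_ge0 ?divr_ge0 ?ler0n ?gam_ge0 // ltW ?pen_gt0.
have uy : ~~ adj u y.
  by apply/negP => uy; move: c2; rewrite /cnt; case: (k) => [|k'] /=; rewrite uy.
case: k re Hc c2 s0 => [|k] re Hc c2 s0; first by move: c2; rewrite /cnt /= (negbTE uy).
case: (boolP [exists (w | w \in R), (20 * count (fun p => w \in p) (pths k.+1 y u R) < cnt k.+1 u R)%N]).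
  move=> /existsP [w /andP [wR Hw]]; right.
  exists s, t.+1, q, u, k.+1, (R :\ w), (w |: Del); split; first exact: ReachDel.
    exact: leq_addr.
  apply: le_trans (gain_del t wR Hw); rewrite ler_wpM2r //; lra.
rewrite negb_exists => /forallP Hw.
have Hw' w : w \in R -> (cnt k.+1 u R <= 20 * count (fun p => w \in p) (pths k.+1 y u R))%N.
  by move=> wR; have := Hw w; rewrite wR /= -leqNgt.
have [d3|d3] := eqVneq #|N u :&: R| 3%N; last first.
  right; have [x xu Hx] := gain_neq3 t uy (ltnW c2) d3.
  exists s.+1, t, (rcons q u), x, k, (R :\: N u), Del; split; first exact: ReachStep re uy xu.
    by clear; lia.
  apply: le_trans Hx; rewrite ler_wpM2r //.
  by have := betaE F; lra.
case: (@gain_eq3 t k u R W uy (ltnW c2) d3) => [[x xu Hx]|H].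
  right; exists s.+1, t, (rcons q u), x, k, (R :\: N u), Del; split => //.
    exact: ReachStep re uy xu.
  by clear; lia.
have [A|[x xu [s' [t' [q' [u' [k' [R' [Del' [re' ss Hx]]]]]]]]]] :
  (forall x, x \in N u :&: R -> robust W k x (R :\: N u)) \/
  exists2 x, x \in N u :&: R & exists s' t' q' u' k' R' Del', [/\ reach s' t' q' u' k' R' Del',
    (s' <= s.+1 + W)%N & (1 + eta W) * score t k x (R :\: N u) <= score t' k' u' R'].
  have step x : x \in N u :&: R -> robust W k x (R :\: N u) \/
     exists s' t' q' u' k' R' Del', [/\ reach s' t' q' u' k' R' Del',
    (s' <= s.+1 + W)%N & (1 + eta W) * score t k x (R :\: N u) <= score t' k' u' R'].
    move=> xu; apply: IH; first exact: ReachStep re uy xu.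
    have [_ h] := H x xu; move: Hc h; rewrite expnS; clear; nia.
  have gen (l : seq V) : {subset l <= N u :&: R} ->
     (forall x, x \in l -> robust W k x (R :\: N u)) \/
     exists2 x, x \in N u :&: R & exists s' t' q' u' k' R' Del', [/\ reach s' t' q' u' k' R' Del',
    (s' <= s.+1 + W)%N & (1 + eta W) * score t k x (R :\: N u) <= score t' k' u' R'].
    elim: l => [|x l IHl] sub; first by left.
    have xu : x \in N u :&: R by apply: sub; rewrite mem_head.
    case: (step x xu) => [rx|ex]; last by right; exists x.
    case: IHl => [z zl|al|ex]; first by apply: sub; rewrite inE zl orbT.
      by left=> z; rewrite inE => /orP [/eqP ->|/al].
    by right.
  case: (gen (enum (N u :&: R))) => [z|al|ex]; first by rewrite mem_enum.
    by left=> x xu; apply: al; rewrite mem_enum.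
  by right.
- left; exists k => //; split=> // x xu; split; last exact: A.
  by have [] := H x xu.
right; exists s', t', q', u', k', R', Del'; split=> //; first by move: ss; clear; lia.
apply: le_trans Hx; have [low _] := H x xu.
rewrite (etaS W).
move: (score t k x _) (score t k.+1 u R) (eta W.+1) e0 e1 low s0 => a b e e0 e1 low b0.
apply: (@le_trans _ _ ((1 + 4%:R * e) * ((1 - 2%:R * e) * b))); last first.
  by rewrite ler_pM2l //; lra.
rewrite mulrA ler_wpM2r //; nra.
Qed.

End Gain.

(** * Layers produced by the growing process *)

Section Layers.

Variables (V : finType) (G : sgraph V).
Local Notation adj := (adj G).
Local Notation N := (neighbours G).

(** All vertices of a layer continue with the same list, which makes consecutive layers completely
    joined; edges inside a layer are not restricted. *)
Fixpoint layered (u : V) (R : {set V}) (Xs : seq {set V}) : Prop :=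
  if Xs is X :: Xs' then
    [/\ N u :&: R = X, X != set0 & forall a, a \in X -> layered a (R :\: X) Xs']
  else True.

Fixpoint rest (R : {set V}) (Xs : seq {set V}) (i : nat) {struct i} : {set V} :=
  if i is i'.+1 then if Xs is X :: Xs' then rest (R :\: X) Xs' i' else R else R.

Lemma in_rest (R : {set V}) Xs i z : (z \in rest R Xs i) = (z \in R) && all (fun X : {set V} => z \notin X) (take i Xs).
Proof.
elim: i R Xs => [|i IH] R [|X Xs] /=; rewrite ?andbT // IH inE.
by case: (z \in R); case: (z \in X); rewrite ?andbF ?andbT.
Qed.

Lemma rest_notin (R : {set V}) Xs i l z : l < i -> l < size Xs -> z \in rest R Xs i ->
  z \notin nth set0 Xs l.
Proof.
move=> li lX; rewrite in_rest => /andP [_ /(all_nthP set0) H].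
by have := H l; rewrite nth_take // size_take_min leq_min li; apply.
Qed.

Lemma rest_out (R : {set V}) Xs i z : i <= size Xs -> z \in R -> z \notin rest R Xs i ->
  exists2 l, l < i & z \in nth set0 Xs l.
Proof.
move=> iX zR; rewrite in_rest zR /= -has_predC => /(has_nthP set0) [l].
rewrite size_take_min (minn_idPl iX) => li.
by rewrite nth_take //= negbK; exists l.
Qed.

Lemma rest_mono (R : {set V}) Xs i j z : i <= j -> z \in rest R Xs j -> z \in rest R Xs i.
Proof.
move=> ij; rewrite !in_rest => /andP [-> /allP H]; apply/allP => X Xi; apply: H.
by rewrite -(subnKC ij) takeD mem_cat Xi.
Qed.

Lemma layered_sub u R Xs i z : layered u R Xs -> z \in nth set0 Xs i -> z \in rest R Xs i.
Proof.
elim: i u R Xs => [|i IH] u R [|X Xs]; try by rewrite nth_nil inE.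
  by move=> [<- _ _] /setIP [].
move=> [_ /set0Pn [a aX] H] zX; exact: IH (H a aX) zX.
Qed.

Lemma layered_nbr u R Xs i t : layered u R Xs -> i.+1 < size Xs -> t \in nth set0 Xs i ->
  N t :&: rest R Xs i.+1 = nth set0 Xs i.+1.
Proof.
elim: i u R Xs => [|i IH] u R [|X [|X1 Xs]] //.
  by move=> [_ _ H] _ tX; have [h _ _] := H t tX.
move=> [_ /set0Pn [a aX] H] iX tX; exact: (IH a (R :\: X) (X1 :: Xs) (H a aX) iX tX).
Qed.

Lemma layered_neq0 u R Xs i : layered u R Xs -> i < size Xs -> nth set0 Xs i != set0.
Proof.
elim: i u R Xs => [|i IH] u R [|X Xs] //=; first by move=> [].
move=> [_ /set0Pn [a aX] H] iX; exact: IH (H a aX) iX.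
Qed.

Lemma layered_far u R Xs i l t z : layered u R Xs -> i < size Xs -> l.+1 < i ->
  t \in nth set0 Xs i -> z \in nth set0 Xs l -> ~~ adj t z.
Proof.
move=> lay iX li tX zX; apply/negP => tz.
have tr := layered_sub lay tX.
have tl : t \in rest R Xs l.+1 by apply: rest_mono tr; apply: ltnW.
have := layered_nbr lay (ltn_trans li iX) zX => /setP/(_ t).
by rewrite inE in_nbr adjC tz tl /= (negbTE (rest_notin li (ltn_trans li iX) tr)).
Qed.

End Layers.

Section Clean.

Variables (V : finType) (G : sgraph V).
Local Notation adj := (adj G).
Local Notation N := (neighbours G).
Local Notation hole := (hole G).
Local Notation pths := (pths G).
Local Notation ball := (ball G).
Local Notation layered := (layered G).

(** Neighbourhoods are prescribed for inner layers only; the two outer layers are where the segment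
    meets the unknown rest of the graph. *)
Definition clean_segment (X : nat -> {set V}) (m : nat) : Prop :=
  [/\ forall i, i < m -> #|X i| = 3,
      forall i j, i < j < m -> [disjoint X i & X j] &
      forall i t, 0 < i -> i.+1 < m -> t \in X i ->
        X i.-1 :|: X i.+1 \subset N t /\ N t \subset X i.-1 :|: X i :|: X i.+1].

Variables (v y u0 : V).
Hypothesis vu0 : u0 \in N v.
Hypothesis vy : y \in N v.
Hypothesis u0y : u0 != y.
Local Notation cnt := (cnt G y).
Local Notation reach := (reach G v y u0).
Local Notation robust := (robust G y).
Local Notation nchordal b := #|[set S | hole S && chordal G b S]|.

Lemma reach_prefix_notin s t q u k R Del q0 : reach s t q u k R Del ->
  q0 \in v :: q -> q0 \notin R.
Proof.
elim=> {s t q u k R Del} [|s t q u k R Del x re IH uy xu|s t q u k R Del w _ IH wR].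
- by rewrite inE => /eqP ->; rewrite !inE eqxx.
- have [uR _ _] := reach_end vu0 vy u0y re.
  rewrite inE mem_rcons inE orbCA inE negb_and.
  by case/orP => [/eqP ->|h]; rewrite ?uR ?IH ?orbT // inE.
by move/IH; rewrite inE negb_and => ->; rewrite orbT.
Qed.

Lemma mem_path_hole q u p z :
  (z \in path_hole v y q u p) = [|| z == v, z \in q, z == u, z \in p | z == y].
Proof.
rewrite inE !(in_cons, mem_cat, mem_rcons).
by case: (z == v); case: (z \in q); case: (z == u); case: (z \in p); case: (z == y).
Qed.

(* If a and b branched into different sets, a hole through a and a vertex w seen
   only by b would make b chordal. *)
Lemma robust_twins s t q u k R Del : reach s t q u k R Del -> robust 3 k u R ->
  (forall b, b \in N u :&: R -> 320 * nchordal b < cnt k u R) ->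
  forall a b, a \in N u :&: R -> b \in N u :&: R ->
  N a :&: (R :\: N u) = N b :&: (R :\: N u).
Proof.
move=> re [k1 ek [uy d3 _ Hx]] rare a b au bu; subst k.
have [ca [k2 ek [ay Ta _ Ha]]] := Hx a au; subst k1.
have [cb [k2' _ [by_ Tb _ _]]] := Hx b bu.
apply/eqP; rewrite eqEcard Tb Ta leqnn andbT; apply/subsetP => x xTa.
apply: contraT => xTb; exfalso.
have [w wTb wTa] : exists2 w, w \in N b :&: (R :\: N u) & w \notin N a :&: (R :\: N u).
  apply/subsetPn; apply/negP => sub.
  have : N b :&: (R :\: N u) == N a :&: (R :\: N u) by rewrite eqEcard sub Ta Tb.
  by move/eqP => e; rewrite e xTa in xTb.
have [cx [k3 ek [xy _ Hw _]]] := Ha x xTa.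
have re1 := ReachStep re uy au; have re2 := ReachStep re1 ay xTa.
set R1 := R :\: N u in wTa wTb xTa xTb Hw cx re1 re2.
have /setIP [bw wR1] := wTb; have /setIP [ax xR1] := xTa; rewrite in_nbr in bw; rewrite in_nbr in ax.
have /setIP [ub bR] := bu; have /setIP [ua aR] := au; rewrite in_nbr in ub; rewrite in_nbr in ua.
have naw : ~~ adj a w by move: wTa; rewrite inE wR1 andbT in_nbr.
have nbx : ~~ adj b x by move: xTb; rewrite inE xR1 andbT in_nbr.
have wR2 : w \in R1 :\: N a by rewrite inE wR1 andbT in_nbr.
have wR : w \in R by move: wR1; rewrite inE => /andP [].
have nuw : ~~ adj u w by move: wR1; rewrite inE in_nbr => /andP [].
have nux : ~~ adj u x by move: xR1; rewrite inE in_nbr => /andP [].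
have [uR yR uy'] := reach_end vu0 vy u0y re.
have ab : b != a by apply/eqP => e; move: nbx; rewrite e ax.
(* This is the source of 320 = 4 * 4 * 20: passing to a and then to x keeps a quarter of the paths
   each time, and by robustness at x a twentieth of the rest use w. In each resulting hole [b] sees
   u and w. *)
pose P := [seq p <- pths k2 y x (R1 :\: N a) | w \in p].
have szP : size P = count (fun p => w \in p) (pths k2 y x (R1 :\: N a)).
  by rewrite size_filter.
suff H : size P <= nchordal b.
  have := Hw w wR2; rewrite -szP; have := rare b bu.
  move: ca cx H; rewrite -/R1; clear; nia.
apply: (count_path_holes vu0 vy u0y re2) => [|p]; first by rewrite filter_uniq ?pths_uniq.
rewrite mem_filter => /andP [wp pp]; split=> //.
have [ip _] : ipath G y x (R1 :\: N a) p /\ size p <= k2.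
  by move: pp; rewrite mem_pths => /andP [].
have pR2 := ipath_sub ip.
have memS z : z \in path_hole v y (rcons (rcons q u) a) x p ->
    [\/ z \in v :: q, z = u, z = a | [\/ z = x, z \in p | z = y]].
  rewrite mem_path_hole !mem_rcons !in_cons !mem_rcons !in_cons -!orbA.
  case/or4P => [h|h|h|/or4P [h|h|h|h]]; move: h.
  - by move/eqP->; apply: Or41; rewrite eqxx.
  - by move/eqP->; apply: Or43.
  - by move/eqP->; apply: Or42.
  - by move=> h; apply: Or41; rewrite h orbT.
  - by move/eqP->; apply: Or44; apply: Or31.
  - by move=> h; apply: Or44; apply: Or32.
  by move/eqP->; apply: Or44; apply: Or33.
have inS : u \in path_hole v y (rcons (rcons q u) a) x p /\ w \in path_hole v y (rcons (rcons q u) a) x p.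
  by rewrite !mem_path_hole !mem_rcons !in_cons !mem_rcons !in_cons eqxx wp !orbT.
have nv z q0 : z \in R -> q0 \in v :: q -> ~~ adj q0 z.
  by move=> zR; have [_] := reach_in re zR; apply.
have p_u z : z \in p -> ~~ adj u z /\ z \in R.
  by move=> /pR2; rewrite !inE => /and3P [_ h1 h2].
apply/andP; split.
  apply/negP => /memS [h|h|h|[h|h|h]].
  - by have := reach_prefix_notin re h; rewrite bR.
  - by rewrite h adjxx in ub.
  - by rewrite h eqxx in ab.
  - by rewrite -h ub in nux.
  - by have [] := p_u _ h; rewrite ub.
  by move: yR; rewrite -h bR.
apply/exists_inP; exists u; first by case: inS.
apply/exists_inP; exists w; first by case: inS.
apply/and5P; split=> //; first by rewrite adjC.
- by apply: contraNneq uR => ->.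
apply/forall_inP => z /memS [h|->|->|[->|h|->]]; rewrite negb_and.
- by rewrite (nv w z wR h) orbT.
- by rewrite adjxx.
- by rewrite naw orbT.
- by rewrite nux.
- by have [-> _] := p_u _ h.
by rewrite uy.
Qed.


(** z sees an early vertex q0 of the path and a later one tau. No vertex of a hole completing the
    path sees both: the prefix does not see the reservoir, and neither u nor y sees tau. So z is
    chordal in all these holes. *)
Lemma prefix_chordal s s' t q ts u tau k k' R R' Del Del' z q0 :
  reach s t q u k R Del -> reach s' t (q ++ u :: ts) tau k' R' Del' ->
  {subset ts <= R} -> tau \in R -> ~~ adj u tau -> ~~ adj tau y -> R' \subset R ->
  2 <= s' -> z \notin R -> q0 \in v :: q -> adj q0 z -> adj z tau ->
  cnt k' tau R' <= nchordal z.
Proof.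
move=> re re' tsR tauR nut nty R'R s2 zR q0q q0z ztau.
have out := reach_prefix_notin re; have [tv Hin] := reach_in re tauR.
have nin w q1 : w \in R -> q1 \in v :: q -> ~~ adj q1 w.
  by move=> wR; have [_] := reach_in re wR; apply.
apply: (count_path_holes vu0 vy u0y re'); first exact: pths_uniq.
move=> p pp; split=> //; first by rewrite (leq_trans s2) ?leq_addr.
have [ip _] : ipath G y tau R' p /\ size p <= k'.
  by move: pp; rewrite mem_pths => /andP [].
have pR w : w \in p -> w \in R by move/(ipath_sub ip)/(subsetP R'R).
have memS w : (w \in path_hole v y (q ++ u :: ts) tau p) ->
   [\/ w \in v :: q, w = u, w \in R | w = y].
  rewrite mem_path_hole mem_cat in_cons -!orbA.
  case/or4P => [/eqP ->|h|/eqP ->|/or4P [h|/eqP ->|h|/eqP ->]].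
  - by apply: Or41; rewrite mem_head.
  - by apply: Or41; rewrite inE h orbT.
  - exact: Or42.
  - by apply: Or43; apply: tsR.
  - by apply: Or43.
  - by apply: Or43; apply: pR.
  exact: Or44.
have qS : q0 \in path_hole v y (q ++ u :: ts) tau p.
  rewrite mem_path_hole mem_cat; move: q0q; rewrite inE.
  by case/orP => ->; rewrite ?orbT.
apply/andP; split.
  apply/negP => /memS [h|h|h|h].
  - by have := nin tau z tauR h; rewrite ztau.
  - by rewrite -h ztau in nut.
  - by rewrite h in zR.
  by rewrite adjC -h ztau in nty.
apply/exists_inP; exists q0 => //.
apply/exists_inP; exists tau; first by rewrite mem_path_hole eqxx !orbT.
apply/and5P; split; rewrite ?ztau //.
- by rewrite adjC.
- by apply: contraNneq (out _ q0q) => ->.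
- exact: nin.
apply/forall_inP => w /memS [h|->|h|->]; rewrite negb_and.
- by rewrite (nin tau w tauR h) orbT.
- by rewrite nut orbT.
- by rewrite (nin w q0 h q0q).
by rewrite [adj y _]adjC nty orbT.
Qed.

(** By [robust_twins] all neighbours of u in the reservoir see the same part of what remains, so the
    layers found behind one of them serve for all. *)
Lemma build_layers W s t q u k R Del : reach s t q u k R Del ->
  robust W.+2 k u R ->
  (forall b, b \in ball (s + W.+2) v -> 320 * 4 ^ W * nchordal b < cnt k u R) ->
  exists Xs, [/\ size Xs = W, layered u R Xs & {in Xs, forall X : {set V}, #|X| = 3}].
Proof.
elim: W s t q u k R Del => [|W IH] s t q u k R Del re ro rare; first by exists [::].
have ro3 : robust 3 k u R by apply: robust_le ro.
have [k1 ek [uy d3 _ Hx]] := ro; subst k.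
have rare0 b : b \in N u :&: R -> 320 * nchordal b < cnt k1.+1 u R.
  move=> /setIP []; rewrite in_nbr => ub _; apply: leq_ltn_trans (rare b _).
    by rewrite -mulnA leq_pmul2l // leq_pmull // expn_gt0.
  have [ball_u _] := reach_ball vu0 re.
  apply: subsetP (ball_adj ball_u ub); apply: ball_mono; clear; lia.
have tw := robust_twins re ro3 rare0.
have [a aX] : exists a, a \in N u :&: R by apply/set0Pn; rewrite -card_gt0 d3.
have [ca roa] := Hx a aX.
have [|Xs [sX lX cX]] := IH _ _ _ _ _ _ _ (ReachStep re uy aX) roa.
  move=> b; rewrite addSnnS => /rare h.
  have : 4 * (320 * 4 ^ W * nchordal b) < 4 * cnt k1 a (R :\: N u).
    apply: leq_trans ca; apply: leq_trans h; rewrite expnS; clear; lia.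
  by rewrite ltn_pmul2l.
have eR : R :\: (N u :&: R) = R :\: N u.
  by apply/setP => z; rewrite !inE; case: (z \in R); rewrite ?andbT ?andbF.
exists ((N u :&: R) :: Xs); rewrite /= sX; split=> //.
  split=> //; first by rewrite -card_gt0 d3.
  move=> b bX; rewrite eR; case: Xs lX {sX cX} => // X1 Xs [e1 n1 H1].
  by split=> //; rewrite -e1; apply: tw.
by move=> X; rewrite inE => /orP [/eqP ->|/cX].
Qed.

Lemma reach_layer i s t q u k R Del Xs W tau : reach s t q u k R Del ->
  robust W k u R -> layered u R Xs -> i < size Xs -> i < W -> tau \in nth set0 Xs i ->
  exists ts k', [/\ {subset ts <= R},
    reach (s + i.+1) t (q ++ u :: ts) tau k' (rest R Xs i.+1) Del,
    robust (W - i.+1) k' tau (rest R Xs i.+1) &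
    cnt k u R <= 4 ^ i.+1 * cnt k' tau (rest R Xs i.+1)].
Proof.
elim: i s t q u k R Xs W => [|i IH] s t q u k R [|X Xs] [|W] //.
  move=> re [k1 ek [uy d3 _ Hx]] [eX X0 _] _ _ tX; subst k.
  have eR : R :\: X = R :\: N u.
    by rewrite -eX; apply/setP => z; rewrite !inE; case: (z \in R); rewrite ?andbT ?andbF.
  rewrite /= eR; have tX' : tau \in N u :&: R by rewrite eX.
  exists [::], k1; split=> //.
  - by rewrite addn1 cats1; apply: ReachStep re uy tX'.
  - by rewrite subSS subn0; case: (Hx _ tX').
  by rewrite expn1; case: (Hx _ tX').
move=> re [k1 ek [uy d3 _ Hx]] [eX X0 H] iX iW tX; subst k.
have eR : R :\: X = R :\: N u.
  by rewrite -eX; apply/setP => z; rewrite !inE; case: (z \in R); rewrite ?andbT ?andbF.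
have [a aX] := set0Pn _ X0; have aX' : a \in N u :&: R by rewrite eX.
have [ca roa] := Hx a aX'.
have lay := H a aX; rewrite eR in lay.
have [ts [k' [h1 h2 h3 h4]]] := IH _ _ _ _ _ _ _ _ (ReachStep re uy aX') roa lay iX iW tX.
exists (a :: ts), k'; rewrite /= eR; split=> //.
- move=> z; rewrite inE => /orP [/eqP ->|/h1]; first by case/setIP: aX'.
  by rewrite inE => /andP [].
- by move: h2; rewrite addSnnS cat_rcons.
apply: leq_trans ca _; rewrite expnS -mulnA leq_pmul2l //.
Qed.

(** Pigeonhole over [#|B|.+1] disjoint blocks of W0 consecutive layers. The shift by one keeps layer
    0, which sees u, out of every block. *)
Lemma block_avoid (Xs : seq {set V}) (B : {set V}) (W0 : nat) :
  (forall i j z, i < j < size Xs -> z \in nth set0 Xs i -> z \notin nth set0 Xs j) ->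
  #|B|.+1 * W0 < size Xs ->
  exists b, b * W0 + W0 < size Xs /\
    forall j z, j < W0 -> z \in nth set0 Xs (b * W0 + j).+1 -> z \notin B.
Proof.
move=> disj sz.
case: (boolP [exists b : 'I_#|B|.+1, all (fun j => [disjoint nth set0 Xs (b * W0 + j).+1 & B]) (iota 0 W0)]).
  move=> /existsP [b /allP H]; exists b; split.
    by apply: leq_ltn_trans sz; rewrite -mulSnr leq_mul2r ltn_ord orbT.
  move=> j z jW zX; have := H j; rewrite mem_iota => /(_ jW) d.
  by rewrite (disjointFr d zX).
rewrite negb_exists => /forallP H; exfalso.
have Hb (b : 'I_#|B|.+1) : exists z, (z \in B) && has (fun j => z \in nth set0 Xs (b * W0 + j).+1) (iota 0 W0).
  have := H b; rewrite -has_predC => /hasP [j jW] /=.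
  rewrite -setI_eq0 => /set0Pn [z /setIP [zX zB]].
  by exists z; rewrite zB /=; apply/hasP; exists j.
pose f b := xchoose (Hb b).
have fB b : f b \in B by case/andP: (xchooseP (Hb b)).
have fX b : exists2 j, j < W0 & f b \in nth set0 Xs (b * W0 + j).+1.
  by case/andP: (xchooseP (Hb b)) => _ /hasP [j]; rewrite mem_iota => jW h; exists j.
have neq (b b' : 'I_#|B|.+1) : b < b' -> f b != f b'.
  move=> bb; have [j jW hj] := fX b; have [j' jW' hj'] := fX b'.
  apply: contraTneq hj' => <-; apply: (disj (b * W0 + j).+1); last exact: hj.
  have k1 : b.+1 * W0 <= b' * W0 by rewrite leq_mul2r bb orbT.
  have k2 : b'.+1 * W0 <= #|B|.+1 * W0 by rewrite leq_mul2r ltn_ord orbT.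
  rewrite mulSn in k1; rewrite mulSn in k2; rewrite !ltnS; apply/andP; split.
    by move: k1 jW; clear; lia.
  apply: leq_ltn_trans sz; apply: leq_trans k2; rewrite addnC ltn_add2r //.
have finj : injective f.
  move=> b b' e; apply/val_inj; case: (ltngtP b b') => // bb.
    by have := neq _ _ bb; rewrite e eqxx.
  by have := neq _ _ bb; rewrite e eqxx.
have : #|f @: [set: 'I_#|B|.+1]| <= #|B|.
  by apply: subset_leq_card; apply/subsetP => z /imsetP [b _ ->].
by rewrite card_imset // cardsT card_ord ltnn.
Qed.

Lemma layered_disjoint u R Xs i j z : layered u R Xs -> i < j < size Xs ->
  z \in nth set0 Xs i -> z \notin nth set0 Xs j.
Proof.
move=> lay /andP [ij jX] zi; apply: contraTN zi => /(layered_sub lay).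
exact: rest_notin (ltn_trans ij jX).
Qed.

(** Inside the reservoir a vertex of a layer sees only its own layer and the two next to it. A
    neighbour outside would be a discarded vertex, excluded by the choice of the block; or v,
    excluded because the reservoir avoids its neighbours; or a neighbour of the earlier path,
    excluded by [prefix_chordal] and the rarity of chordal vertices. *)
Lemma clean_of_robust D W0 W s t q u k R Del : (forall z, #|N z| <= D) -> 0 < W0 ->
  (t * D).+1 * W0 < W ->
  reach s t q u k R Del -> robust W.+2 k u R ->
  (forall b, b \in ball (s + W.+3) v -> 320 * 4 ^ W.+1 * nchordal b < cnt k u R) ->
  exists X, clean_segment X W0.
Proof.
move=> HD W00 hW re ro rare.
have [|Xs [sX lX cX]] := @build_layers W s t q u k R Del re ro.
  move=> b hb; apply: leq_ltn_trans (rare b _).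
    by rewrite leq_mul2r leq_pmul2l // leq_pexp2l ?orbT.
  by apply: subsetP hb; apply: ball_mono; clear; lia.
pose B := \bigcup_(d in Del) N d.
have [dt _] := reach_card vu0 vy u0y HD re.
have cB : #|B| <= t * D.
  apply: (@leq_trans (\sum_(d in Del) #|N d|)).
    rewrite /B; elim/big_ind2: _ => [|a b c d h1 h2|j _] //; first by rewrite cards0.
    by apply: leq_trans (leq_card_setU _ _) (leq_add h1 h2).
  apply: (@leq_trans (\sum_(d in Del) D)); first by apply: leq_sum.
  by rewrite sum_nat_const leq_mul2r dt orbT.
have [||b [bW Hb]] := @block_avoid Xs B W0.
- by move=> i j z; apply: layered_disjoint lX.
- by rewrite sX; apply: leq_ltn_trans hW; rewrite leq_mul2r ltnS cB orbT.
rewrite sX in bW.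
pose X i := nth set0 Xs (b * W0 + i).+1.
exists X; split.
- move=> i iW; apply: cX; rewrite /X mem_nth // sX; move: bW iW; clear; lia.
- move=> i j /andP [ij jW]; rewrite disjoint_subset; apply/subsetP => z zi.
  rewrite inE; apply: (layered_disjoint lX _ zi); rewrite sX.
  by move: bW ij jW; clear; lia.
move=> i tau i0 iW tX.
have [l el] : exists l, l = b * W0 + i by exists (b * W0 + i).
have [l1 el1] : exists l1, l = l1.+1 by exists l.-1; rewrite prednK //; move: i0 el; clear; lia.
have lW : l.+2 < size Xs by rewrite sX; move: bW iW el; clear; lia.
have eXi : X i = nth set0 Xs l.+1 by rewrite /X -el.
have eXp : X i.-1 = nth set0 Xs l1.+1.
  by rewrite /X; congr (nth _ _ _.+1); move: el el1 i0; clear; lia.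
have eXn : X i.+1 = nth set0 Xs l.+2 by rewrite /X addnS -el.
rewrite eXi in tX; rewrite eXi eXp eXn.
have nb := layered_nbr lX lW tX.
have lW1 : l1.+2 < size Xs by rewrite -el1; apply: ltnW.
split.
  apply/subsetP => z; rewrite inE => /orP [zX|]; last by rewrite -nb => /setIP [].
  have := layered_nbr lX lW1 zX; rewrite -el1 => /setP/(_ tau).
  by rewrite tX inE in_nbr => /andP [h _]; rewrite in_nbr adjC.
have lW2 : l.+1 < size Xs by apply: ltnW.
have tR1 := layered_sub lX tX.
have tR : tau \in R by move: tR1; rewrite in_rest => /andP [].
apply/subsetP => z zt; have tz : adj tau z by rewrite -in_nbr.
have [zr|zr] := boolP (z \in rest R Xs l.+2).
  by rewrite !inE -nb inE zt zr !orbT.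
have [zR|zR] := boolP (z \in R).
  have [j jl zj] := rest_out (ltnW lW) zR zr.
  case: (ltngtP j.+1 l.+1) => [h|h|h].
  - by have := layered_far lX lW2 h tX zj; rewrite tz.
  - have -> : l.+1 = j by move: jl h; clear; lia.
    by rewrite !inE zj orbT.
  have -> : l1.+1 = j by move: h el1; clear; lia.
  by rewrite !inE zj.
exfalso; case: (reach_out re zR) => [zD|[zv|[q0 q0q q0z]]].
- have iW' : i < W0 by apply: ltnW.
  have := Hb i tau iW'; rewrite -el => /(_ tX)/negP; apply.
  by apply/bigcupP; exists z => //; rewrite in_nbr adjC.
- have [_ H] := reach_in re tR; have := H v (mem_head _ _).
  by rewrite -zv adjC tz.
have lW3 : l.+1 < W.+2 by move: lW2; rewrite sX; clear; lia.
have [ts [k' [h1 h2 h3 h4]]] := reach_layer re ro lX lW2 lW3 tX.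
have nty : ~~ adj tau y.
  have : 0 < W.+2 - l.+2 by rewrite subn_gt0; move: lW; rewrite sX; clear; lia.
  by case: (W.+2 - l.+2) h3 => // m [k2 _ []].
have nut : ~~ adj u tau.
  have : tau \in rest R Xs 1 by apply: rest_mono tR1.
  case: (Xs) lX lW => // X0 Xs' [e0 _ _] _ /= /setDP [_].
  by rewrite -e0 inE tR andbT in_nbr.
have R'R : rest R Xs l.+2 \subset R by apply/subsetP => w; rewrite in_rest => /andP [].
have s2 : 2 <= s + l.+2 by clear; lia.
have zt' : adj z tau by rewrite adjC.
have H := prefix_chordal re h2 h1 tR nut nty R'R s2 zR q0q q0z zt'.
have zb : z \in ball (s + W.+3) v.
  have [_ hq] := reach_ball vu0 re.
  by apply: subsetP (ball_adj (hq _ q0q) q0z); apply: ball_mono; clear; lia.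
have := rare z zb; apply/negP; rewrite -leqNgt; apply: leq_trans h4 _.
apply: (@leq_trans (4 ^ W.+1 * nchordal z)).
  apply: leq_mul => //; rewrite leq_pexp2l //; move: lW; rewrite sX; clear; lia.
by rewrite leq_mul2r leq_pmull ?orbT.
Qed.

End Clean.

(** * Existence of a clean segment *)

Section Core.
Local Open Scope ring_scope.
Variable F : archiRealFieldType.

Lemma bernoulli (h : F) k : 0 <= h -> 1 + k%:R * h <= (1 + h) ^+ k.
Proof.
move=> h0; elim: k => [|k IH]; first by rewrite mul0r addr0 expr0.
rewrite exprS -natr1; have k0 := ler0n F k.
apply: le_trans (ler_wpM2l _ IH); last by lra.
have : 0 <= k%:R * h * h by rewrite !mulr_ge0.
move: (k%:R) => x; nra.
Qed.

Lemma exp_above (h x : F) : 0 < h -> exists k, x < (1 + h) ^+ k.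
Proof.
move=> h0; have [k Hk] := nat_above (x / h).
exists k; apply: lt_le_trans (bernoulli k (ltW h0)).
by move: Hk; rewrite ltr_pdivrMr // => /lt_le_trans; apply; lra.
Qed.

Lemma gam_above (x : F) : exists k, forall n, (k <= n)%N -> x < gam F n.
Proof.
have h0 : 0 < 11%:R / 25%:R :> F by lra.
have [k Hk] := exp_above x h0; exists k => n kn.
apply: (lt_le_trans Hk); rewrite -(subnK kn).
apply: le_trans (gam_ge_exp F k (n - k)).
have -> : 1 + 11%:R / 25%:R = 36%:R / 25%:R :> F by field.
apply: (@le_trans _ _ (gam F k)); first by have := gam_ge_exp F 0 k; rewrite gam0 mulr1 addn0.
by apply: ler_peMl (gam_ge0 _ _) _; apply: exprn_ege1; lra.
Qed.

Lemma pen_below (c : F) : 0 < c -> exists t, (10%:R / 11%:R) ^+ t < c.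
Proof.
move=> c0; have h0 : 0 < 10%:R^-1 :> F by rewrite invr_gt0 ltr0n.
have [t Ht] := exp_above c^-1 h0; exists t.
have -> : 10%:R / 11%:R = (1 + 10%:R^-1)^-1 :> F by field.
by rewrite exprVn -ltf_pV2 ?posrE ?invr_gt0 ?exprn_gt0 ?addr_gt0 ?ltr01 // invrK.
Qed.

Section Iterate.
Variables (V : finType) (G : sgraph V) (v y u0 : V).
Local Notation N := (neighbours G).
Local Notation reach := (reach G v y u0).
Local Notation score := (@score F V G y).

Lemma iterate_gain (W J : nat) (c1 : F) : 0 <= c1 -> 1 < c1 * (1 + eta F W) ^+ J ->
  c1 <= score 0 #|V| u0 (~: (v |: N v)) ->
  (forall s t q u k R Del, reach s t q u k R Del -> (s <= J * W)%N ->
      c1 <= score t k u R -> (4 ^ W * 2 <= cnt G y k u R)%N) ->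
  exists s t q u k R Del, [/\ reach s t q u k R Del, (s <= J * W)%N,
     c1 <= score t k u R & robust G y W k u R].
Proof.
move=> c10 HJ Hroot Hbig.
have e0 := eta_gt0 F W.
have step j : (j <= J)%N ->
  (exists s t q u k R Del, [/\ reach s t q u k R Del, (s <= J * W)%N,
     c1 <= score t k u R & robust G y W k u R]) \/
  (exists s t q u k R Del, [/\ reach s t q u k R Del, (s <= j * W)%N &
     c1 * (1 + eta F W) ^+ j <= score t k u R]).
  elim: j => [|j IH] jJ.
    right; exists 0%N, 0%N, [::], u0, #|V|, (~: (v |: N v)), set0.
    by rewrite expr0 mulr1; split=> //; apply: Reach0.
  have [h|[s [t [q [u [k [R [Del [re sj Hs]]]]]]]]] := IH (ltnW jJ); first by left.
  have sJ : (s <= J * W)%N by apply: leq_trans sj _; rewrite leq_mul2r ltnW ?orbT.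
  have Hs1 : c1 <= score t k u R.
    by apply: le_trans Hs; apply: ler_peMr => //; apply: exprn_ege1; lra.
  have [ro|[s' [t' [q' [u' [k' [R' [Del' [re' ss Hs']]]]]]]]] :=
     gain_or_robust F re (Hbig _ _ _ _ _ _ _ re sJ Hs1).
    by left; exists s, t, q, u, k, R, Del.
  right; exists s', t', q', u', k', R', Del'; split=> //.
    by apply: leq_trans ss _; rewrite mulSn addnC leq_add2l.
  apply: le_trans Hs'; rewrite exprS mulrCA ler_wpM2l //; lra.
have [//|[s [t [q [u [k [R [Del [_ _ Hs]]]]]]]]] := step J (leqnn J).
have := le_trans Hs (score_le1 F G y t k u R); by rewrite leNgt HJ.
Qed.

End Iterate.

Lemma root_exists (V : finType) (G : sgraph V) (v : V) (D : nat) (c : F) :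
  (0 < D)%N -> (#|neighbours G v| <= D)%N -> 0 < c ->
  c * gam F #|V| <= #|[set S | hole G S && (v \in S)]|%:R ->
  exists u0 y, [/\ u0 \in neighbours G v, y \in neighbours G v, u0 != y &
    c / (D * D)%:R <= score F G y 0 #|V| u0 (~: (v |: neighbours G v))].
Proof.
move=> D0 HD c0 H; set X := [set S | _] in H.
pose Y := setX (neighbours G v) (neighbours G v).
pose Q (t : V * V) (S : {set V}) := (nth v (hole_from G S v) 1 == t.1) && (last v (hole_from G S v) == t.2).
have HQ S : S \in X -> exists2 t, t \in Y & Q t S.
  rewrite inE => /andP [hS vS].
  have [u [y [p [e vu vy pp sz]]]] := hole_from_path hS vS.
  exists (u, y); first by rewrite in_setX vu vy.
  by rewrite /Q e /= last_rcons !eqxx.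
have HY : (#|Y| <= D * D)%N by rewrite cardsX leq_mul.
have DD : (0 < D * D)%N by rewrite muln_gt0 D0.
have g0 := gam_gt0 F #|V|.
have [|[u0 y] tY Ht] := exists_ge_pigeon HQ HY DD H; first exact: mulr_gt0 c0 g0.
move: tY; rewrite in_setX => /andP [/= vu vy].
exists u0, y.
have pos : 0 < c * gam F #|V| / (D * D)%:R.
  by apply: divr_gt0; [exact: mulr_gt0 c0 g0|rewrite ltr0n].
have QP S : S \in [set S in X | Q (u0, y) S] -> exists2 p, p \in pths G #|V| y u0 (~: (v |: neighbours G v)) &
    S = [set:: v :: u0 :: rcons p y] /\ u0 != y.
  rewrite inE => /andP [SX]; rewrite inE in SX; case/andP: SX => hS vS.
  have [u [y' [p [e _ _ pp sz]]]] := hole_from_path hS vS.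
  have [u2 [y2 [p2 [e2 hs2 eS2 _]]]] := hole_fromP hS vS.
  have ep : v :: u :: rcons p y' = v :: u2 :: rcons p2 y2 by rewrite -e -e2.
  rewrite /Q e /= last_rcons => /andP [/eqP eu /eqP ey].
  case: ep => eu2 /rcons_inj [ep2 ey2].
  subst u2 p2 y2 u y'; exists p => //; split=> //.
  by case: hs2; rewrite !cons_uniq mem_rcons inE negb_or => /and3P [_ /andP [-> _] _].
split=> //.
  have : 0 < #|[set S in X | Q (u0, y) S]|%:R :> F by apply: lt_le_trans Ht.
  by rewrite ltr0n => /card_gt0P [S /QP [p _ []]].
have : (#|[set S in X | Q (u0, y) S]| <= cnt G y #|V| u0 (~: (v |: neighbours G v)))%N.
  rewrite /cnt -(size_map (fun p => [set:: v :: u0 :: rcons p y])).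
  apply: leq_trans (card_size _); apply: subset_leq_card; apply/subsetP => S /QP [p pp [-> _]].
  by apply/mapP; exists p.
rewrite -(ler_nat F) => h; have {}h := le_trans Ht h.
rewrite /score expr0 mulr1 ler_pdivlMr ?gam_gt0 //; apply: le_trans h.
rewrite [X in _ <= X]mulrAC; apply: ler_wpM2l; last exact: gam_nonnbr.
by apply: divr_ge0 (ltW c0) (ler0n _ _).
Qed.

(** The order of the constants matters: the lower bound c1 on scores gives t0, this gives W, and W
    gives the number J of rounds, from which the radius [rho], [eps] and [kap] follow. The root v is
    then chosen with no often chordal vertex within distance [rho]. *)
Theorem exists_clean_segment (c : F) (D W0 : nat) : 0 < c -> (3 <= D)%N -> (0 < W0)%N ->
  exists n0 : nat, forall (V : finType) (G : sgraph V), (n0 <= #|V|)%N ->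
    (forall v, (#|neighbours G v| <= D)%N) ->
    (forall v, c * gam F #|V| <= #|[set S | hole G S && (v \in S)]|%:R) ->
    exists X, clean_segment G X W0.
Proof.
move=> c0 D3 W00; have D0 : (0 < D)%N by apply: leq_trans D3.
have [c1 ec1] : exists c1, c1 = c / (D * D)%:R by eexists.
have c10 : 0 < c1 by rewrite ec1 divr_gt0 // ltr0n muln_gt0 D0.
have [t0 Ht0] := pen_below c10.
have [W eW] : exists W, W = ((t0 * D).+1 * W0).+1 by eexists.
have [J HJ] := exp_above c1^-1 (eta_gt0 F W.+2).
have HJ1 : 1 < c1 * (1 + eta F W.+2) ^+ J by rewrite -ltr_pdivrMl // mulr1.
pose smax := (J * W.+2)%N.
have [k0 ek0] : exists k0, k0 = (D.+1 * smax.+1 + t0)%N by eexists.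
have [c2 ec2] : exists c2 : F, c2 = c1 / (3%:R / 2%:R) ^+ k0 by eexists.
have p32 : 0 < (3%:R / 2%:R : F) ^+ k0 by apply: exprn_gt0; lra.
have c20 : 0 < c2 by rewrite ec2 divr_gt0.
have [M eM] : exists M, M = (320 * 4 ^ W.+1)%N by eexists.
have M0 : 0 < M%:R :> F by rewrite eM ltr0n muln_gt0 expn_gt0.
(* M * eps is half of c2, and every state reached keeps at least c2 * gam n continuations. *)
have [eps eeps] : exists eps : F, eps = c2 / M%:R / 2%:R by eexists.
have eps0 : 0 < eps by rewrite eeps !divr_gt0 // ltr0n.
pose rho := (smax + W.+3)%N.
(* Bad vertices then number at most half of |V| divided by the bound on the size of a ball, so the
   balls around them cannot cover V. *)
have [kap ekap] : exists kap : F, kap = 2%:R^-1 / (D.+1 ^ rho)%:R by eexists.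
have B0 : 0 < (D.+1 ^ rho)%:R :> F by rewrite ltr0n expn_gt0.
have kap0 : 0 < kap by rewrite ekap divr_gt0 // invr_gt0 ltr0n.
have [n1 Hn1] := few_chordal D3 eps0 kap0.
have [n2 Hn2] := gam_above ((4 ^ W.+2 * 2)%:R / c2).
exists (n1 + n2).+1 => V G nV HD Hv.
have V0 : 0 < #|V|%:R :> F by rewrite ltr0n; apply: leq_trans nV.
have few := Hn1 V G (leq_trans (leq_trans (leq_addr _ _) (leqnSn _)) nV) HD.
have gbig : (4 ^ W.+2 * 2)%:R / c2 < gam F #|V|.
  by apply: Hn2; apply: leq_trans nV; rewrite leqW // leq_addl.
set Bad := [set b | _] in few.
have [v Hball] : exists v, forall b, b \in ball G rho v -> b \notin Bad.
  pose BB := \bigcup_(b in Bad) ball G rho b.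
  have : (#|BB| < #|V|)%N.
    rewrite -(ltr_nat F); apply: (@le_lt_trans _ _ (#|Bad|%:R * (D.+1 ^ rho)%:R)).
      rewrite -natrM ler_nat; apply: (@leq_trans (\sum_(b in Bad) #|ball G rho b|)).
        rewrite /BB; elim/big_ind2: _ => [|a b d e h1 h2|j _] //; first by rewrite cards0.
        by apply: leq_trans (leq_card_setU _ _) (leq_add h1 h2).
      rewrite -sum_nat_const; apply: leq_sum => b _; exact: card_ball.
    apply: (@le_lt_trans _ _ (kap * #|V|%:R * (D.+1 ^ rho)%:R)).
      by rewrite ler_pM2r.
    rewrite ekap mulrAC divfK ?gt_eqF //.
    by rewrite gtr_pMl // invf_lt1 ?ltr0n // ltr1n.
  move=> lt; have /subsetPn [v _ vB] : ~~ ([set: V] \subset BB).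
    by apply: contraL lt => /subset_leq_card; rewrite cardsT -leqNgt.
  exists v => b bv; apply: contra vB => bB; apply/bigcupP; exists b => //.
  exact: ball_sym.
have [u0 [y [vu vy uy Hroot]]] := root_exists D0 (HD v) c0 (Hv v).
rewrite -ec1 in Hroot.
have state s t q u k R Del : reach G v y u0 s t q u k R Del -> (s <= smax)%N ->
    c1 <= score F G y t k u R -> (t <= t0)%N /\ c2 * gam F #|V| <= (cnt G y k u R)%:R.
  move=> re ss Hs.
  have g0 := gam_gt0 F #|R|.
  have C1 : (cnt G y k u R)%:R / gam F #|R| <= 1.
    by rewrite ler_pdivrMr // mul1r; apply: size_pths_le.
  have C0 : 0 <= (cnt G y k u R)%:R / gam F #|R| by rewrite divr_ge0 ?ler0n // ltW.
  have tt0 : (t <= t0)%N.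
    rewrite leqNgt; apply/negP => tt; move: Ht0; apply/negP; rewrite -leNgt.
    apply: (le_trans Hs); rewrite /score.
    apply: (@le_trans _ _ ((10%:R / 11%:R) ^+ t)).
      by apply: ler_piMl => //; apply: ltW (pen_gt0 F t).
    apply: ler_wiXn2l; [lra|lra|exact: ltnW].
  split=> //.
  have h1 : c1 <= (cnt G y k u R)%:R / gam F #|R|.
    apply: (le_trans Hs); rewrite /score; apply: ler_piMr => //.
    by apply: exprn_ile1; lra.
  have [_ HV] := reach_card vu vy uy HD re.
  have Vk : (#|V| <= k0 + #|R|)%N.
    apply: (leq_trans HV); rewrite -addnA addnC leq_add2r ek0 leq_add //.
    by rewrite leq_mul2l ltnS ss orbT.
  have h2 := le_trans (gam_homo F Vk) (gam_le_exp F #|R| k0).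
  move: h1; rewrite ler_pdivlMr // => h1; apply: le_trans h1.
  rewrite ec2 mulrAC ler_pdivrMr // -mulrA ler_pM2l // mulrC //.
have [s [t [q [u [k [R [Del [re ss Hs ro]]]]]]]] :=
  @iterate_gain V G v y u0 W.+2 J c1 (ltW c10) HJ1 Hroot (fun s t q u k R Del re ss Hs =>
    ltac:(have [_ h] := state s t q u k R Del re ss Hs;
      rewrite -(ler_nat F); apply: le_trans h; rewrite mulrC -ler_pdivrMr //; exact: ltW)).
have [tt0 Hc] := state _ _ _ _ _ _ _ re ss Hs.
apply: (clean_of_robust vu vy uy HD W00 _ re ro).
  by rewrite eW ltnS leq_mul2r ltnS leq_mul2r tt0 !orbT.
move=> b hb; rewrite -eM.
have : b \notin Bad.
  apply: Hball; apply: subsetP hb; apply: ball_mono.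
  by rewrite /rho leq_add2r.
rewrite inE -ltNge => hlt; rewrite -(ltr_nat F) natrM; apply: lt_le_trans Hc.
apply: (@lt_trans _ _ (M%:R * (eps * gam F #|V|))); first by rewrite ltr_pM2l.
rewrite mulrA ltr_pM2r ?gam_gt0 // eeps.
rewrite (_ : M%:R * _ = c2 / 2%:R); last by field; rewrite gt_eqF.
by rewrite gtr_pMr // invf_lt1 ?ltr0n // ltr1n.
Qed.

End Core.

(** * The gap in the number of paths of given parity *)

(* E9 (n + 3) is 27 times the number of odd holes of the members of the extremal
   family on n vertices; E9 m / 9 bounds the number of paths with an even number
   of inner vertices out of m available ones.  The factor 9 clears denominators. *)
Definition E9 (m : nat) : nat := 9 ^ (m %/ 6) * nth 0 [:: 9; 12; 16; 24; 36; 54] (m %% 6).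
Arguments E9 : simpl never.

Lemma E9D a m : E9 (6 * a + m) = 9 ^ a * E9 m.
Proof. by rewrite /E9 [6 * a]mulnC divnMDl // modnMDl expnD mulnA. Qed.

Lemma E9_6 m : E9 (m + 6) = 9 * E9 m.
Proof. by rewrite addnC -[in LHS](muln1 6) E9D expn1. Qed.

Lemma E9_gt0 m : 0 < E9 m.
Proof.
rewrite /E9 muln_gt0 expn_gt0 /=.
by have := ltn_pmod m (isT : 0 < 6); case: (m %% 6) => [|[|[|[|[|[|k]]]]]].
Qed.

Lemma E9_ge9 m : 9 <= E9 m.
Proof.
rewrite /E9; have : 9 <= nth 0 [:: 9; 12; 16; 24; 36; 54] (m %% 6).
  by have := ltn_pmod m (isT : 0 < 6); case: (m %% 6) => [|[|[|[|[|[|k]]]]]].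
by move=> h; apply: leq_trans h _; apply: leq_pmull; rewrite expn_gt0.
Qed.

Lemma E9_ge12 m : 0 < m -> 12 <= E9 m.
Proof.
move=> m0; rewrite /E9; have := ltn_pmod m (isT : 0 < 6); have := divn_eq m 6.
have : 0 < 9 ^ (m %/ 6) by rewrite expn_gt0.
case: (m %/ 6) => [|q] _.
  by case: (m %% 6) => [|[|[|[|[|[|s]]]]]] // e; move: m0; rewrite e.
have q0 : 0 < 9 ^ q by rewrite expn_gt0.
move=> _ _; have : 9 <= nth 0 [:: 9; 12; 16; 24; 36; 54] (m %% 6).
  by have := ltn_pmod m (isT : 0 < 6); case: (m %% 6) => [|[|[|[|[|[|k]]]]]].
rewrite expnS; move: (nth _ _ _) (9 ^ q) q0 => x z z0 h; nia.
Qed.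

Lemma lin_exp9 b s : 0 < s -> 6 * b + s <= s * 9 ^ b.
Proof.
move=> s0; elim: b => [|b IH]; first by rewrite muln1.
have b1 : 0 < 9 ^ b by rewrite expn_gt0.
rewrite expnS; nia.
Qed.

(** Write d = 6b + s with 1 <= s <= 6. Six more vertices multiply [E9] by 9 while d grows only
    linearly, so finitely many residues remain to be computed. For d = 3 there is equality. *)
Lemma E9_step i d : 3 * d * E9 i <= E9 (i + d + 3).
Proof.
case: (posnP d) => [->|d0]; first by rewrite muln0.
have [b [s [ed s0 s6]]] : exists b s, [/\ d = 6 * b + s, 0 < s & s <= 6].
  exists (d.-1 %/ 6), (d.-1 %% 6).+1; split=> //; last by rewrite ltn_mod.
  by rewrite addnS mulnC -divn_eq prednK.
rewrite {1}(divn_eq i 6) [in X in _ <= X](divn_eq i 6) ed.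
have : i %% 6 < 6 by rewrite ltn_mod.
move: (i %% 6) (i %/ 6) => r a r6.
have -> : a * 6 + r + (6 * b + s) + 3 = 6 * a + (6 * b + (r + s + 3)) by lia.
rewrite [a * 6]mulnC !E9D mulnCA leq_mul2l; apply/orP; right.
have base : 3 * s * E9 r <= E9 (r + s + 3).
  by case: r r6 => [|[|[|[|[|[|]]]]]] // _; case: s s0 s6 {ed} => [|[|[|[|[|[|[|]]]]]]].
have := lin_exp9 b s0; move: base; move: (E9 r) (E9 (r + s + 3)) (9 ^ b) => x z t h1 h2.
apply: (@leq_trans (3 * (s * t) * x)); first by rewrite leq_mul2r leq_mul2l h2 !orbT.
by rewrite mulnA mulnAC [X in X <= _]mulnC leq_mul2l h1 orbT.
Qed.

Lemma E9_step_strict i d : (d < 2) || (4 < d) -> 16 * d * E9 i <= 5 * E9 (i + d + 3).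
Proof.
case: (posnP d) => [->|d0 hd]; first by rewrite muln0.
(* Representatives modulo 6 of the admissible d, with 8, 9 and 10 standing in for the excluded 2, 3
   and 4. *)
have [b [s [ed hs]]] : exists b s, d = 6 * b + s /\ s \in [:: 1; 5; 6; 8; 9; 10].
  have e := divn_eq d 6; have r6 : d %% 6 < 6 by rewrite ltn_mod.
  move: (d %/ 6) (d %% 6) e r6 => q [|[|[|[|[|[|//]]]]]] e _.
  - by exists q.-1, 6; split=> //; move: e d0; clear; lia.
  - by exists q, 1; split=> //; move: e; clear; lia.
  - by exists q.-1, 8; split=> //; move: e hd; clear; lia.
  - by exists q.-1, 9; split=> //; move: e hd; clear; lia.
  - by exists q.-1, 10; split=> //; move: e hd; clear; lia.
  by exists q, 5; split=> //; move: e; clear; lia.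
rewrite {1}(divn_eq i 6) [in X in _ <= X](divn_eq i 6) ed.
have : i %% 6 < 6 by rewrite ltn_mod.
move: (i %% 6) (i %/ 6) => r a r6.
have -> : a * 6 + r + (6 * b + s) + 3 = 6 * a + (6 * b + (r + s + 3)) by lia.
rewrite [a * 6]mulnC !E9D mulnCA [5 * _]mulnCA leq_mul2l; apply/orP; right.
have s0 : 0 < s by case: s hs {ed}.
have base : 16 * s * E9 r <= 5 * E9 (r + s + 3).
  move: hs; rewrite !inE; case: r r6 => [|[|[|[|[|[|]]]]]] // _;
  by case/or4P => [/eqP ->|/eqP ->|/eqP ->|/or3P [] /eqP ->]; by vm_compute.
have := lin_exp9 b s0; move: base; move: (E9 r) (E9 (r + s + 3)) (9 ^ b) => x z t h1 h2.
apply: (@leq_trans (16 * (s * t) * x)); first by rewrite leq_mul2r leq_mul2l h2 !orbT.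
by rewrite mulnA mulnAC [5 * (_ * _)]mulnCA [X in X <= _]mulnC leq_mul2l h1 orbT.
Qed.

(* Bounds 27 times the number of paths whose number of inner vertices has the
   given parity. *)
Definition parity_bound (par : bool) (m : nat) : nat :=
  if par then E9 (m + 3) else 3 * E9 m.

Lemma parity_bound_step par d m :
  d * parity_bound (~~ par) m <= parity_bound par (d + m).
Proof.
case: par; rewrite /parity_bound /=.
  by rewrite mulnCA mulnA [d + m]addnC E9_step.
have := E9_step (m + 3) d; rewrite (_ : m + 3 + d + 3 = d + m + 6); last by lia.
rewrite E9_6; lia.
Qed.

Lemma parity_bound_strict par d m : (d < 2) || (4 < d) ->
  16 * (d * parity_bound (~~ par) m) <= 15 * parity_bound par (d + m).
Proof.
move=> hd; case: par; rewrite /parity_bound /=.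
  have := E9_step_strict m hd; rewrite [m + d]addnC; lia.
have := E9_step_strict (m + 3) hd; rewrite (_ : m + 3 + d + 3 = d + m + 6); last by lia.
rewrite E9_6; lia.
Qed.

Lemma in_tail (T : eqType) (P : T -> Prop) x s : {in x :: s, forall z, P z} -> {in s, forall z, P z}.
Proof. by move=> H z zs; apply: H; rewrite inE zs orbT. Qed.

(** * Chains of layers and the paths through them *)

Section Chains.

Variables (V : finType) (G : sgraph V) (y : V).
Local Notation adj := (adj G).
Local Notation N := (neighbours G).
Local Notation pths := (pths G).

Definition par_cnt par k u (R : {set V}) : nat :=
  \sum_(p <- pths k y u R) (odd (size p) == par).

Lemma par_cntS par k u R : par_cnt par k.+1 u R =
  if adj u y then (~~ par : nat) else \sum_(x in N u :&: R) par_cnt (~~ par) k x (R :\: N u).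
Proof.
rewrite /par_cnt (sum_pthsS G k y u R (fun p => (odd (size p) == par : nat))) /=.
case: ifP => _; first by case: par.
by apply: eq_bigr => x _; apply: eq_bigr => p _ /=; case: par; case: (odd _).
Qed.

Lemma par_cnt_le par k u R : par_cnt par k u R <= size (pths k y u R).
Proof. by rewrite /par_cnt -sum1_size; apply: leq_sum => p _; case: (_ == _). Qed.

Lemma par_cnt_bound par k u R : 27 * par_cnt par k u R <= parity_bound par #|R|.
Proof.
elim: k par u R => [|k IH] par u R.
  rewrite /par_cnt /=; case: ifP => _; last by rewrite big_nil muln0.
  rewrite big_seq1 /=; case: par => //=; rewrite /parity_bound.
  by rewrite (@leq_mul2l 3 9) E9_ge9.
rewrite par_cntS; case: ifP => _.
  by case: par => //=; rewrite /parity_bound (@leq_mul2l 3 9) E9_ge9.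
rewrite big_distrr /= (card_split G u R).
apply: leq_trans (parity_bound_step par _ _).
by rewrite -sum_nat_const; apply: leq_sum => x _; apply: IH.
Qed.

(* A chain exhausts R and only its last layer sees y, whereas layered imposes
   nothing beyond the listed layers. *)
Fixpoint chain (u : V) (R : {set V}) (Xs : seq {set V}) : Prop :=
  if Xs is X :: Xs' then
    [/\ ~~ adj u y, N u :&: R = X, X != set0 & forall a, a \in X -> chain a (R :\: X) Xs']
  else R = set0 /\ adj u y.

Lemma chain_layered u R Xs : chain u R Xs -> layered G u R Xs.
Proof.
elim: Xs u R => [|X Xs IH] u R //= [_ h1 h2 h3]; split=> // a aX; exact/IH/h3.
Qed.

Lemma chain_cover u R Xs z : chain u R Xs -> z \in R ->
  exists2 i, i < size Xs & z \in nth set0 Xs i.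
Proof.
elim: Xs u R => [|X Xs IH] u R /=; first by move=> [-> _]; rewrite inE.
move=> [_ _ /set0Pn [a aX] H] zR; case zX: (z \in X); first by exists 0.
by have [|i iX zi] := IH _ _ (H a aX); rewrite ?inE ?zX //; exists i.+1.
Qed.

Lemma chain_end u R Xs i t : chain u R Xs -> i < size Xs -> t \in nth set0 Xs i ->
  adj t y = (i.+1 == size Xs).
Proof.
elim: Xs u R i => [|X Xs IH] u R [|i] //= [_ _ X0 H] iX tX.
  by have := H t tX; case: Xs {IH H iX} => [|Y Xs] /= [] // h1 h2 *; rewrite ?h2 ?(negbTE h1).
have [a aX] := set0Pn _ X0; by rewrite eqSS (IH _ _ _ (H a aX) iX tX).
Qed.

Lemma chain_far u R Xs i l t z : chain u R Xs -> i < size Xs -> l.+1 < i ->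
  t \in nth set0 Xs i -> z \in nth set0 Xs l -> ~~ adj z t.
Proof. by move/chain_layered=> lay iX li tX zX; rewrite adjC (layered_far lay iX li tX zX). Qed.

Lemma chain_sub u R Xs i t : chain u R Xs -> t \in nth set0 Xs i -> t \in R.
Proof.
move/chain_layered => lay /(layered_sub lay); rewrite in_rest => /andP [] //.
Qed.

Lemma chain_next u R Xs i t z : chain u R Xs -> i.+1 < size Xs -> t \in nth set0 Xs i ->
  z \in nth set0 Xs i.+1 -> adj t z.
Proof.
move/chain_layered => lay iX tX; rewrite -(layered_nbr lay iX tX).
by case/setIP; rewrite in_nbr.
Qed.

(** Only the last layer sees y, and an edge leads at most one layer ahead; with layer i + 1 deleted,
    a path in the earlier layers never gets past it. *)
Lemma chain_stuck u R Xs i l z (R0 : {set V}) p : chain u R Xs -> l <= i -> i.+1 < size Xs ->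
  z \in nth set0 Xs l -> R0 \subset R -> [disjoint R0 & nth set0 Xs i.+1] ->
  ~~ ipath G y z R0 p.
Proof.
move=> ch; elim: p l z R0 => [|x p IH] l z R0 li iX zl R0R dis; apply/negP => /=.
  by rewrite (chain_end ch _ zl) //; [move=> /eqP; move: li iX; clear; lia|apply: leq_ltn_trans li (ltnW iX)].
case/and3P => _ /setIP []; rewrite in_nbr => zx xR0; apply/negP.
have [j jX xj] := chain_cover ch (subsetP R0R x xR0).
have ji : j <= i.
  rewrite leqNgt; apply/negP => ij; case: (ltngtP j i.+1) => h.
  - by move: ij h; clear; lia.
  - by have := chain_far ch jX (leq_ltn_trans (li : l.+1 <= i.+1) h) xj zl; rewrite zx.
  by have := disjointFr dis xR0; rewrite -h xj.
apply: (IH j) => //; first by apply: subset_trans (subsetDl _ _) R0R.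
by apply: disjointWl dis; apply: subsetDl.
Qed.

(* A path through layer i that does not proceed to layer i + 1 is stuck: by
   leaving x it has deleted that layer. *)
Lemma chain_walk k u R Xs i x (R0 : {set V}) : chain u R Xs -> i < size Xs ->
  x \in nth set0 Xs i -> R0 \subset R ->
  size (pths k y x R0) <= \prod_(X <- drop i.+1 Xs) #|X :&: R0|.
Proof.
move=> ch; elim: k i x R0 => [|k IH] i x R0 iX xi R0R.
  rewrite /= (chain_end ch iX xi); case: eqP => //= e.
  by rewrite e drop_size big_nil.
case xy: (adj x y).
  rewrite /= xy; move: xy; rewrite (chain_end ch iX xi) => /eqP ->.
  by rewrite drop_size big_nil.
have iX1 : i.+1 < size Xs.
  by rewrite ltn_neqAle iX andbT -(chain_end ch iX xi) xy.
have := cnt_step k R0 (negbT xy); rewrite /cnt => ->.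
rewrite (drop_nth set0 iX1) big_cons.
set Q := \prod_(_ <- _) _; set Y := nth set0 Xs i.+1.
apply: (@leq_trans (\sum_(z in N x :&: R0) (if z \in Y then Q else 0))).
  apply: leq_sum => z /setIP []; rewrite in_nbr => xz zR0.
  case: ifP => zY.
    apply: leq_trans (IH _ _ _ iX1 zY (subset_trans (subsetDl _ _) R0R)) _.
    by apply: leq_prod => X _; apply: subset_leq_card; apply: setIS; apply: subsetDl.
  rewrite leqn0 size_eq0; apply/eqP; apply/nilP/nilP.
  case E : (pths _ _ _ _) => [//|p s]; exfalso.
  have : p \in pths k y z (R0 :\: N x) by rewrite E mem_head.
  rewrite mem_pths => /andP [ip _]; move: ip; apply/negP.
  have [j jX zj] := chain_cover ch (subsetP R0R z zR0).
  have ji : j <= i.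
    rewrite leqNgt; apply/negP => ij; case: (ltngtP j i.+1) => h.
    - by move: ij h; clear; lia.
    - by have := chain_far ch jX h zj xi; rewrite xz.
    by move: zY; rewrite /Y -h zj.
  apply: (chain_stuck p ch ji iX1 zj); first exact: subset_trans (subsetDl _ _) R0R.
  rewrite disjoint_subset; apply/subsetP => w; rewrite !inE => /andP [h _].
  by apply: contra h => wY; rewrite (chain_next ch iX1 xi wY).
rewrite -big_mkcondr /= sum_nat_const leq_mul2r; apply/orP; right.
by apply: subset_leq_card; apply/subsetP => z /andP [/setIP [_ zR]] zY; rewrite inE zY zR.
Qed.

(** A bound for the paths from a vertex whose neighbours in R form S: the first step enters some
    layer at a vertex of S, and from there the path has to advance through the later layers,
    deprived of S. *)
Fixpoint walk_bound (S : {set V}) (Xs : seq {set V}) : nat :=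
  if Xs is X :: Xs' then #|X :&: S| * \prod_(Y <- Xs') #|Y :\: S| + walk_bound S Xs' else 0.

Lemma sum_walk_bound (S T : {set V}) Xs (f : V -> nat) : T \subset S ->
  (forall z, z \in T -> exists2 i, i < size Xs & z \in nth set0 Xs i) ->
  (forall i z, i < size Xs -> z \in nth set0 Xs i -> f z <= \prod_(Y <- drop i.+1 Xs) #|Y :\: S|) ->
  \sum_(z in T) f z <= walk_bound S Xs.
Proof.
elim: Xs T => [|X Xs IH] T TS cov Hf.
  by rewrite big1 // => z /cov [].
rewrite (bigID (mem X)) /= leq_add //.
  apply: (@leq_trans (\sum_(z in X :&: S) \prod_(Y <- Xs) #|Y :\: S|)); last first.
    by rewrite sum_nat_const.
  rewrite big_mkcond [X in _ <= X]big_mkcond /=; apply: leq_sum => z _.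
  rewrite inE; case: ifP => // /andP [zT zX]; rewrite zX (subsetP TS z zT) /=.
  by have := Hf 0 z isT zX; rewrite /= drop0.
rewrite (eq_bigl (mem (T :\: X))); last by move=> z; rewrite /= !inE andbC.
apply: IH.
- exact: subset_trans (subsetDl _ _) TS.
- move=> z; rewrite inE => /andP [zX /cov [[|i] iX zi]]; last by exists i.
  by move: zi zX => /= ->.
by move=> i z iX zi; apply: (Hf i.+1 z).
Qed.

(** Transversals of the layers are classified by the last layer in which they meet S. As the layers
    are nonempty, each class has at least as many members as the corresponding summand; the second
    product counts those avoiding S. *)
Lemma walk_bound_le (S : {set V}) Xs : {in Xs, forall X : {set V}, 0 < #|X|} ->
  walk_bound S Xs + \prod_(X <- Xs) #|X :\: S| <= \prod_(X <- Xs) #|X|.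
Proof.
elim: Xs => [|X Xs IH] HX; first by rewrite !big_nil.
rewrite /= !big_cons -(cardsID S X).
have {IH} := IH (in_tail HX).
have : 0 < #|X :&: S| + #|X :\: S| by rewrite cardsID HX ?mem_head.
move: #|_| #|_| (\prod_(_ <- _) _) (walk_bound _ _) (\prod_(_ <- _) _) => a b q w p; nia.
Qed.

Lemma prod_del_le (S : {set V}) Xs : \prod_(X <- Xs) #|X :\: S| <= \prod_(X <- Xs) #|X|.
Proof. by apply: leq_prod => X _; apply: subset_leq_card; apply: subsetDl. Qed.

Lemma prod_del_le34 (S : {set V}) Xs : {in Xs, forall X : {set V}, #|X| <= 4} ->
  has (fun X => X :&: S != set0) Xs ->
  4 * \prod_(X <- Xs) #|X :\: S| <= 3 * \prod_(X <- Xs) #|X|.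
Proof.
elim: Xs => [|X Xs IH] //= HX /orP [h|h]; rewrite !big_cons.
  have := prod_del_le S Xs; have : 0 < #|X :&: S| by rewrite card_gt0.
  have := HX X (mem_head _ _); rewrite -(cardsID S X).
  move: #|_| #|_| (\prod_(_ <- _) _) (\prod_(_ <- _) _) => a b q p; nia.
have := IH (in_tail HX) h.
have : #|X :\: S| <= #|X| by apply: subset_leq_card; apply: subsetDl.
move: #|_| #|_| (\prod_(_ <- _) _) (\prod_(_ <- _) _) => a b q p; nia.
Qed.

(** The constant is attained when X has size 2 and lies in S, and S meets a single later layer, of
    size 4, in one vertex: then (2 * 3 + 1) / (2 * 4) = 7/8. *)
Lemma walk_bound_gap (S X : {set V}) Xs :
  {in X :: Xs, forall X : {set V}, 2 <= #|X| <= 4} ->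
  (exists2 z, z \in X & z \notin S) \/ has (fun X => X :&: S != set0) Xs ->
  8 * walk_bound S (X :: Xs) <= 7 * \prod_(Y <- X :: Xs) #|Y|.
Proof.
move=> HX hS; rewrite /= big_cons -(cardsID S X).
have HXs Y : Y \in Xs -> 2 <= #|Y| <= 4 by move=> h; apply: HX; rewrite inE h orbT.
have w1 : walk_bound S Xs + \prod_(X <- Xs) #|X :\: S| <= \prod_(X <- Xs) #|X|.
  by apply: walk_bound_le => Y /HXs /andP [h _]; apply: ltnW.
have q1 := prod_del_le S Xs.
have := HX X (mem_head _ _); rewrite -(cardsID S X).
have hS' : 0 < #|X :\: S| \/ 4 * \prod_(X <- Xs) #|X :\: S| <= 3 * \prod_(X <- Xs) #|X|.
  case: hS => [[z zX zS]|h].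
    by left; apply/card_gt0P; exists z; rewrite inE zX zS.
  by right; apply: prod_del_le34 => // Y /HXs /andP [].
move: hS' w1 q1.
move: #|X :&: S| #|X :\: S| (\prod_(_ <- _) _) (walk_bound _ _) (\prod_(_ <- _) _) => a b q w p.
case: a => [|a]; first by move=> *; nia.
move=> [h|h] w1 q1 /andP [h1 h2]; nia.
Qed.

Lemma chain_dichotomy a b R Xs k : chain a R Xs ->
  {in Xs, forall X : {set V}, 2 <= #|X| <= 4} ->
  size (pths k y b R) <= \prod_(X <- Xs) #|X| /\
  (chain b R Xs \/ 8 * size (pths k y b R) <= 7 * \prod_(X <- Xs) #|X|).
Proof.
move=> ch sz.
have P1 : {in Xs, forall X : {set V}, 0 < #|X|} by move=> X /sz /andP [h _]; apply: ltnW.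
have pos : 0 < \prod_(X <- Xs) #|X|.
  by rewrite big_seq prodn_cond_gt0.
case: Xs ch sz P1 pos => [|X Xs] ch sz P1 pos.
  case: ch => eR _; rewrite big_nil; case by_: (adj b y).
    have -> : pths k y b R = [:: [::]] by case: k => [|k]; rewrite /= by_.
    by split=> //; left.
  have -> : pths k y b R = [::].
    by case: k => [|k]; rewrite /= by_ // eR setI0 enum_set0.
  by split=> //; right.
have PX : 1 < \prod_(X <- X :: Xs) #|X|.
  rewrite big_cons; have /andP [h _] := sz X (mem_head _ _).
  rewrite big_cons muln_gt0 in pos; case/andP: pos => _ h2.
  by apply: leq_trans h _; rewrite leq_pmulr.
case by_: (adj b y).
  have -> : pths k y b R = [:: [::]] by case: k => [|k]; rewrite /= by_.
  by split; [apply: ltnW|right; move: PX; clear; move: (\prod_(_ <- _) _) => z /=; lia].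
have T : size (pths k y b R) <= walk_bound (N b :&: R) (X :: Xs).
  case: k => [|k]; first by rewrite /= by_.
  have := cnt_step k R (negbT by_); rewrite /cnt => ->.
  apply: sum_walk_bound => // [z /setIP [_ zR]|i z iX zi]; first exact: chain_cover ch zR.
  apply: leq_trans (chain_walk k ch iX zi (subsetDl _ _)) _.
  apply: leq_prod => Y _; apply: subset_leq_card; apply/subsetP => w.
  by rewrite !inE => /and3P [h1 h2 h3]; rewrite h1 (negbTE h2).
have T2 := walk_bound_le (N b :&: R) P1.
split; first by apply: leq_trans T (leq_trans (leq_addr _ _) T2).
case: (eqVneq (N b :&: R) X) => [e|ne].
  by left; case: ch => [_ _ X0 H]; split=> //; rewrite by_.
right; apply: leq_trans (_ : 8 * walk_bound (N b :&: R) (X :: Xs) <= _); first by rewrite leq_mul2l.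
apply: walk_bound_gap => //.
case: (boolP (X \subset N b :&: R)) => sub; last by left; apply/subsetPn.
right; have /subsetPn [z zb zX] : ~~ (N b :&: R \subset X).
  by apply: contra ne => h; rewrite eqEsubset h sub.
have [[|i] iX zi] := chain_cover ch (subsetP (subsetIr _ _) z zb).
  by move: zi zX => /= ->.
apply/(has_nthP set0); exists i => //; apply/set0Pn; exists z; by rewrite inE zi zb.
Qed.

Lemma chain_prod u R Xs : chain u R Xs -> 27 * \prod_(X <- Xs) #|X| <= parity_bound (odd (size Xs)) #|R|.
Proof.
elim: Xs u R => [|X Xs IH] u R /=.
  by move=> [-> _]; rewrite big_nil cards0.
move=> [_ eX /set0Pn [a aX] H]; rewrite big_cons mulnCA.
have eR : R :\: X = R :\: N u.
  by rewrite -eX; apply/setP => z; rewrite !inE; case: (z \in R); rewrite ?andbT ?andbF.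
rewrite (card_split G u R) eX -eR.
apply: leq_trans (parity_bound_step _ _ _); rewrite negbK leq_mul2l.
by rewrite (IH _ _ (H a aX)) orbT.
Qed.

(** Averaging over the d neighbours of u in R yields one, a, that again exceeds 31/32 of its bound,
    and induction gives the chain behind it. A d outside 2..4 would lose a sixteenth. A sibling of a
    that does not fit the chain loses an eighth of a share that is at least a quarter of the whole,
    and 1/8 * 1/4 = 1/32. *)
Theorem chain_of_many_paths par k u (R : {set V}) : #|R| <= k ->
  31 * parity_bound par #|R| < 32 * (27 * par_cnt par k u R) ->
  exists Xs, [/\ chain u R Xs, odd (size Xs) = par & {in Xs, forall X : {set V}, 2 <= #|X| <= 4}].
Proof.
elim: k par u R => [|k IH] par u R Rk H.
  have eR : R = set0 by apply/eqP; rewrite -cards_eq0 -leqn0.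
  move: H; rewrite /par_cnt /=; case: ifP => uy; last by rewrite big_nil muln0.
  rewrite big_seq1 /=; case: par => //= _; by exists [::].
move: H; rewrite par_cntS; case: ifP => uy H.
  have p0 : par = false by case: par H; rewrite // muln0.
  subst par; exists [::]; split=> //=; split=> //.
  apply/eqP; rewrite -cards_eq0 -leqn0 leqNgt; apply/negP => R0.
  move: H; rewrite /parity_bound /=; apply/negP; rewrite -leqNgt.
  have : 12 <= E9 #|R|; last by move: (E9 _) => x; clear; lia.
  exact: E9_ge12.
set d := #|N u :&: R|; set R1 := R :\: N u in H.
have cR : #|R| = d + #|R1| by apply: card_split.
have Hs := parity_bound_step par d #|R1|; rewrite -cR in Hs.
have [a aX Ha] : exists2 a, a \in N u :&: R &
    31 * parity_bound (~~ par) #|R1| < 32 * (27 * par_cnt (~~ par) k a R1).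
  apply/exists_inP; apply: contraT; rewrite negb_exists_in => /forall_inP Hn.
  exfalso; move: H; apply/negP; rewrite -leqNgt.
  apply: leq_trans (_ : 31 * (d * parity_bound (~~ par) #|R1|) <= _); last by rewrite leq_mul2l Hs orbT.
  rewrite !big_distrr /= mulnCA -sum_nat_const; apply: leq_sum => x xX.
  by rewrite leqNgt; apply: Hn.
have d0 : 0 < d by apply/card_gt0P; exists a.
have R1k : #|R1| <= k by move: Rk; rewrite cR; move: d0; clear; lia.
have [Xs [ch oXs sz]] := IH _ _ _ R1k Ha.
have S1 : 27 * \sum_(x in N u :&: R) par_cnt (~~ par) k x R1 <= d * parity_bound (~~ par) #|R1|.
  by rewrite big_distrr -sum_nat_const; apply: leq_sum => x _; apply: par_cnt_bound.
have hd : 2 <= d <= 4.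
  apply: contraT => hd; exfalso.
  have hd' : (d < 2) || (4 < d) by move: hd; clear; lia.
  have := parity_bound_strict par #|R1| hd'; rewrite -cR => h.
  by move: H S1 h; clear; move: (parity_bound _ _) (parity_bound _ _) (\sum_(_ in _) _) => x z t; lia.
have eR : R :\: (N u :&: R) = R1.
  by rewrite /R1; apply/setP => z; rewrite !inE; case: (z \in R); rewrite ?andbT ?andbF.
exists ((N u :&: R) :: Xs); split.
- split; rewrite ?uy //; first by rewrite -card_gt0.
  rewrite eR => b bX; have [_ [//|hb]] := chain_dichotomy b k ch sz; exfalso.
  have Pb := chain_prod ch; rewrite oXs in Pb.
  have S2 : 8 * \sum_(x in N u :&: R) par_cnt (~~ par) k x R1 + \prod_(X <- Xs) #|X| <=
      8 * d * \prod_(X <- Xs) #|X|.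
    rewrite (bigD1 b) //= /d (cardsD1 b) bX.
    have : \sum_(i in N u :&: R | i != b) par_cnt (~~ par) k i R1 <= #|(N u :&: R) :\ b| * \prod_(X <- Xs) #|X|.
      rewrite -sum_nat_const (eq_bigl (mem ((N u :&: R) :\ b))); last by move=> i; rewrite /= !inE andbC.
      apply: leq_sum => i _; apply: leq_trans (par_cnt_le _ _ _ _) _.
      by have [] := chain_dichotomy i k ch sz.
    have := par_cnt_le (~~ par) k b R1; move: hb.
    move: (\sum_(_ in _ | _) _) (par_cnt _ _ _ _) (size _) (\prod_(_ <- _) _) #|_| => s c z p e; clear; nia.
  move: H S2 Pb Hs hd; clear.
  move: (parity_bound _ _) (parity_bound _ _) (\sum_(_ in _) _) (\prod_(_ <- _) _) d => x z s p d.
  nia.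
- by rewrite /= oXs negbK.
by move=> X; rewrite inE => /orP [/eqP ->|/sz].
Qed.

End Chains.

(** * Cyclic braids *)

Section Crossing.

Variables (V : finType) (G : sgraph V).
Local Notation adj := (adj G).
Local Notation N := (neighbours G).
Local Notation hole := (hole G).
Variables (P A B C Q : {set V}).
Hypothesis B4 : #|B| <= 4.
Hypothesis HB : forall b, b \in B -> A :|: C \subset N b /\ N b \subset A :|: B :|: C.
Hypothesis HA : forall a, a \in A -> P :|: B \subset N a /\ N a \subset P :|: A :|: B.
Hypothesis HC : forall c, c \in C -> B :|: Q \subset N c /\ N c \subset B :|: C :|: Q.

Let adjBA b z : b \in B -> z \in A -> adj b z.
Proof. by move=> /HB [/subsetP h _] zA; rewrite -in_nbr h // inE zA. Qed.
Let adjBC b z : b \in B -> z \in C -> adj b z.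
Proof. by move=> /HB [/subsetP h _] zC; rewrite -in_nbr h // inE zC orbT. Qed.

(** If a neighbour of t on the hole were in B, so would be the other one and the next two vertices,
    since B sees all of A and C; that makes five vertices in B. If both neighbours were in A, the
    vertex following one of them would lie in P or B, and the other one sees all of these; likewise
    for C. *)
Lemma hole_cross_raw S t : hole S -> t \in S -> t \in B ->
  exists u y p, [/\ (u \in A) && (y \in C) || (u \in C) && (y \in A),
    induced_path G (u :: rcons p y), S = [set:: t :: u :: rcons p y], #|S| = (size p).+3 &
    {in p, forall z, [&& t != z, z \notin A, z \notin B & z \notin C]}].
Proof.
move=> hS tS tB.
have [u [y [p [hs eS sz p1]]]] := hole_rooted hS tS.
have p0 : p != [::] by case: p p1 {hs eS sz}.
have [ip tn tu ty tp] := hole_seq_path hs p0.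
have tz z : z \in p -> (z \notin A) && (z \notin C).
  move=> /tp h; apply/andP; split; apply: contra h => zz; [exact: adjBA|exact: adjBC].
exists u, y, p.
have [_ /subsetP NB] := HB tB.
have uABC : u \in A :|: B :|: C by apply: NB; rewrite in_nbr.
have yABC : y \in A :|: B :|: C by apply: NB; rewrite in_nbr.
case: p p0 p1 ip tn tp tz eS sz {hs} => [|x [|x2 p]] // _ _ ip tn tp tz eS sz.
have /andP [xA xC] := tz x (mem_head _ _).
have /andP [x2A x2C] : (x2 \notin A) && (x2 \notin C) by apply: tz; rewrite !inE eqxx orbT.
have Uq : uniq (u :: rcons [:: x, x2 & p] y) by exact: induced_path_uniq ip.
have := ip; rewrite !rcons_cons => /and3P [/andP [ux ualll] _ /and3P [/andP [xx2 xall] _ _]].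
have ny : y \in rcons p y by rewrite mem_rcons mem_head.
have nuy : ~~ adj u y by apply: (allP ualll); rewrite inE ny orbT.
have nxy : ~~ adj x y by apply: (allP xall).
have side : (u \in A) && (y \in C) || (u \in C) && (y \in A).
  case uB: (u \in B).
    have yB : y \in B.
      move: yABC; rewrite !inE -orbA => /or3P [h|//|h]; move: nuy; first by rewrite adjBA.
      by rewrite adjBC.
    have inB w z : w \in B -> adj w z -> z \notin A -> z \notin C -> z \in B.
      move=> /HB [_ /subsetP h] wz zA zC; have := h z; rewrite in_nbr => /(_ wz).
      by rewrite !inE (negbTE zA) (negbTE zC) orbF.
    have xB := inB _ _ uB ux xA xC; have x2B := inB _ _ xB xx2 x2A x2C.
    have : #|[set:: [:: t; u; x; x2; y]]| <= #|B|.
      apply: subset_leq_card; apply/subsetP => z; rewrite !inE.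
      by case/or4P => [| | |/orP []] /eqP ->.
    rewrite cardsE (card_uniqP _); first by rewrite leqNgt ltnS B4.
    have U2 : uniq (t :: u :: rcons [:: x, x2 & p] y) by rewrite cons_uniq tn.
    apply: subseq_uniq U2; rewrite !rcons_cons /= !eqxx.
    by rewrite sub1seq.
  have yB : y \notin B.
    apply/negP => yB; move: uABC; rewrite !inE uB orbF => /orP [] h; move: nuy; rewrite adjC.
      by rewrite adjBA.
    by rewrite adjBC.
  move: uABC yABC; rewrite !inE uB (negbTE yB) !orbF.
  case uA: (u \in A); case uC: (u \in C); case yA: (y \in A); case yC : (y \in C) => //= _ _; exfalso.
    have [_ /subsetP h] := HA uA; have := h x; rewrite in_nbr => /(_ ux).
    rewrite !inE (negbTE xA) orbF => hx; move/negP: nxy; apply; rewrite adjC.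
    by have [/subsetP h2 _] := HA yA; rewrite -in_nbr h2 // inE.
  have [_ /subsetP h] := HC uC; have := h x; rewrite in_nbr => /(_ ux).
  rewrite !inE (negbTE xC) orbF => hx; move/negP: nxy; apply; rewrite adjC.
  by have [/subsetP h2 _] := HC yC; rewrite -in_nbr h2 // inE.
split=> // z zp; have /andP [-> ->] := tz z zp; rewrite andbT /=.
apply/andP; split; first by apply: contraNneq tn => ->; rewrite inE mem_rcons inE zp !orbT.
apply/negP => zB.
have [zu zy] : adj z u /\ adj z y.
  by case/orP: side => /andP [h1 h2]; split; first [exact: adjBA|exact: adjBC].
move: zp; rewrite inE => /orP [/eqP e|zp].
  by move: nxy; rewrite -e zy.
have : ~~ adj u z.
  by apply: (allP ualll); move: zp; rewrite !inE mem_rcons inE => /orP [->|->]; rewrite ?orbT.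
by rewrite adjC zu.
Qed.

Lemma hole_cross S t : [disjoint A & B] -> [disjoint C & B] -> [disjoint A & C] ->
  hole S -> t \in S -> t \in B ->
  exists u y p, [/\ u \in C, y \in A, ipath G y u (~: (A :|: B :|: C)) p,
    S = [set:: t :: u :: rcons p y] /\ #|S| = (size p).+3 & S :&: B = [set t]].
Proof.
move=> dAB dCB dAC hS tS tB.
have [u [y [p [side ip eS sz pz]]]] := hole_cross_raw hS tS tB.
have [u' [y' [p' [u'C y'A ip' eS' [sz' pz']]]]] : exists u y p, [/\ u \in C, y \in A,
    induced_path G (u :: rcons p y), S = [set:: t :: u :: rcons p y] & #|S| = (size p).+3 /\
    {in p, forall z, [&& t != z, z \notin A, z \notin B & z \notin C]}].
  case/orP: side => /andP [h1 h2]; last by exists u, y, p.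
  exists y, u, (rev p); split=> //.
  - by have := induced_path_rev ip; rewrite rev_cons rev_rcons rcons_cons.
  - rewrite eS; apply/setP => z; rewrite !inE !mem_rcons !inE mem_rev.
    by case: (z == t); case: (z == u); case: (z == y).
  by rewrite size_rev; split=> // z; rewrite mem_rev; apply: pz.
exists u', y', p'; split=> //.
  apply: (ipath_of_induced ip') => z /pz' /and4P [_ h1 h2 h3].
  by rewrite !inE (negbTE h1) (negbTE h2) (negbTE h3).
apply/setP => z; rewrite eS' !inE mem_rcons inE.
case: (eqVneq z t) => [->|zt] //=.
case: (eqVneq z u') => [->|_]; first by rewrite (disjointFr dCB u'C).
case: (eqVneq z y') => [->|_]; first by rewrite (disjointFr dAB y'A).
by case zp: (z \in p') => //=; have /and4P [_ _ /negbTE -> _] := pz' z zp.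
Qed.

End Crossing.

Section SgraphOf.

Variables (T : finType) (e : rel T).
Hypothesis e_sym : symmetric e.
Hypothesis e_irr : irreflexive e.

Definition edge_set : {set {set T}} := [set A : {set T} | [exists x, exists y, e x y && (A == [set x; y])]].

Lemma edge_setP : [forall A in edge_set, #|A| == 2].
Proof.
apply/forall_inP => A; rewrite inE => /existsP [x /existsP [y /andP [xy /eqP ->]]].
rewrite cards2; suff -> : x != y by []. by apply: contraTneq xy => ->; rewrite e_irr.
Qed.

Definition sgraph_of : sgraph T := exist _ edge_set edge_setP.

Lemma adj_sgraph_of x y : adj sgraph_of x y = e x y.
Proof.
rewrite -[LHS]/([set x; y] \in edge_set) inE; apply/existsP/idP => [[z /existsP [w /andP [zw /eqP eq]]]|xy].
  have : x \in [set z; w] by rewrite -eq !inE eqxx.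
  have : z \in [set x; y] by rewrite eq !inE eqxx.
  have : w \in [set x; y] by rewrite eq !inE eqxx orbT.
  have nzw : z == w = false by apply/eqP => h; move: zw; rewrite h e_irr.
  rewrite !inE => /orP [/eqP wx|/eqP wy] /orP [/eqP zx|/eqP zy] /orP [/eqP xz|/eqP xw].
  all: try by move: nzw zw; subst; rewrite ?eqxx // e_sym.
by exists x; apply/existsP; exists y; rewrite xy eqxx.
Qed.

End SgraphOf.

Lemma ordS_iter k (i : 'I_k) m : val (iter m (@ordS k) i) = (i + m) %% k.
Proof.
elim: m => [|m IH]; first by rewrite addn0 modn_small.
by rewrite iterS /= IH -addn1 modnDml addn1 addnS.
Qed.

Lemma ord_pred_eq k (i j : 'I_k) : (j == ord_pred i) = (i == ordS j).
Proof. by apply/eqP/eqP => ->; rewrite ?ord_predK ?ordSK. Qed.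

Lemma ordS_lt k (i j : 'I_k) : i < j ->
  (j == ordS i) || (i == ordS j) = (j == i.+1 :> nat) || ((i == 0 :> nat) && (j == k.-1 :> nat)).
Proof.
move=> ij; have jk := ltn_ord j; rewrite -!val_eqE /=.
rewrite (modn_small (leq_ltn_trans ij jk)).
case: (ltnP j.+1 k) => h; first by rewrite modn_small //; move: ij h jk; clear; lia.
have e : j.+1 = k by apply/eqP; rewrite eqn_leq jk h.
by rewrite e modnn; move: ij e; clear; lia.
Qed.

Section Braid.

Variables (V : finType) (G : sgraph V) (k : nat) (B : 'I_k -> {set V}).
Local Notation adj := (adj G).
Hypothesis HB : cyclic_braid_clusters G B.

Lemma braid_mem z : exists i, z \in B i.
Proof.
have [_ _ /and3P [/eqP cov _ _] _] := HB.
have : z \in cover [set B i | i : 'I_k] by rewrite cov inE.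
by move=> /bigcupP [X /imsetP [i _ ->] zi]; exists i.
Qed.

Lemma braid_disj i j : i != j -> [disjoint B i & B j].
Proof.
have [_ inj /and3P [_ /trivIsetP tr _] _] := HB => ij.
by apply: tr; rewrite ?imset_f //; apply: contra ij => /eqP/inj ->.
Qed.

Lemma braid_inj z i j : z \in B i -> z \in B j -> i = j.
Proof.
move=> zi zj; apply/eqP; apply: contraT => ij.
by rewrite (disjointFr (braid_disj ij) zi) in zj.
Qed.

Lemma braid_neq0 i : exists z, z \in B i.
Proof.
have [_ _ /and3P [_ _ n0] _] := HB; apply/set0Pn.
by apply: contra n0 => /eqP e; rewrite -e imset_f.
Qed.

Lemma braid_sum : \sum_i #|B i| = #|V|.
Proof.
have [_ inj pt _] := HB; have := card_partition pt; rewrite cardsT => ->.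
by rewrite big_imset //= => i j _ _; apply: inj.
Qed.

Lemma braid_adj i j x z : x \in B i -> z \in B j -> i != j ->
  adj x z = (j == ordS i) || (i == ordS j).
Proof.
have [_ _ _ H] := HB => xi zj ij; have [/subsetP h1 /subsetP h2] := H _ _ xi.
apply/idP/idP => [xz|h].
  have := h2 z; rewrite in_nbr => /(_ xz); rewrite !inE -(ord_pred_eq i j).
  case/orP => [/orP []|] zz; have e := braid_inj zj zz; rewrite e ?eqxx ?orbT //.
  by rewrite e eqxx in ij.
by rewrite -in_nbr h1 // inE; case/orP: h => /eqP e; rewrite ?e ?ordSK -?e zj ?orbT.
Qed.

Hypothesis k5 : 5 <= k.

Lemma ordS_neq (i : 'I_k) : ordS i != i.
Proof.
rewrite -val_eqE /=; have := ltn_ord i; case: (ltnP i.+1 k) => h ik.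
  by rewrite modn_small //; clear; lia.
have e : i.+1 = k by apply/eqP; rewrite eqn_leq ik h.
by rewrite e modnn; move: k5 e; clear; lia.
Qed.

Lemma ordSS_neq (i : 'I_k) : ordS (ordS i) != i.
Proof.
rewrite -val_eqE /=; have := ltn_ord i; case: (ltnP i.+1 k) => h ik.
  rewrite (modn_small h); case: (ltnP i.+2 k) => h2.
    by rewrite modn_small //; clear; lia.
  have e : i.+2 = k by apply/eqP; rewrite eqn_leq h h2.
  by rewrite e modnn; move: k5 e; clear; lia.
have e : i.+1 = k by apply/eqP; rewrite eqn_leq ik h.
by rewrite e modnn modn_small; move: k5 e; clear; lia.
Qed.

Hypothesis B4 : forall i, #|B i| <= 4.

Lemma braid_hole_cross S i t : hole G S -> t \in S -> t \in B i ->
  S :&: B i = [set t] /\ exists u, u \in S :&: B (ordS i).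
Proof.
move=> hS tS ti; have [_ _ _ H] := HB.
have pi : ord_pred i != i by rewrite -{2}[i]ord_predK eq_sym ordS_neq.
have psi : ord_pred i != ordS i by rewrite -{2}[i]ord_predK eq_sym ordSS_neq.
have [|a ai|c ci||||u [y [p [uC yA _ [eS _] e]]]] :=
  @hole_cross V G (B (ord_pred (ord_pred i))) (B (ord_pred i)) (B i) (B (ordS i))
    (B (ordS (ordS i))) (B4 i) _ _ _ S t _ _ _ hS tS ti.
- by move=> b bi; apply: H.
- by have := H _ _ ai; rewrite ord_predK.
- by have := H _ _ ci; rewrite ordSK.
- exact: braid_disj.
- by apply: braid_disj; apply: ordS_neq.
- exact: braid_disj.
by split=> //; exists u; rewrite inE uC andbT eS !inE eqxx orbT.
Qed.

(** By [braid_hole_cross] a hole meeting a cluster meets it in one vertex and also meets the next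
    cluster, hence all clusters in turn. *)
Lemma braid_hole_transversal S i : hole G S -> #|S :&: B i| = 1.
Proof.
move=> hS; have /andP [_ S5] := hS.
have [t tS] : exists t, t \in S by apply/set0Pn; rewrite -card_gt0; apply: leq_trans S5.
have [i0 ti] := braid_mem t.
have all_i m : exists u, u \in S :&: B (iter m (@ordS k) i0).
  elim: m => [|m [u /setIP [uS ui]]]; first by exists t; rewrite inE tS.
  by have [_ h] := braid_hole_cross hS uS ui.
have ei : iter (i + (k - i0)) (@ordS k) i0 = i.
  apply/val_inj; rewrite ordS_iter.
  have -> : i0 + (i + (k - i0)) = i + k by have := ltn_ord i0; clear; lia.
  by rewrite modnDr modn_small.
have [u] := all_i (i + (k - i0)); rewrite ei => /setIP [uS ui].
by have [-> _] := braid_hole_cross hS uS ui; rewrite cards1.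
Qed.

Lemma transversal_hole (f : {ffun 'I_k -> V}) : f \in family B -> odd k -> odd_hole G [set f i | i : 'I_k].
Proof.
move=> /familyP Hf ok.
have fi i : f i \in B i by apply: Hf.
have finj : injective f by move=> i j e; apply: (@braid_inj (f i)); rewrite // e.
have [x0 _] := braid_neq0 (Ordinal (leq_trans (isT : 0 < 5) k5)).
pose c := [seq f i | i <- enum 'I_k].
have sc : size c = k by rewrite size_map size_enum_ord.
have eS : [set f i | i : 'I_k] = [set:: c].
  apply/setP => z; rewrite inE; apply/imsetP/mapP => [[i _ ->]|[i _ ->]].
    by exists i; rewrite ?mem_enum.
  by exists i.
have cS : #|[set f i | i : 'I_k]| = k by rewrite card_imset // card_ord.
rewrite /odd_hole cS ok k5 andbT eS; apply/andP; split=> //.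
apply: hole_seq_induces; last by rewrite sc; apply: leq_trans k5.
apply/(hole_seq_nthP G x0); first by rewrite sc; apply: leq_trans k5.
split; first by rewrite map_inj_uniq // enum_uniq.
move=> i j; rewrite sc => /andP [ij jk]; have ik := ltn_trans ij jk.
have nc l (lk : l < k) : nth x0 c l = f (Ordinal lk).
  by rewrite (nth_map (Ordinal lk)) ?size_enum_ord // (nth_ord_enum (Ordinal lk) (Ordinal lk)).
rewrite (nc i ik) (nc j jk) (braid_adj (fi _) (fi _)).
  by rewrite ordS_lt.
by rewrite -val_eqE /= ltn_eqF.
Qed.

Lemma card_familyE : #|family B| = \prod_i #|B i|.
Proof. by rewrite card_family foldrE big_map enumT. Qed.

Lemma nb_odd_holes_braid_ge : odd k -> \prod_i #|B i| <= nb_odd_holes G.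
Proof.
move=> ok; rewrite -card_familyE /nb_odd_holes.
have inj : {in family B &, injective (fun f : {ffun 'I_k -> V} => [set f i | i : 'I_k])}.
  move=> f g /familyP Hf /familyP Hg e; apply/ffunP => i.
  have : f i \in [set g i | i : 'I_k] by rewrite -e imset_f.
  move=> /imsetP [j _ ej]; rewrite ej; congr (g _).
  by apply: (@braid_inj (f i)); [rewrite ej|]; [apply: Hg|apply: Hf].
rewrite -(card_in_imset inj); apply: subset_leq_card; apply/subsetP => S /imsetP [f Hf ->].
by rewrite inE transversal_hole.
Qed.

Lemma nb_odd_holes_braid_le : nb_odd_holes G <= \prod_i #|B i|.
Proof.
rewrite -card_familyE /nb_odd_holes.
apply: leq_trans (leq_imset_card (fun f : {ffun 'I_k -> V} => [set f i | i : 'I_k]) (mem (family B))).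
apply: subset_leq_card; apply/subsetP => S; rewrite inE => /odd_hole_hole hS.
have ex i : exists z, z \in S :&: B i by apply/card_gt0P; rewrite braid_hole_transversal.
pose f := [ffun i => xchoose (ex i)].
have fi i : f i \in S :&: B i by rewrite ffunE; apply: xchooseP.
apply/imsetP; exists f; first by apply/familyP => i; have /setIP [] := fi i.
apply/eqP; rewrite eqEsubset; apply/andP; split; apply/subsetP => z; last first.
  by move=> /imsetP [i _ ->]; have /setIP [] := fi i.
move=> zS; have [i zi] := braid_mem z.
have /eqP/cards1P [w e] := braid_hole_transversal i hS.
have : z \in S :&: B i by rewrite inE zS.
have := fi i; rewrite e !inE => /eqP <- /eqP ->; exact: imset_f.
Qed.

Lemma nb_odd_holes_braid : odd k -> nb_odd_holes G = \prod_i #|B i|.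
Proof. by move=> ok; apply/eqP; rewrite eqn_leq nb_odd_holes_braid_le nb_odd_holes_braid_ge. Qed.

End Braid.

Section BraidOfSeq.

Variables (V : finType) (G : sgraph V) (Cs : seq {set V}).
Local Notation adj := (adj G).
Hypothesis C3 : 3 <= size Cs.
Hypothesis C0 : forall i, i < size Cs -> nth set0 Cs i != set0.
Hypothesis Cdisj : forall i j z, i < j < size Cs -> z \in nth set0 Cs i -> z \notin nth set0 Cs j.
Hypothesis Ccov : forall z, exists2 i, i < size Cs & z \in nth set0 Cs i.
Hypothesis Cadj : forall i j x z, i < j < size Cs -> x \in nth set0 Cs i -> z \in nth set0 Cs j ->
  adj x z = (j == i.+1) || ((i == 0) && (j == (size Cs).-1)).

Lemma braid_of_seq : cyclic_braid_clusters G (fun i : 'I_(size Cs) => nth set0 Cs i).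
Proof.
have dis (i j : 'I_(size Cs)) z : z \in nth set0 Cs i -> z \in nth set0 Cs j -> i = j.
  move=> zi zj; apply/val_inj; case: (ltngtP i j) => // h.
    by move: (Cdisj (i:=i) (j:=j) (z:=z)); rewrite h ltn_ord zj => /(_ isT zi).
  by move: (Cdisj (i:=j) (j:=i) (z:=z)); rewrite h ltn_ord zi => /(_ isT zj).
have ad (i j : 'I_(size Cs)) x z : i != j -> x \in nth set0 Cs i -> z \in nth set0 Cs j ->
    adj x z = (j == ordS i) || (i == ordS j).
  move=> ij xi zj; case: (ltngtP i j) => h.
  - by rewrite ordS_lt // (@Cadj i j) ?h ?ltn_ord.
  - by rewrite adjC orbC ordS_lt // (@Cadj j i) ?h ?ltn_ord.
  by move: ij; rewrite -val_eqE /= h eqxx.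
split=> //.
- move=> i j /= e; have [z zi] := set0Pn _ (C0 (ltn_ord i)).
  by apply: (dis i j z) => //; rewrite -e.
- apply/and3P; split.
  + apply/eqP/setP => z; rewrite inE; have [i iC zi] := Ccov z.
    by apply/bigcupP; exists (nth set0 Cs i) => //; apply/imsetP; exists (Ordinal iC).
  + apply/trivIsetP => X Y /imsetP [i _ ->] /imsetP [j _ ->] ne.
    rewrite disjoint_subset; apply/subsetP => z zi; rewrite inE; apply: contra ne => zj.
    by rewrite (dis _ _ _ zi zj).
  by apply/negP => /imsetP [i _ e]; have := C0 (ltn_ord i); rewrite -e eqxx.
move=> i x xi; split; apply/subsetP => z; rewrite in_nbr !inE.
  have S_neq (j : 'I_(size Cs)) : ordS j != j.
    rewrite -val_eqE /=; have := ltn_ord j; case: (ltnP j.+1 (size Cs)) => h jk.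
      by rewrite modn_small //; clear; lia.
    have e : j.+1 = size Cs by apply/eqP; rewrite eqn_leq jk h.
    by rewrite e modnn; move: C3 e; clear; lia.
  have P_neq : ord_pred i != i by rewrite -{2}[i]ord_predK eq_sym S_neq.
  case/orP => zj.
    by rewrite (ad i (ord_pred i)) 1?eq_sym // ord_predK eqxx orbT.
  by rewrite (ad i (ordS i)) 1?eq_sym // eqxx.
move=> xz; have [j jC zj] := Ccov z.
case: (eqVneq i (Ordinal jC)) => [->|ne]; first by rewrite zj orbT.
move: xz; rewrite (ad i (Ordinal jC)) // -(ord_pred_eq i) => /orP [] /eqP <-; by rewrite zj ?orbT.
Qed.

End BraidOfSeq.

(** * Cutting a graph along a clean segment *)

Section FromSegment.

Variables (V : finType) (G : sgraph V) (X : nat -> {set V}) (W : nat).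
Local Notation adj := (adj G).
Local Notation N := (neighbours G).
Hypothesis W5 : 4 < W.
Hypothesis seg : clean_segment G X W.

Let Xcard i : i < W -> #|X i| = 3. Proof. by case: seg => h _ _; apply: h. Qed.

Lemma seg_disj i j : i < W -> j < W -> i != j -> [disjoint X i & X j].
Proof.
have [_ d _] := seg; move=> iW jW; case: (ltngtP i j) => // h _.
  by apply: d; rewrite h.
by rewrite disjoint_sym; apply: d; rewrite h.
Qed.

Lemma seg_nbr i t : 0 < i -> i.+1 < W -> t \in X i ->
  X i.-1 :|: X i.+1 \subset N t /\ N t \subset X i.-1 :|: X i :|: X i.+1.
Proof. by case: seg => _ _ h; apply: h. Qed.

Lemma seg_cross i S t : 1 < i -> i.+2 < W -> hole G S -> t \in S -> t \in X i ->
  exists u y p, [/\ u \in X i.+1, y \in X i.-1, ipath G y u (~: (X i.-1 :|: X i :|: X i.+1)) p,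
    S = [set:: t :: u :: rcons p y] /\ #|S| = (size p).+3 & S :&: X i = [set t]].
Proof.
case: i => [|[|i]] // _ iW hS tS ti /=.
have lt1 : i.+3 < W by apply: ltnW.
have lt2 : i.+2 < W by apply: ltnW.
have lt3 : i.+1 < W by apply: ltnW.
apply: (@hole_cross V G (X i) (X i.+1) (X i.+2) (X i.+3) (X i.+4)) hS tS ti.
- by rewrite Xcard.
- by move=> b bi; apply: (@seg_nbr i.+2).
- by move=> b bi; apply: (@seg_nbr i.+1).
- by move=> b bi; apply: (@seg_nbr i.+3).
- by apply: seg_disj => //; clear; lia.
- by apply: seg_disj => //; clear; lia.
by apply: seg_disj => //; clear; lia.
Qed.

(** A hole meeting an inner layer also meets the one before it, so going back it would meet
    [X 2]. *)
Lemma seg_misses S i : hole G S -> [disjoint S & X 2] -> 1 < i -> i.+2 < W ->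
  [disjoint S & X i].
Proof.
move=> hS d2; elim: i => [|[|[|i]] IH] // _ iW.
rewrite -setI_eq0; apply/eqP/setP => t; rewrite in_set0; apply/negP => /setIP [tS ti].
have [u [y [p [_ yX _ [eS _] _]]]] := seg_cross (isT : 1 < i.+3) iW hS tS ti.
have := IH isT (ltnW iW); move/disjointFl => /(_ _ yX).
by rewrite eS !inE mem_rcons inE eqxx !orbT.
Qed.

Local Notation R := (~: (X 1 :|: X 2 :|: X 3)).

Section Count.
Local Open Scope ring_scope.
Variable F : archiRealFieldType.

Lemma many_paths (c : F) : 0 < c ->
  c <= #|[set S | odd_hole G S && ~~ [disjoint S & X 2]]|%:R ->
  exists u y, [/\ u \in X 3, y \in X 1 & c / 27%:R <= (par_cnt G y false #|V| u R)%:R].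
Proof.
move=> c0 Hc; set Z := [set S | _] in Hc.
pose Y := setX (X 2) (setX (X 3) (X 1)).
pose Ps (t : V * (V * V)) := [seq [set:: t.1 :: t.2.1 :: rcons p t.2.2] |
  p <- [seq p <- pths G #|V| t.2.2 t.2.1 R | ~~ odd (size p)]].
pose Q t (S : {set V}) := S \in Ps t.
have HQ S : S \in Z -> exists2 t, t \in Y & Q t S.
  rewrite inE -setI_eq0 => /andP [oS /set0Pn [t /setIP [tS t2]]].
  have [u [y [p [uX yX ip [eS sS] _]]]] := seg_cross (isT : (1 < 2)%N) W5 (odd_hole_hole oS) tS t2.
  exists (t, (u, y)); first by rewrite !in_setX t2 uX yX.
  apply/mapP; exists p => //; rewrite mem_filter mem_pths ip.
  have /and3P [_ odS _] := oS; rewrite sS /= negbK in odS; rewrite odS /=.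
  by apply: leq_trans (max_card (mem S)); rewrite sS -addn3 leq_addr.
have HY : (#|Y| <= 27)%N by rewrite !cardsX !Xcard //; apply: ltn_trans W5.
have [|[t [u y]] tY Ht] := exists_ge_pigeon HQ HY isT Hc; first by [].
move: tY; rewrite !in_setX => /and3P [_ /= uX yX].
exists u, y; split=> //; apply: (le_trans Ht); rewrite ler_nat.
apply: (@leq_trans (size (Ps (t, (u, y))))).
  apply: leq_trans (card_size _); apply: subset_leq_card; apply/subsetP => S.
  by rewrite inE => /andP [].
rewrite size_map size_filter -sum1_count big_mkcond /par_cnt /=.
by apply: leq_sum => p _; case: (odd _).
Qed.

End Count.

Let W1 : 1 < W. Proof. exact: leq_trans W5. Qed.
Let W2 : 2 < W. Proof. exact: leq_trans W5. Qed.
Let W3 : 3 < W. Proof. exact: leq_trans W5. Qed.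
Let W0 : 0 < W. Proof. exact: leq_trans W5. Qed.

Let notX i j z : i < W -> j < W -> i != j -> z \in X i -> (z \in X j) = false.
Proof. by move=> iW jW ij; apply: disjointFr; apply: seg_disj. Qed.

Lemma seg_next u z : u \in X 3 -> z \in R -> adj u z = (z \in X 4).
Proof.
move=> u3 zR; have [/subsetP h1 /subsetP h2] := seg_nbr (isT : 0 < 3) W5 u3.
rewrite -in_nbr; apply/idP/idP => [/h2|z4]; last by apply: h1; rewrite inE z4 orbT.
by move: zR; rewrite !inE !negb_or => /andP [/andP [_ /negbTE ->] /negbTE ->].
Qed.

Lemma seg_prev y z : y \in X 1 -> z \in R -> adj y z = (z \in X 0).
Proof.
move=> y1 zR; have [/subsetP h1 /subsetP h2] := seg_nbr (isT : 0 < 1) W2 y1.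
rewrite -in_nbr; apply/idP/idP => [/h2|z0]; last by apply: h1; rewrite inE z0.
by move: zR; rewrite !inE !negb_or => /andP [/andP [/negbTE -> /negbTE ->] _]; rewrite !orbF.
Qed.

Lemma seg_mid x z : x \in X 2 -> z \in R -> adj x z = false.
Proof.
move=> x2 zR; have [_ /subsetP h2] := seg_nbr (isT : 0 < 2) W3 x2.
rewrite -in_nbr; apply: contraTF zR => /h2.
by rewrite !inE negbK.
Qed.

(** Within R the neighbours of u form [X 4] and those of y form [X 0], so these are the first and
    the last layer of the chain. The other vertices of [X 3] and [X 1] see the same vertices of R,
    which closes the chain to a cycle. *)
Lemma braid_of_chain u y Xs : u \in X 3 -> y \in X 1 -> chain G y u R Xs ->
  1 < size Xs ->
  cyclic_braid_clusters G (fun i : 'I_(size Xs).+3 => nth set0 [:: X 1, X 2, X 3 & Xs] i).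
Proof.
move=> u3 y1 ch s2.
have X4R z : z \in X 4 -> z \in R.
  by move=> z4; rewrite !inE !(notX _ _ _ z4).
have eX0 : nth set0 Xs 0 = X 4.
  case: Xs ch s2 => [|X0 Xs] //= [_ <- _ _] _.
  apply/setP => z; rewrite inE; case zR: (z \in R); last first.
    by rewrite andbF; apply/esym; apply: contraFF zR; apply: X4R.
  by rewrite in_nbr (seg_next u3 zR) andbT.
have sR i z : z \in nth set0 Xs i -> z \in R by apply: chain_sub ch.
have y_adj x i z : x \in X 1 -> i < size Xs -> z \in nth set0 Xs i -> adj x z = (i.+1 == size Xs).
  move=> x1 iX zi; rewrite (seg_prev x1 (sR _ _ zi)) -(seg_prev y1 (sR _ _ zi)) adjC.
  exact: chain_end ch iX zi.
have XsN i z j : 0 < j <= 3 -> z \in nth set0 Xs i -> z \notin X j.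
  move=> j3 /sR; rewrite !inE !negb_or => /andP [/andP [h1 h2] h3].
  by case: j j3 => [|[|[|[|]]]].
apply: (@braid_of_seq V G [:: X 1, X 2, X 3 & Xs]) => //.
- move=> [|[|[|i]]] iX; rewrite /= -?card_gt0 ?Xcard //.
  by rewrite card_gt0; apply: layered_neq0 (chain_layered ch) _.
- move=> i j z /andP []; case: i => [|[|[|i]]]; case: j => [|[|[|j]]] //= ij js zi;
    rewrite ?(notX _ _ _ zi) //.
  1-3: by apply/negP => zj; move: zi; apply/negP; apply: XsN zj.
  by apply: (layered_disjoint (chain_layered ch) (i := i)) => //; apply/andP; split.
- move=> z; case zR: (z \in R).
    by have [i iX zi] := chain_cover ch zR; exists i.+3.
  move/negbT: zR; rewrite in_setC negbK !inE => /orP [/orP [] |] h.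
  + by exists 0.
  + by exists 1.
  by exists 2.
move=> i j x z ij xi zj.
have key : i < j -> adj x z = (j == i.+1) || (i == 0) && (j == (size Xs).+2).
  case/andP: ij => _; move: xi zj.
  case: i => [|[|[|i]]]; case: j => [|[|[|j]]] //= xi zj js lij.
  - have [/subsetP h _] := seg_nbr (isT : 0 < 1) W2 xi.
    by rewrite -in_nbr h // inE zj orbT.
  - have [_ /subsetP h] := seg_nbr (isT : 0 < 1) W2 xi.
    rewrite [RHS](_ : _ = false); last by move: s2; clear; lia.
    apply/negP; rewrite -in_nbr => /h; rewrite !inE.
    by rewrite !(notX _ _ _ zj).
  - by rewrite (y_adj x j z).
  - have [/subsetP h _] := seg_nbr (isT : 0 < 2) W3 xi.
    by rewrite -in_nbr h // inE zj orbT.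
  - by rewrite (seg_mid xi (sR _ _ zj)).
  - rewrite (seg_next xi (sR _ _ zj)) -eX0 orbF !eqSS.
    case: j zj js {lij} => [|j] zj js; first by rewrite zj.
    apply/negP => z0; have := layered_disjoint (chain_layered ch) (_ : 0 < j.+1 < size Xs) z0.
    by rewrite (js : j.+1 < size Xs) zj => /(_ isT).
  - rewrite orbF !eqSS; case: (ltngtP j i.+1) => h.
    + by move: h lij; clear; lia.
    + by apply/negbTE; apply: (chain_far ch _ h zj xi).
    by apply: (chain_next ch _ xi); rewrite -h.
by apply: key; case/andP: ij.
Qed.

End FromSegment.

(** * Passing to induced subgraphs *)

Section Relabel.

Variables (V : finType) (G : sgraph V) (A : {set V}).

Let h (i : 'I_#|A|) : V := enum_val i.
Let e : rel 'I_#|A| := fun i j => adj G (h i) (h j).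

Let e_sym : symmetric e. Proof. by move=> i j; rewrite /e adjC. Qed.
Let e_irr : irreflexive e. Proof. by move=> i; rewrite /e adjxx. Qed.

(** The graph induced on A is copied to ['I_#|A|], since [max_odd_holes] ranges over graphs on
    ordinals; odd holes inside A become odd holes of the copy. *)
Lemma card_odd_holes_sub : #|[set S : {set V} | odd_hole G S && (S \subset A)]| <= max_odd_holes #|A|.
Proof.
have hinj : injective h by apply: enum_val_inj.
pose G' := sgraph_of e_irr.
have pre (S : {set V}) : S \subset A -> h @: (h @^-1: S) = S.
  move=> SA; apply/setP => z; apply/imsetP/idP => [[i]|zS].
    by rewrite inE => hi ->.
  have zA := subsetP SA z zS; exists (enum_rank_in zA z).
    by rewrite inE /h enum_rankK_in.
  by rewrite /h enum_rankK_in.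
have inj : {in [set S : {set V} | odd_hole G S && (S \subset A)] &, injective (fun S : {set V} => h @^-1: S)}.
  by move=> S T; rewrite !inE => /andP [_ SA] /andP [_ TA] eq; rewrite -(pre S SA) -(pre T TA) eq.
rewrite -(card_in_imset inj).
apply: leq_trans (leq_bigmax G'); apply: subset_leq_card; apply/subsetP => S' /imsetP [S].
rewrite !inE => /andP [oS SA] ->.
have [hc S3] : induces_cycle G S /\ 3 <= #|S| by case/and3P: oS => h1 _ h3; split=> //; apply: leq_trans h3.
have [c [[Uc Hc] cS sc]] := induces_hole_seq hc.
have [a aS] : exists a, a \in S by apply/set0Pn; rewrite -card_gt0; apply: leq_trans S3.
have aA := subsetP SA a aS.
pose c' := [seq enum_rank_in aA z | z <- c].
have cc : [seq h i | i <- c'] = c.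
  rewrite -map_comp -[RHS]map_id; apply/eq_in_map => z zc /=.
  by rewrite /h enum_rankK_in //; apply: (subsetP SA); rewrite -cS inE.
have eS : h @^-1: S = [set:: c'].
  by apply/setP => i; rewrite !inE -cS inE -cc mem_map.
have Uc' : uniq c' by rewrite -(map_inj_uniq hinj) cc.
have cd : #|h @^-1: S| = #|S| by rewrite -[in RHS](pre S SA) card_imset.
rewrite /odd_hole cd; case/and3P: oS => _ -> ->; rewrite !andbT eS.
apply: hole_seq_induces; last by rewrite size_map sc.
split=> // i j ic jc; rewrite adj_sgraph_of // /e.
have hm l : l \in c' -> h l \in c by move=> lc; rewrite -cc mem_map.
by rewrite Hc ?hm // -cc !next_map // !inj_eq.
Qed.

End Relabel.

Lemma nb_odd_holes_le (V : finType) (G : sgraph V) : nb_odd_holes G <= max_odd_holes #|V|.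
Proof.
have := card_odd_holes_sub G [set: V]; rewrite cardsT; apply: leq_trans.
by apply: subset_leq_card; apply/subsetP => S; rewrite !inE subsetT andbT.
Qed.

(** * Optimal cluster sizes *)

(* a and c are the numbers of clusters of size 2 and 4. *)
Definition extremal_counts (n a c : nat) : bool :=
  match n %% 6 with
  | 0 => (a == 3) && (c == 0)
  | 1 => (a == 2) && (c == 0)
  | 2 => (a == 1) && (c == 0)
  | 3 => (a == 0) && (c == 0)
  | 4 => (a == 0) && (c == 1)
  | _ => (a == 0) && (c == 2) || (a == 4) && (c == 0)
  end.

Lemma extremal_countsD q m a c : extremal_counts (6 * q + m) a c = extremal_counts m a c.
Proof. by rewrite /extremal_counts [6 * q]mulnC modnMDl. Qed.

Lemma pow3_split b : 3 ^ b = 9 ^ (b %/ 2) * 3 ^ (b %% 2).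
Proof. by rewrite {1}(divn_eq b 2) expnD [_ %/ 2 * 2]mulnC expnM. Qed.

Lemma counts_split a b c : 2 * a + 3 * b + 4 * c = 6 * (b %/ 2) + (2 * a + 3 * (b %% 2) + 4 * c).
Proof. have := divn_eq b 2; lia. Qed.

Lemma counts_parity a b c : odd (a + b + c) = odd (a + b %% 2 + c).
Proof. by rewrite !oddD modn2; case: (odd b). Qed.

(** Two clusters of size 3 contribute six vertices and a factor 9 on both sides, so only the parity
    s of their number matters and finitely many cases remain. *)
Lemma extremal_counts_check a c s : a < 5 -> c < 3 -> s < 2 ->
  (extremal_counts (2 * a + 3 * s + 4 * c) a c ==
   odd (a + s + c) && (E9 (2 * a + 3 * s + 4 * c + 3) <= 27 * (2 ^ a * 3 ^ s * 4 ^ c))) &&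
  (extremal_counts (2 * a + 3 * s + 4 * c) a c ==>
   (E9 (2 * a + 3 * s + 4 * c + 3) == 27 * (2 ^ a * 3 ^ s * 4 ^ c))).
Proof.
case: a => [|[|[|[|[|]]]]] // _; case: c => [|[|[|]]] // _; case: s => [|[|]] // _; by vm_compute.
Qed.

Lemma extremal_counts_bound a c n : extremal_counts n a c -> a < 5 /\ c < 3.
Proof.
rewrite /extremal_counts; case: (n %% 6) => [|[|[|[|[|m]]]]];
  by [move=> /andP [/eqP -> /eqP ->]|case/orP => /andP [/eqP -> /eqP ->]].
Qed.

Lemma extremal_counts_prod a b c : extremal_counts (2 * a + 3 * b + 4 * c) a c ->
  odd (a + b + c) /\ E9 (2 * a + 3 * b + 4 * c + 3) = 27 * (2 ^ a * 3 ^ b * 4 ^ c).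
Proof.
move=> H; have [a5 c3] := extremal_counts_bound H.
have s2 : b %% 2 < 2 by rewrite ltn_mod.
have /andP [/eqP h1 /implyP h2] := extremal_counts_check a5 c3 s2.
rewrite counts_split extremal_countsD in H; have /eqP e := h2 H.
rewrite h1 in H; case/andP: H => H _; rewrite counts_parity H; split=> //.
by rewrite counts_split -[in LHS]addnA E9D e (pow3_split b); move: (9 ^ _) (2 ^ a) (3 ^ _) (4 ^ c) => x y z t; ring.
Qed.

Lemma pow2_sub3 w : 2 < w -> 2 ^ w = 8 * 2 ^ (w - 3).
Proof. by move=> w3; rewrite -[in LHS](subnKC w3) expnD. Qed.

(* Replacing 2 * 2 * 2 by 3 * 3 gains a factor 9/8. *)
Lemma prod23_le w b : 1 < w -> 27 * (2 ^ w * 3 ^ b) <= E9 (2 * w + 3 * b + 3).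
Proof.
elim/ltn_ind: w b => w IH b w1.
case: (ltnP w 5) => w5.
  have := divn_eq b 2; have : b %% 2 < 2 by rewrite ltn_mod.
  rewrite (pow3_split b); move: (b %/ 2) (b %% 2) => q s s2 ->.
  have -> : 2 * w + 3 * (q * 2 + s) + 3 = 6 * q + (2 * w + 3 * s + 3) by lia.
  rewrite E9D [2 ^ w * _]mulnCA [27 * _]mulnCA leq_mul2l; apply/orP; right; clear IH.
  by case: w w1 w5 => [|[|[|[|[|]]]]] // _ _; case: s s2 => [|[|]] // _; vm_compute.
have := IH (w - 3) _ b.+2 _.
have -> : 2 * (w - 3) + 3 * b.+2 + 3 = 2 * w + 3 * b + 3 by lia.
rewrite (pow2_sub3 (ltnW (ltnW w5))) !expnS => h.
have := h _ _; move: (E9 _) (2 ^ _) (3 ^ b) => x y z; clear -w5; lia.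
Qed.

Lemma prod23_lt w b : 4 < w -> 27 * (2 ^ w * 3 ^ b) < E9 (2 * w + 3 * b + 3).
Proof.
move=> w5; have := @prod23_le (w - 3) b.+2.
have -> : 2 * (w - 3) + 3 * b.+2 + 3 = 2 * w + 3 * b + 3 by lia.
have := E9_gt0 (2 * w + 3 * b + 3).
rewrite (pow2_sub3 (ltnW (ltnW w5))) !expnS => h0 h.
have := h _; move: h0; move: (E9 _) (2 ^ _) (3 ^ b) => x y z; clear -w5; lia.
Qed.

Lemma extremal_counts_of_prod a b c : odd (a + b + c) ->
  E9 (2 * a + 3 * b + 4 * c + 3) <= 27 * (2 ^ a * 3 ^ b * 4 ^ c) ->
  extremal_counts (2 * a + 3 * b + 4 * c) a c.
Proof.
move=> ok H.
(* A cluster of size 4 is read as two of size 2, so that [prod23_lt] bounds a + 2c by 4. *)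
have e : 2 ^ a * 3 ^ b * 4 ^ c = 2 ^ (a + 2 * c) * 3 ^ b by rewrite expnD expnM; ring.
case: (ltnP 4 (a + 2 * c)) => w.
  have := prod23_lt b w; rewrite -e ltnNge (_ : 2 * (a + 2 * c) + 3 * b = 2 * a + 3 * b + 4 * c); last by lia.
  by rewrite H.
have a5 : a < 5 by lia. have c3 : c < 3 by lia.
have s2 : b %% 2 < 2 by rewrite ltn_mod.
have /andP [/eqP h1 _] := extremal_counts_check a5 c3 s2.
rewrite counts_split extremal_countsD h1 -counts_parity ok /=.
move: H; rewrite counts_split -[in X in X -> _]addnA E9D (pow3_split b).
rewrite (_ : 27 * _ = 9 ^ (b %/ 2) * (27 * (2 ^ a * 3 ^ (b %% 2) * 4 ^ c))); last by ring.
by rewrite leq_pmul2l // expn_gt0.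
Qed.

Section SizeCounts.

Variables (I : finType) (r : I -> nat).
Hypothesis r234 : forall i, r i \in [:: 2; 3; 4].
Let cnt s := #|[set i | r i == s]|.

Lemma sum_indicator s : \sum_i (r i == s : nat) = cnt s.
Proof.
rewrite /cnt -sum1_card [RHS]big_mkcond; apply: eq_bigr => i _.
by rewrite inE; case: (r i == s).
Qed.

Lemma card_sizes : cnt 2 + cnt 3 + cnt 4 = #|I|.
Proof.
rewrite -!sum_indicator -!big_split /= -sum1_card; apply: eq_bigr => i _.
by have := r234 i; rewrite !inE => /or3P [] /eqP ->.
Qed.

Lemma sum_sizes : \sum_i r i = 2 * cnt 2 + 3 * cnt 3 + 4 * cnt 4.
Proof.
rewrite -!sum_indicator !big_distrr -!big_split /=; apply: eq_bigr => i _.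
by have := r234 i; rewrite !inE => /or3P [] /eqP ->.
Qed.

Lemma prod_sizes : \prod_i r i = 2 ^ cnt 2 * 3 ^ cnt 3 * 4 ^ cnt 4.
Proof.
rewrite -!sum_indicator !expn_sum -!big_split /=; apply: eq_bigr => i _.
by have := r234 i; rewrite !inE => /or3P [] /eqP ->.
Qed.

End SizeCounts.

Lemma card_size0 (I : finType) (r : I -> nat) t : #|[set i | r i == t]| = 0 <-> forall i, r i != t.
Proof.
split=> [/eqP|H]; first by rewrite cards_eq0 => /eqP/setP h i; have := h i; rewrite !inE => ->.
by apply/eqP; rewrite cards_eq0; apply/eqP/setP => i; rewrite !inE (negbTE (H i)).
Qed.

Lemma size3_exceptP (V : finType) k (B : 'I_k -> {set V}) j s t : (s, t) = (2, 4) \/ (s, t) = (4, 2) ->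
  size3_except B j s <-> (forall i, #|B i| \in [:: 2; 3; 4]) /\
    #|[set i | #|B i| == s]| = j /\ #|[set i | #|B i| == t]| = 0.
Proof.
move=> st; rewrite card_size0; case: st => -[-> ->]; split=> [[H e]|[H [e e0]]].
all: try (split; [by move=> i; case: (H i) => ->|split=> // i; by case: (H i) => ->]).
all: split=> // i; have := H i; have := e0 i; rewrite !inE => /negbTE ->.
  by rewrite orbF => /orP [] /eqP ->; [right|left].
by move=> /= /orP [] /eqP ->; [left|right].
Qed.

Lemma extremal_sizesP (V : finType) k (B : 'I_k -> {set V}) n :
  extremal_sizes B n <-> (forall i, #|B i| \in [:: 2; 3; 4]) /\
    extremal_counts n #|[set i | #|B i| == 2]| #|[set i | #|B i| == 4]|.
Proof.
have s2 j := @size3_exceptP V k B j 2 4 (or_introl erefl).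
have s4 j := @size3_exceptP V k B j 4 2 (or_intror erefl).
rewrite /extremal_sizes /extremal_counts.
have two j : size3_except B j 2 <-> (forall i, #|B i| \in [:: 2; 3; 4]) /\
    (#|[set i | #|B i| == 2]| == j) && (#|[set i | #|B i| == 4]| == 0).
  split=> [/s2 [h [-> ->]]|[h /andP [/eqP h1 /eqP h2]]]; first by rewrite !eqxx.
  by apply/s2.
have four j : size3_except B j 4 <-> (forall i, #|B i| \in [:: 2; 3; 4]) /\
    (#|[set i | #|B i| == 2]| == 0) && (#|[set i | #|B i| == 4]| == j).
  split=> [/s4 [h [-> ->]]|[h /andP [/eqP h1 /eqP h2]]]; first by rewrite !eqxx.
  by apply/s4.
case: (n %% 6) => [|[|[|[|[|m]]]]] //.
  split=> [H|[H /andP [/eqP h2 /eqP h4]] i].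
    split; first by move=> i; rewrite H.
    by apply/andP; split; apply/eqP/card_size0 => i; rewrite H.
  have := H i; have /card_size0/(_ i)/negbTE := h2; have /card_size0/(_ i)/negbTE := h4.
  by rewrite !inE => -> -> /orP [] // /orP [/eqP|].
split=> [[/four|/two] [h ->]|[h /orP []] hh]; rewrite ?orbT //; [left; apply/four|right; apply/two]; by [].
Qed.

(** * Blow-ups of cycles and the lower bound *)

Section LowerBound.

Variable s : seq nat.
Hypothesis s_pos : {in s, forall x, 0 < x}.
Hypothesis s5 : 5 <= size s.
Local Notation T := {i : 'I_(size s) & 'I_(nth 0 s i)}.

Let e : rel T := fun x z => (tag z == ordS (tag x)) || (tag x == ordS (tag z)).

Let e_sym : symmetric e. Proof. by move=> x z; rewrite /e orbC. Qed.
Let e_irr : irreflexive e.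
Proof. by move=> x; rewrite /e orbb eq_sym; apply/negbTE/ordS_neq. Qed.

Let B (i : 'I_(size s)) : {set T} := [set x | tag x == i].

Lemma card_blowup_cluster i : #|B i| = nth 0 s i.
Proof.
rewrite /B cardsE; have := bij_eq_card (tag_with_bij (fun i : 'I_(size s) => 'I_(nth 0 s i)) i).
by rewrite card_ord card_sig => ->; apply: eq_card.
Qed.

Lemma blowup_braid : cyclic_braid_clusters (sgraph_of e_irr) B.
Proof.
have ne i : B i != set0.
  by rewrite -card_gt0 card_blowup_cluster s_pos // mem_nth.
split; first by apply: leq_trans s5.
- move=> i j e1; have /set0Pn [z zi] := ne i.
  by have := zi; rewrite e1; move: zi; rewrite !inE => /eqP -> /eqP.
- apply/and3P; split.
  + apply/eqP/setP => z; rewrite inE; apply/bigcupP; exists (B (tag z)); last by rewrite inE.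
    exact: imset_f.
  + apply/trivIsetP => X Y /imsetP [i _ ->] /imsetP [j _ ->] nij.
    rewrite disjoint_subset; apply/subsetP => z; rewrite !inE => /eqP zi; apply: contra nij => /eqP zj.
    by rewrite -zi -zj.
  by apply/negP => /imsetP [i _ e0]; have := ne i; rewrite -e0 eqxx.
move=> i x; rewrite inE => /eqP xi; split; apply/subsetP => z; rewrite in_nbr adj_sgraph_of // /e xi !inE -(ord_pred_eq i).
  by rewrite orbC.
by case/orP => ->; rewrite ?orbT.
Qed.

Lemma max_odd_holes_prod : odd (size s) -> \prod_(x <- s) x <= max_odd_holes (sumn s).
Proof.
move=> os; have := nb_odd_holes_le (sgraph_of e_irr).
have -> : #|{: T}| = sumn s.
  rewrite card_tagged; congr sumn.
  apply: (@eq_from_nth _ 0); first by rewrite size_map size_enum_ord.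
  move=> i; rewrite size_map size_enum_ord => iS.
  by rewrite (nth_map (Ordinal iS)) ?size_enum_ord // (nth_ord_enum (Ordinal iS) (Ordinal iS)) card_ord.
apply: leq_trans; apply: leq_trans (nb_odd_holes_braid_ge blowup_braid s5 os).
rewrite (big_nth 0) big_mkord; apply: leq_prod => i _.
by rewrite card_blowup_cluster.
Qed.

End LowerBound.

Lemma extremal_counts_exist n : 20 <= n ->
  exists a b c, [/\ n = 2 * a + 3 * b + 4 * c, extremal_counts n a c & 5 <= a + b + c].
Proof.
move=> n20; have e := divn_eq n 6; have := ltn_pmod n (isT : 0 < 6).
rewrite /extremal_counts; move: (n %/ 6) (n %% 6) e => q [|[|[|[|[|[|m]]]]]] e // _.
- by exists 3, (2 * q - 2), 0; split=> //; lia.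
- by exists 2, (2 * q - 1), 0; split=> //; lia.
- by exists 1, (2 * q), 0; split=> //; lia.
- by exists 0, (2 * q + 1), 0; split=> //; lia.
- by exists 0, (2 * q), 1; split=> //; lia.
by exists 4, (2 * q - 1), 0; split=> //; lia.
Qed.

Lemma max_odd_holes_ge n : 20 <= n -> E9 (n + 3) <= 27 * max_odd_holes n.
Proof.
move=> n20; have [a [b [c [en ex k5]]]] := extremal_counts_exist n20.
rewrite en in ex; have [ok eE] := extremal_counts_prod ex.
rewrite en eE leq_mul2l /=.
have := @max_odd_holes_prod (nseq a 2 ++ nseq b 3 ++ nseq c 4).
rewrite !size_cat !size_nseq addnA !sumn_cat !sumn_nseq !big_cat /= !big_nseq !iter_muln_1 addnA mulnA.
apply=> //; move=> x; rewrite !mem_cat !mem_nseq => /or3P [] /andP [_ /eqP ->] //.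
Qed.

(** * Asymptotics *)

Local Notation M := max_odd_holes.

Lemma max_odd_holes_attained n : exists G : sgraph 'I_n, nb_odd_holes G = M n.
Proof.
have e_sym : symmetric (fun _ _ : 'I_n => false) by [].
have e_irr : irreflexive (fun _ _ : 'I_n => false) by [].
have [|G e] := @bigop.eq_bigmax _ (@nb_odd_holes 'I_n).
  by apply/card_gt0P; exists (sgraph_of e_irr).
by exists G.
Qed.

Lemma odd_holes_at (V : finType) (G : sgraph V) (v : V) :
  nb_odd_holes G <= #|[set S | hole G S && (v \in S)]| + M #|V|.-1.
Proof.
rewrite /nb_odd_holes -(cardsID [set S : {set V} | v \in S]) leq_add //.
  by apply: subset_leq_card; apply/subsetP => S; rewrite !inE => /andP [/odd_hole_hole -> ->].
have := card_odd_holes_sub G [set~ v]; rewrite cardsC1; apply: leq_trans.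
apply: subset_leq_card; apply/subsetP => S; rewrite !inE => /andP [vS ->] /=.
by apply/subsetP => z zS; rewrite !inE; apply: contraNneq vS => <-.
Qed.

(** The case d = 4 of [E9_step] with a factor 9 cancelled. The growth 4/3 per vertex, combined with
    the ratio 4/5 of consecutive maxima, is the origin of 16/15. *)
Lemma E9S_ge m : 4 * E9 m <= 3 * E9 m.+1.
Proof.
have := E9_step m 4; rewrite (_ : m + 4 + 3 = m.+1 + 6); last by lia.
rewrite E9_6; lia.
Qed.

Lemma family_nb n (G : sgraph 'I_n) : 20 <= n -> extremal_family G ->
  27 * nb_odd_holes G = E9 (n + 3).
Proof.
move=> n20 [k [B [HB /extremal_sizesP [B234 ex]]]].
have ks := card_sizes B234; have ss := sum_sizes B234.
have := braid_sum HB; rewrite ss card_ord => en; rewrite card_ord in ks.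
rewrite -{1}en in ex; have [ok eE] := extremal_counts_prod ex; rewrite ks in ok.
have k5 : 5 <= k by move: ks en n20; clear; lia.
have B4 i : #|B i| <= 4 by have := B234 i; rewrite !inE => /or3P [] /eqP ->.
by rewrite (nb_odd_holes_braid HB k5 B4 ok) (prod_sizes B234) -eE en.
Qed.

Lemma braid_extremal n k (G : sgraph 'I_n) (B : 'I_k -> {set 'I_n}) :
  cyclic_braid_clusters G B -> odd k -> 5 <= k -> (forall i, 2 <= #|B i| <= 4) ->
  E9 (n + 3) <= 27 * nb_odd_holes G -> extremal_family G.
Proof.
move=> HB ok k5 B24 H; exists k, B; split=> //.
have B234 i : #|B i| \in [:: 2; 3; 4].
  by have := B24 i; rewrite !inE; case: #|B i| => [|[|[|[|[|m]]]]].
have ks := card_sizes B234; have ss := sum_sizes B234.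
have := braid_sum HB; rewrite ss card_ord => en; rewrite card_ord in ks.
have B4 i : #|B i| <= 4 by case/andP: (B24 i).
rewrite (nb_odd_holes_braid HB k5 B4 ok) (prod_sizes B234) in H.
apply/extremal_sizesP; split=> //; rewrite -{1}en.
by apply: extremal_counts_of_prod; rewrite ?ks // en.
Qed.

Section Asymptotics.
Local Open Scope ring_scope.
Variable F : archiRealFieldType.

(** A vertex of degree d offers d^2 pairs of neighbours to a hole but removes d vertices from the
    reservoir, whose worth in [gam] is exponential in d. This bounds the degrees of vertices lying
    in many holes. *)
Lemma degree_tradeoff : exists K : F, 1 <= K /\ forall d m,
  (d%:R + 1) * (d%:R ^+ 2 * gam F m) <= K * gam F (d + m)%N.
Proof.
exists (100%:R ^+ 3); split; first by apply: exprn_ege1; rewrite ler1n.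
move=> d m; have h := cube_le_betaX F d; move: h.
move: (100%:R ^+ 3 : F) (exprn_ge0 3 (ler0n F 100)) => K K0 h.
have b : beta F ^+ d <= (36%:R / 25%:R) ^+ d.
  apply: lerXn2r; rewrite ?nnegrE ?betaE; lra.
have g := gam_ge_exp F m d; have g0 := gam_ge0 F m.
apply: (@le_trans _ _ (K * ((36%:R / 25%:R) ^+ d * gam F m))); last by rewrite ler_wpM2l.
move: (gam F m) g0 {g} => z z0; rewrite !mulrA ler_wpM2r // -mulrA.
apply: (@le_trans _ _ (K * beta F ^+ d)); last by rewrite ler_wpM2l.
apply: le_trans h; have d0 := ler0n F d.
rewrite [(_ + 1) ^+ 3]exprS ler_wpM2l //; first by lra.
by rewrite expr2; move: (d%:R) d0 => x x0; nra.
Qed.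

Lemma holes_at_degree : exists K : F, 1 <= K /\ forall (V : finType) (G : sgraph V) (v : V),
  (#|neighbours G v|%:R + 1) * #|[set S | hole G S && (v \in S)]|%:R <= K * gam F #|V|.
Proof.
have [K [K1 H]] := degree_tradeoff; exists K; split=> // V G v.
have K0 : 0 <= K by lra.
have h1 := card_holes_at F (leqnn #|neighbours G v|).
have h2 := H #|neighbours G v| #|~: (v |: neighbours G v)|.
have d0 := ler0n F #|neighbours G v|.
apply: (@le_trans _ _ (K * gam F (#|neighbours G v| + #|~: (v |: neighbours G v)|)%N)).
  by apply: le_trans h2; rewrite ler_wpM2l //; lra.
rewrite ler_wpM2l // gam_homo // card_nonnbr.
have : (#|neighbours G v| < #|V|)%N.
  have -> : #|V| = #|[set: V]| by rewrite cardsT.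
  apply: proper_card; apply/properP; split; first exact: subsetT.
  by exists v; rewrite // in_nbr adjxx.
by move: #|neighbours G v| #|V|; clear; lia.
Qed.

(** Either a vertex lies in at least a fifth of the holes, and [holes_at_degree] bounds their
    number, or its removal loses less than a fifth of them, and then the factor 5/4 is absorbed by
    the growth 36/25 of [gam]. *)
Lemma max_odd_holes_upper : exists C : F, 0 < C /\ forall k, (M k)%:R <= C * gam F k.
Proof.
have [K [K1 HK]] := holes_at_degree; exists (5%:R * K); split; first by lra.
elim=> [|k IH].
  have [G <-] := max_odd_holes_attained 0.
  have : (nb_odd_holes G <= 1)%N.
    by apply: leq_trans (max_card _) _; rewrite -cardsT -powersetT card_powerset cardsT card_ord.
  rewrite gam0 mulr1 -(ler_nat F) => h; apply: (le_trans h); lra.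
have [G eG] := max_odd_holes_attained k.+1.
have := odd_holes_at G ord0; rewrite eG card_ord /= => h.
have := HK _ G ord0; rewrite card_ord => h2.
set x := #|[set S | _]| in h h2.
have {}h2 : x%:R <= K * gam F k.+1.
  apply: le_trans h2; rewrite ler_peMl ?ler0n //.
  by rewrite lerDr ler0n.
have g1 := gamS_ge F k; have g0 := gam_ge0 F k.
rewrite -(ler_nat F) natrD in h.
have : (M k.+1)%:R <= 5%:R * x%:R :> F \/ (M k.+1)%:R <= 5%:R / 4%:R * (M k)%:R :> F.
  have [h3|h3] := boolP ((M k.+1)%:R <= 5%:R * x%:R :> F); first by left.
  by right; move: h3; rewrite -ltNge; move: h; clear; move: (_%:R) (x%:R) (_%:R) => a b d; lra.
case=> h3; first by apply: (le_trans h3); lra.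
apply: (le_trans h3); apply: (@le_trans _ _ (5%:R / 4%:R * (5%:R * K * gam F k))).
  by rewrite ler_wpM2l //; lra.
rewrite mulrCA ler_wpM2l //; lra.
Qed.

Lemma gam_3k k m : gam F (3 * k + m)%N = 3%:R ^+ k * gam F m.
Proof.
elim: k => [|k IH]; first by rewrite mul1r.
have -> : (3 * k.+1 + m = (3 * k + m).+3)%N by lia.
by rewrite gam_add3 IH exprS mulrA.
Qed.

Lemma gam_6q q r : gam F (6 * q + r)%N = 9%:R ^+ q * gam F r.
Proof.
elim: q => [|q IH]; first by rewrite mul1r.
have -> : (6 * q.+1 + r = (6 * q + r).+3.+3)%N by lia.
by rewrite !gam_add3 IH exprS; ring.
Qed.

(** The smallest ratio is 300/13, at residue 5; the slightly smaller 459/20 = 27 * 17/20 becomes a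
    round number on division by 27. *)
Lemma gam_le_E9 n : 459%:R / 20%:R * gam F n <= (E9 (n + 3))%:R.
Proof.
rewrite {1 2}(divn_eq n 6); have := ltn_pmod n (isT : (0 < 6)%N).
move: (n %/ 6)%N (n %% 6)%N => q r r6.
rewrite [(q * 6)%N]mulnC -addnA E9D gam_6q natrM natrX mulrCA.
apply: ler_wpM2l; first by apply: exprn_ge0; apply: ler0n.
case: r r6 => [|[|[|[|[|[|r]]]]]] // _; rewrite ?gam_add3 ?gam0 ?gam1 ?gam2 /E9 /=; lra.
Qed.

Lemma extremal_of_large_step : exists n1, (20 <= n1)%N /\ forall n (G : sgraph 'I_n), (n1 <= n)%N ->
  nb_odd_holes G = M n -> (5 * M n.-1 <= 4 * M n)%N -> extremal_family G.
Proof.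
have [K [K1 HK]] := holes_at_degree.
have [C [C0 HC]] := max_odd_holes_upper.
(* The maximum is at least 17/20 * gam n, and by the assumption on [M n.-1] every vertex lies in at
   least a fifth of the holes of an extremal graph. *)
pose c : F := 17%:R / 100%:R.
have c0 : 0 < c by rewrite /c; lra.
have [D' HD'] := nat_above (K / c).
pose D := (D' + 3)%N.
(* 3^k is so large that the odd holes on n - 3k vertices number less than [E9 (n + 3)] / (27 * 32).
   The length k + 5 provides k layers from [X 2] on, with room for [seg_misses] behind them. *)
have [k Hk] := exp_above (27%:R * 32%:R * C / (459%:R / 20%:R)) (ltr0n F 2 : 0 < 2%:R :> F).
pose W := (k + 5)%N.
have [n0 Hn0] := @exists_clean_segment F c D W c0 (leq_addl _ _) (leq_trans (isT : (0 < 5)%N) (leq_addl _ _)).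
exists (n0 + (3 * k + 20))%N; split; first by rewrite addnA leq_addl.
move=> n G nn eG good.
have n20 : (20 <= n)%N by apply: leq_trans nn; rewrite addnA leq_addl.
have nn0 : (n0 <= n)%N by apply: leq_trans nn; rewrite leq_addr.
have n3k : (3 * k <= n)%N by move: nn; clear; lia.
have lowM := max_odd_holes_ge n20.
have g0 := gam_gt0 F n.
have gE := gam_le_E9 n.
have lowMF : (E9 (n + 3))%:R <= 27%:R * (M n)%:R :> F by rewrite -natrM ler_nat.
have goodF : 5%:R * (M n.-1)%:R <= 4%:R * (M n)%:R :> F by rewrite -!natrM ler_nat.
have at_v v : c * gam F n <= #|[set S | hole G S && (v \in S)]|%:R.
  have := odd_holes_at G v; rewrite eG card_ord -(ler_nat F) natrD.
  rewrite /c; move: (#|_|%:R : F) => x; lra.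
have deg v : (#|neighbours G v| <= D)%N.
  have := HK _ G v; rewrite card_ord => h.
  rewrite -(ler_nat F); have d0 := ler0n F #|neighbours G v|.
  have : (#|neighbours G v|%:R + 1) * (c * gam F n) <= K * gam F n.
    by apply: le_trans h; rewrite ler_wpM2l //; lra.
  rewrite mulrA ler_pM2r // -ler_pdivlMr // => h2.
  rewrite /D natrD; lra.
have [|||X seg] := Hn0 'I_n G; [by rewrite card_ord|exact: deg|by move=> v; rewrite card_ord|].
have W5 : (4 < W)%N by rewrite /W addnC.
have low : (31 * E9 (n + 3) < 32 * (27 * #|[set S | odd_hole G S && ~~ [disjoint S & X 2]]|))%N.
  set meet := #|_|; have := cardsID [set S : {set 'I_n} | ~~ [disjoint S & X 2]] [set S | odd_hole G S].
  rewrite -/(nb_odd_holes G) eG.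
  have -> : #|[set S | odd_hole G S] :&: [set S : {set 'I_n} | ~~ [disjoint S & X 2]]| = meet.
    by apply: eq_card => S; rewrite !inE.
  set miss := #|_| => eM.
  have cardB j : (j <= k)%N -> #|\bigcup_(i < j) X (2 + i)%N| = (3 * j)%N.
    elim: j => [|j IH] jk; first by rewrite big_ord0 cards0.
    have jW : (2 + j < W)%N by rewrite /W; move: jk; clear; lia.
    rewrite big_ord_recr /= cardsU IH ?(ltnW jk) //.
    have -> : #|X (2 + j)%N| = 3 by case: seg => h _ _; apply: h.
    rewrite (_ : _ :&: _ = set0) ?cards0 ?subn0; first by clear; lia.
    apply/setP => z; rewrite !inE; apply/negbTE/negP => /andP [/bigcupP [i _ zi] zj].
    have := seg_disj seg (_ : 2 + i < W)%N jW; rewrite /W.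
    have ij := ltn_ord i; move=> /(_ _ _) d.
    have d' : [disjoint X (2 + i)%N & X (2 + j)%N].
      by apply: d; move: ij jk; clear; lia.
    by rewrite (disjointFr d' zi) in zj.
  have missM : (miss <= M (n - 3 * k))%N.
    have <- : #|~: \bigcup_(i < k) X (2 + i)%N| = (n - 3 * k)%N.
      by rewrite cardsCs setCK cardB // card_ord.
    apply: leq_trans (card_odd_holes_sub G _); apply: subset_leq_card; apply/subsetP => S.
    rewrite !inE negbK => /andP [dis oS]; rewrite oS /=.
    rewrite -disjoints_subset; apply/bigcup_disjointP => i _.
    have := @seg_misses _ G X W seg S (2 + i)%N (odd_hole_hole oS) dis isT; apply.
    by have := ltn_ord i; rewrite /W; clear; lia.
  have h := HC (n - 3 * k)%N.
  have e3 : gam F n = 3%:R ^+ k * gam F (n - 3 * k)%N.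
    by rewrite -gam_3k subnKC.
  have small : (27 * 32 * miss < E9 (n + 3))%N.
    rewrite -(ltr_nat F) natrM.
    apply: (@le_lt_trans _ _ (27%:R * 32%:R * C * gam F (n - 3 * k)%N)).
      rewrite -[in X in _ <= X]mulrA -[in X in _ <= X]natrM; apply: ler_wpM2l; first exact: ler0n.
      by apply: le_trans h; rewrite ler_nat.
    apply: lt_le_trans gE; rewrite e3; move: (gam F (n - 3 * k)%N) (gam_gt0 F (n - 3 * k)%N) => g g1; rewrite [X in _ < X]mulrA ltr_pM2r //.
    move: Hk; rewrite ltr_pdivrMr; last by lra.
    by rewrite [X in _ < X]mulrC (_ : 1 + 2%:R = 3%:R :> F) //; ring.
  by move: small lowM eM; clear; lia.
set meet := #|_| in low.
have meet0 : 0 < meet%:R :> F by rewrite ltr0n; case: (meet) low => //; rewrite !muln0.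
have [u [y [u3 y1 Hpc]]] := many_paths W5 seg meet0 (lexx _).
set R := ~: _ in Hpc; set pc := par_cnt _ _ _ _ _ _ in Hpc.
have Hpc' : (meet <= 27 * pc)%N.
  by rewrite -(ler_nat F) natrM mulrC -ler_pdivrMr // ltr0n.
have cR : #|R| = (n - 9)%N.
  have c3 i : (i < W)%N -> #|X i| = 3 by case: seg => h _ _; apply: h.
  have d i j : (i < 4)%N -> (j < 4)%N -> i != j -> X i :&: X j = set0.
    move=> i4 j4 ij; apply/eqP; rewrite setI_eq0; apply: (seg_disj seg) => //.
      exact: leq_trans i4 (ltnW W5).
    exact: leq_trans j4 (ltnW W5).
  rewrite /R cardsCs setCK card_ord !cardsU setIUl !d // setU0 cards0 !subn0 !c3 //.
  - exact: leq_trans W5.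
  - exact: leq_trans W5.
  exact: leq_trans W5.
have Rn : (#|R| <= #|'I_n|)%N by rewrite max_card.
have [|Xs [ch oXs sXs]] := @chain_of_many_paths _ G y false #|'I_n| u R Rn.
  (* Fixing the three vertices in the cut layers divides the count by 27, and [E9 (n + 3)] is 27
     times the bound 3 * [E9 (n - 9)] for the remaining path, so the ratio 31/32 survives
     unchanged. *)
  rewrite /parity_bound cR -/pc.
  have : E9 (n + 3) = (81 * E9 (n - 9))%N.
    by rewrite (_ : n + 3 = 6 * 2 + (n - 9))%N ?E9D //; move: n20; clear; lia.
  by move: low Hpc'; move: (E9 _) (E9 _); clear; lia.
have s1 : (1 < size Xs)%N.
  case: Xs ch oXs {sXs} => [|X0 [|X1 Xs]] //= [R0 _] _.
  by move: cR; rewrite R0 cards0; move: n20; clear; lia.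
have br := braid_of_chain W5 seg u3 y1 ch s1.
apply: (braid_extremal br).
- by rewrite /= oXs.
- by [].
- move=> [[|[|[|i]]] iX] /=; try by rewrite (_ : #|_| = 3) //; case: seg => h _ _; apply: h; apply: leq_trans W5.
  by apply: sXs; rewrite mem_nth.
by rewrite eG.
Qed.

Lemma exists_no_large_step : exists n2, forall n, (n2 <= n)%N -> (5 * M n.-1 <= 4 * M n)%N.
Proof.
have [n1 [n120 Hn1]] := extremal_of_large_step.
have [C [C0 HC]] := max_odd_holes_upper.
have h15 : 0 < 15%:R^-1 :> F by rewrite invr_gt0 ltr0n.
have [J HJ] := exp_above (27%:R * C / (459%:R / 20%:R)) h15.
exists (n1 + J)%N => n nn; rewrite leqNgt; apply/negP => bad.
have key j : (j <= J)%N -> (16 ^ j * E9 (n - j + 3) <= 15 ^ j * (27 * M (n - j)))%N /\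
    (4 * M (n - j) < 5 * M (n - j).-1)%N.
  elim: j => [|j IH] jJ.
    rewrite subn0 !mul1n; split=> //; apply: max_odd_holes_ge.
    by apply: leq_trans n120 _; apply: leq_trans nn; apply: leq_addr.
  have [h1 h2] := IH (ltnW jJ).
  have en : (n - j = (n - j.+1).+1)%N by move: nn jJ n120; clear; lia.
  have h3 : (16 ^ j.+1 * E9 (n - j.+1 + 3) <= 15 ^ j.+1 * (27 * M (n - j.+1)))%N.
    have := E9S_ge (n - j.+1 + 3); move: h1 h2; rewrite en /= addSn !expnS.
    move: (n - j.+1)%N (16 ^ j)%N (15 ^ j)%N => m a b h1 h2 h4.
    move: (M m) (M m.+1) (E9 (m + 3)) (E9 (m + 3).+1) h1 h2 h4 => x z s t; clear; nia.
  split=> //; rewrite ltnNge; apply/negP => good.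
  have n1j : (n1 <= n - j.+1)%N by move: nn jJ; clear; lia.
  have [G eG] := max_odd_holes_attained (n - j.+1).
  have := family_nb (leq_trans n120 n1j) (Hn1 _ G n1j eG good); rewrite eG => e.
  move: h3; rewrite e leq_pmul2r ?E9_gt0 // leq_exp2r //.
have [h _] := key J (leqnn J).
have g := gam_le_E9 (n - J); have c := HC (n - J)%N; have g0 := gam_gt0 F (n - J)%N.
move: h g; move: (E9 _) => E h g.
move: h; apply/negP; rewrite -ltnNge -(ltr_nat F) !natrM.
apply: (@le_lt_trans _ _ ((15 ^ J)%:R * (27%:R * C * gam F (n - J)%N))).
  by rewrite -[27%:R * C * _]mulrA ler_wpM2l ?ler0n // ler_wpM2l ?ler0n.
apply: (@lt_le_trans _ _ ((16 ^ J)%:R * (459%:R / 20%:R * gam F (n - J)%N))); last first.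
  by rewrite ler_wpM2l ?ler0n.
move: (gam F (n - J)%N) g0 {g c} => g g0; rewrite !mulrA ltr_pM2r // -!mulrA.
have e16 : (16 ^ J)%:R = (15 ^ J)%:R * (1 + 15%:R^-1) ^+ J :> F.
  by rewrite !natrX -exprMn; congr (_ ^+ J); field.
rewrite e16 -mulrA ltr_pM2l ?ltr0n ?expn_gt0 //.
by move: HJ; rewrite ltr_pdivrMr //; lra.
Qed.

End Asymptotics.

Theorem theorem1p7 :
  exists n0 : nat, forall n : nat, n0 <= n ->
    forall G : sgraph 'I_n,
      nb_odd_holes G = max_odd_holes n <-> extremal_family G.
Proof.
have [n1 [n120 H1]] := extremal_of_large_step rat.
have [n2 H2] := exists_no_large_step rat.
exists (n1 + n2) => n nn G.
have nn1 : n1 <= n by apply: leq_trans nn; rewrite leq_addr.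
have good : 5 * M n.-1 <= 4 * M n by apply: H2; apply: leq_trans nn; rewrite leq_addl.
split=> [eG|fG]; first exact: H1 nn1 eG good.
have n20 := leq_trans n120 nn1.
(* For the converse, all members of the family have the same number of odd holes, and a graph
   attaining the maximum is one of them. *)
have [G0 e0] := max_odd_holes_attained n.
have := family_nb n20 fG; rewrite -(family_nb n20 (H1 n G0 nn1 e0 good)) e0 => /eqP.
by rewrite eqn_pmul2l // => /eqP.
Qed.
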